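(* There is a polynomial time algorithm that produces from a given 3-CNF formula $\phi$ with $t$ variables a pure $2$-dimensional connected simplicial complex $L_\phi$ with $\tilde\chi(L_\phi) = t$ such that the following statements are equivalent: (i) The formula $\phi$ is satisfiable. (ii) The complex $L_\phi$ is shellable. (iii) The complex $L_\phi$ is collapsible after removing some $t$ triangles. (iv) $\operatorname{wsat}(L_\phi^{(1)}, K_3) = n-1$, where $n$ is the number of vertices of $L_\phi$. (v) The complex $L_\phi$ is collapsible after removing some number of triangles.
   Context: A 3-CNF formula is a Boolean formula in conjunctive normal form in which each clause contains three literals. Simplicial complexes. A (finite abstract) simplicial complex is a finite set system $K$ of finite sets such that if $\sigma\in K$ and $\tau\subseteq\sigma$ then $\tau\in K$. Its set of vertices is $\bigcup K$. Elements of $K$ are faces; the dimension of a face $\sigma$ is $|\sigma|-1$ (so the empty face has dimension $-1$); faces of dimension $1$ are edges and faces of dimension $2$ are triangles. The dimension $\dim K$ is the maximum dimension of a face. The $k$-skeleton $K^{(k)}$ is the subcomplex of all faces of dimension at most $k$; graphs are regarded as (at most) $1$-dimensional simplicial complexes, so $K^{(1)}$ is a graph. A facet is an inclusion-maximal face, and $K$ is pure if all its facets have the same dimension. Removing triangles from a $2$-dimensional complex means deleting these $2$-dimensional faces while keeping all other faces (in particular all edges and vertices). Shellability. For faces $\vartheta_1,\dots,\vartheta_k$ of $K$, $K[\vartheta_1,\dots,\vartheta_k]$ denotes the subcomplex formed by the faces $\sigma$ with $\sigma\subseteq\vartheta_i$ for some $i\in\{1,\dots,k\}$. A pure $d$-dimensional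 complex $K$ is shellable if there is an ordering $\vartheta_1,\dots,\vartheta_m$ of all facets of $K$ such that for every $i\in\{2,\dots,m\}$ the complex $K[\vartheta_i]\cap K[\vartheta_1,\dots,\vartheta_{i-1}]$ is pure and $(d-1)$-dimensional. Collapsibility. A complex $K'$ arises from $K$ by an elementary collapse if there is a face $\tau$ of $K$ contained in a single facet $\sigma$ distinct from $\tau$, and $K'$ is obtained from $K$ by removing all faces containing $\tau$. $K$ collapses to a subcomplex $L$ if there is a sequence $K=K_1,K_2,\dots,K_\ell=L$ of complexes such that $K_{i+1}$ is obtained from $K_i$ by an elementary collapse for each $i\in\{1,\dots,\ell-1\}$. $K$ is collapsible if it collapses to a point (an arbitrary vertex of $K$). Reduced Euler characteristic. $\tilde\chi(K)=\sum_{i=-1}^{\dim K}(-1)^i f_i(K)$, where $f_i(K)$ is the number of $i$-dimensional faces of $K$ (the empty face is counted for $i=-1$). Weak saturation. $K_3$ denotes the complete graph on three vertices. Let $F$ and $H$ be graphs and let $G$ be a spanning subgraph of $F$. $G$ is weakly $H$-saturated in $F$ if the edges of $E(F)\setminus E(G)$ can be ordered into a sequence $e_1,\dots,e_m$ such that for every $i\in\{1,\dots,m\}$ the graph obtained from $G$ by adding $e_1,\dots,e_i$ contains a copy of $H$ which contains $e_i$. The weak saturation number $\operatorname{wsat}(F,H)$ is the minimum number of edges of a graph which is weakly $H$-saturated in $F$. *)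

(* Defs.v *)
From mathcomp Require Import all_boot all_order all_algebra finmap.
From mathcomp Require Import boolp.

Set Implicit Arguments.
Unset Strict Implicit.
Unset Printing Implicit Defensive.

Import Order.TTheory GRing.Theory Num.Theory.

Local Open Scope fset_scope.
Local Open Scope nat_scope.

(* 3-CNF formulas. The literal (i, true) is x_i and (i, false) is its negation.
   The three literals of a clause need not be distinct, and a variable need not
   occur in any clause. *)

Record cnf3 : Type := Cnf3 {
  nvars : nat;
  clauses : seq (3.-tuple ('I_nvars * bool))
}.

Definition satisfiable (phi : cnf3) : Prop :=
  exists a : {ffun 'I_(nvars phi) -> bool},
    all (fun c : 3.-tuple _ => has (fun l => a l.1 == l.2) c) (clauses phi).

(* Simplicial complexes *)

Section Complexes.
Variable V : choiceType.
Implicit Types (K L : {fset {fset V}}) (s t : {fset V}).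

Definition simplicial K : Prop := forall s t, s \in K -> t `<=` s -> t \in K.

Definition vertices K : {fset V} := \bigcup_(s <- K) s.

Definition fdim s : int := (#|` s|%:Z - 1)%R.

(* The maximum is at least -1 because every face has dimension at least -1. *)
Definition dimension K : int := (\big[Num.max/-1]_(s <- K) fdim s)%R.

Definition faces K (i : int) : {fset {fset V}} := [fset s in K | fdim s == i].

Definition skeleton (k : int) K : {fset {fset V}} :=
  [fset s in K | (fdim s <= k)%R].

Definition facet K s : Prop :=
  s \in K /\ forall t, t \in K -> s `<=` t -> t = s.

Definition pure K : Prop := forall s t, facet K s -> facet K t -> fdim s = fdim t.

Definition connected K : Prop :=
  forall u v, u \in vertices K -> v \in vertices K ->
  exists2 p : seq V, path (fun x y => [fset x; y] \in K) u p & last u p = v.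

(* The index k stands for the dimension k - 1, ranging over -1, ..., dim K. *)
Definition reduced_euler K : int :=
  (\sum_(0 <= k < `|(dimension K + 2)%R|%N)
     (-1) ^ (k%:Z - 1) * #|` faces K (k%:Z - 1)|%:Z)%R.

Definition spanned K (ths : seq {fset V}) : {fset {fset V}} :=
  [fset s in K | has (fun th => s `<=` th) ths].

Definition shellable K : Prop :=
  pure K /\
  exists ths : seq {fset V},
    [/\ uniq ths,
        forall s, s \in ths <-> facet K s &
        forall i, 0 < i < size ths ->
          let I := spanned K [:: nth fset0 ths i] `&` spanned K (take i ths) in
          pure I /\ dimension I = (dimension K - 1)%R].

Definition elementary_collapse K K' : Prop :=
  exists t s,
    [/\ t \in K, t != s,
        forall r, facet K r /\ t `<=` r <-> r = s &
        K' = [fset r in K | ~~ (t `<=` r)]].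

Inductive collapses : {fset {fset V}} -> {fset {fset V}} -> Prop :=
| collapses_refl K : collapses K K
| collapses_step K K' L :
    elementary_collapse K K' -> collapses K' L -> collapses K L.

Definition collapsible K : Prop :=
  exists2 v, v \in vertices K & collapses K [fset fset0; [fset v]].

End Complexes.

Definition complex_of (V : choiceType) (s : seq (seq V)) : {fset {fset V}} :=
  \bigcup_(f <- s) fpowerset [fset x in f].

(* Weak saturation. A graph is a simplicial complex of dimension at most 1. *)

Definition K3 : {fset {fset nat}} :=
  skeleton 1 (complex_of [:: [:: 0; 1; 2]]).

Section WeakSaturation.
Variables (V W : choiceType) (H : {fset {fset W}}).
Implicit Types (F G : {fset {fset V}}) (e : {fset V}).

Definition has_copy_through G e : Prop :=
  exists f : W -> V,
    [/\ {in vertices H &, injective f},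
        forall h, h \in H -> f @` h \in G &
        exists2 h, h \in H & f @` h = e].

Definition weakly_saturated F G : Prop :=
  [/\ simplicial G, G `<=` F, vertices G = vertices F &
      exists es : seq {fset V},
        [/\ uniq es,
            es =i faces F 1 `\` faces G 1 &
            forall i, i < size es ->
              has_copy_through (G `|` [fset e in take i.+1 es])
                               (nth fset0 es i)]].

End WeakSaturation.

(* A graph F is weakly H-saturated in itself, so the default value of the
   minimum is one of the values over which it is taken. *)
Definition wsat (V W : choiceType) (F : {fset {fset V}}) (H : {fset {fset W}}) :
    nat :=
  \big[minn/#|` faces F 1|]_(G <- fpowerset F | `[< weakly_saturated H F G >])
     #|` faces G 1|.

(* Deterministic multitape Turing machines with two-way infinite tapes. Tape
   symbols are the blank None, the input/output symbols Some (inl b), and the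
   work symbols Some (inr a). *)

Section Tapes.
Variable A : Type.

(* tape_left is listed from the head outwards; beyond both lists the tape is
   blank. *)
Record tape : Type := Tape {
  tape_left : seq (option A);
  tape_head : option A;
  tape_right : seq (option A)
}.

Inductive move : Type := Left | Stay | Right.

Definition tape_write (a : option A) (tp : tape) : tape :=
  Tape (tape_left tp) a (tape_right tp).

Definition tape_move (d : move) (tp : tape) : tape :=
  let: Tape l a r := tp in
  match d with
  | Left => Tape (behead l) (head None l) (a :: r)
  | Stay => tp
  | Right => Tape (a :: l) (head None r) (behead r)
  end.

End Tapes.

Record machine : Type := Machine {
  mstate : finType;
  mwork : finType;
  mtapes : nat;  (* the machine has mtapes + 1 tapes *)
  mstart : mstate;
  mhalt : pred mstate;
  mdelta : mstate -> {ffun 'I_mtapes.+1 -> option (bool + mwork)} ->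
           mstate * {ffun 'I_mtapes.+1 -> option (bool + mwork) * move}
}.

Section Run.
Variable M : machine.

Definition symbol : Type := (bool + mwork M)%type.

Definition config : Type :=
  (mstate M * {ffun 'I_(mtapes M).+1 -> tape symbol})%type.

Definition step (c : config) : config :=
  if mhalt c.1 then c else
  let: (q, act) := mdelta c.1 [ffun i => tape_head (c.2 i)] in
  (q, [ffun i => tape_move (act i).2 (tape_write (act i).1 (c.2 i))]).

Definition tape_of_word (w : seq bool) : tape symbol :=
  let u : seq (option symbol) := [seq Some (inl b) | b <- w] in
  Tape [::] (head None u) (behead u).

(* The word is read from the head rightwards, up to the first cell that does
   not hold an input/output symbol. *)
Fixpoint read_word (u : seq (option symbol)) : seq bool :=
  if u is Some (inl b) :: u' then b :: read_word u' else [::].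

Definition word_of_tape (tp : tape symbol) : seq bool :=
  read_word (tape_head tp :: tape_right tp).

Definition init (w : seq bool) : config :=
  (mstart M,
   [ffun i => if i == ord0 then tape_of_word w else tape_of_word [::]]).

Definition outputs_within (n : nat) (w v : seq bool) : Prop :=
  let c := iter n step (init w) in
  mhalt c.1 /\ word_of_tape (c.2 ord_max) = v.

End Run.

Definition poly_time (X Y : Type) (encX : X -> seq bool) (encY : Y -> seq bool)
    (f : X -> Y) : Prop :=
  exists (M : machine) (c k : nat), forall x : X,
    outputs_within M (c * (size (encX x)).+1 ^ k) (encX x) (encY (f x)).

(* Self-delimiting binary words. Numbers are written in unary; for a variable
   index i < nvars phi this is polynomially equivalent to binary, since the
   length of the code of phi is in any case at least nvars phi. *)

Definition enc_nat (n : nat) : seq bool := rcons (nseq n true) false.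

Definition enc_seq (X : Type) (enc : X -> seq bool) (s : seq X) : seq bool :=
  foldr (fun x w => true :: enc x ++ w) [:: false] s.

Definition enc_literal (t : nat) (l : 'I_t * bool) : seq bool :=
  l.2 :: enc_nat l.1.

Definition enc_clause (t : nat) (c : 3.-tuple ('I_t * bool)) : seq bool :=
  flatten [seq enc_literal l | l <- c].

Definition enc_cnf3 (phi : cnf3) : seq bool :=
  enc_nat (nvars phi) ++ enc_seq (@enc_clause (nvars phi)) (clauses phi).

Definition enc_complex : seq (seq nat) -> seq bool := enc_seq (enc_seq enc_nat).

(* Main.v *)
(* A region is a triangulated disc whose boundary consists of two hairs, paths from
   a common apex to the tip of the region; it may cover further hairs, which are
   glued into its interior. It can be collapsed away as soon as it has lost a
   triangle or one of its two boundary hairs is no longer covered elsewhere.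
   A variable yields two regions with the same boundary, that is, a sphere. Each
   sphere must lose a triangle, so removing t triangles opens exactly one side of
   each sphere, and this side is read as the value of the variable. The side of a
   literal covers one hair for each occurrence of the literal. Two regions per
   clause compute the disjunction of its literals: the first can be collapsed once
   the side of one of the first two literals is gone, the second once the first
   one or the side of the third literal is gone. The second regions of all clauses
   cover the boundary of a hub region, which in turn covers the boundaries of all
   spheres. So everything collapses if every clause has a literal on an opened
   side; otherwise the regions of an unsatisfied clause, the hub and the unopened
   sides form a subcomplex without free edges. Conversely, collapsing a satisfied
   instance backwards is a shelling in which the removed triangles come last.
   A shelling adds a triangle along its whole boundary exactly chi(L) = t times,
   and without these triangles it is a collapse read backwards. The collapse of
   triangles read backwards adds edges that close triangles, which is a percolation
   from a spanning tree; it can be reversed because every 3-clique of the graph is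
   a face.
   The reduction is computed by a program on stacks of bits, each of them held on a
   tape of the machine. *)
From HB Require Import structures.
Require Import Defs.
From mathcomp Require Import all_boot all_order all_algebra finmap boolp zify.

Set Implicit Arguments.
Unset Strict Implicit.
Unset Printing Implicit Defensive.

Import Order.TTheory GRing.Theory Num.Theory.

Local Open Scope fset_scope.
Local Open Scope nat_scope.

(** * Euler characteristic and collapses *)

Section Complexes.
Variable V : choiceType.
Implicit Types (K L : {fset {fset V}}) (s t r : {fset V}) (l : seq (seq V)).

(** The forbidden pattern in a shelling is a triangle meeting the earlier ones in an edge and the
    isolated opposite vertex. Since all hairs start at the apex, the triangles at the apex can be
    shelled before all others without meeting this pattern: a vertex that is present is then joined
    to the apex. Afterwards only the tips need care. A hair cannot be inserted when its tip was
    already reached along the other hair ending there. The order of filling exists to avoid this,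
    and the truth of a clause enters only at its third slot, where the companion hair bounds the
    second region of the clause and is covered by the first. Regions are subdivided as finely as
    they are because every 3-clique must be a face: the private vertices of a block keep covered
    tips away from ring vertices and from the tip of the region. The Euler characteristic is a count
    of circles. The hairs form one circle for each tip, each region fills one circle, and there are
    [t] more regions than tips because the two sides of a variable share a tip. As a collapsible
    complex has characteristic 0, an arbitrary removal in the last statement consists of exactly [t]
    triangles, which closes the cycle of implications. *)

Lemma in_fsep (T : choiceType) (A : {fset T}) (P : pred T) x :
  (x \in [fset y in A | P y]) = (x \in A) && P x.
Proof. by rewrite !inE. Qed.

Lemma fproperP s t : reflect (s `<=` t /\ exists2 x, x \in t & x \notin s) (s `<` t).
Proof.
rewrite fproperE; apply: (iffP andP) => -[st]; first by case/fsubsetPn => x xt xs; split=> //; exists x.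
by case=> x xt xs; split=> //; apply/fsubsetPn; exists x.
Qed.

Lemma in_complex_of l s : (s \in complex_of l) = has (fun f => s `<=` [fset x in f]) l.
Proof.
rewrite /complex_of; elim: l => [|f l IH]; first by rewrite big_nil.
by rewrite big_cons in_fsetU fpowersetE IH.
Qed.

Lemma complex_of_simplicial l : simplicial (complex_of l).
Proof.
move=> s t; rewrite !in_complex_of => /hasP[f fl sf] ts.
by apply/hasP; exists f => //; apply: fsubset_trans sf.
Qed.

Lemma in_vertices K x : simplicial K -> (x \in vertices K) = ([fset x] \in K).
Proof.
move=> sK; apply/idP/idP.
  by case/bigfcupP => s /andP[sK' _] xs; apply: (sK s) => //; rewrite fsub1set.
by move=> xK; apply/bigfcupP; exists [fset x]; rewrite ?xK // in_fset1.
Qed.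

Lemma dimensionE K (d : nat) :
  (forall s, s \in K -> #|` s| <= d) -> (exists2 s, s \in K & #|` s| = d) ->
  dimension K = (d%:Z - 1)%R.
Proof.
move=> le_d [s sK sd]; apply/eqP; rewrite eq_le; apply/andP; split.
  rewrite /dimension big_seq; apply: (big_ind (fun x => (x <= d%:Z - 1)%R)).
  - lia.
  - by move=> x y hx hy; rewrite ge_max hx.
  - by move=> t /le_d; rewrite /fdim; lia.
rewrite /dimension; have: s \in enum_fset K by [].
elim: (enum_fset K) => // t r IH; rewrite inE big_cons le_max => /orP[/eqP <-|/IH ->].
  by rewrite /fdim sd lexx.
by rewrite orbT.
Qed.

Lemma dimension_ub K s : s \in K -> (fdim s <= dimension K)%R.
Proof.
rewrite /dimension; change (s \in K) with (s \in enum_fset K).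
elim: (enum_fset K) => // t r IH; rewrite inE big_cons le_max => /orP[/eqP <-|/IH ->].
  by rewrite lexx.
by rewrite orbT.
Qed.

Lemma in_faces K i s : (s \in faces K i) = (s \in K) && (fdim s == i).
Proof. by rewrite !inE. Qed.

Lemma fdimE s (d : nat) : (fdim s == d%:Z)%R = (#|` s| == d.+1).
Proof. by rewrite /fdim; lia. Qed.

(** The exponent is the dimension plus two: the parity is unchanged, and it is a natural number also
    for the empty face. *)
Definition euler K : int := (\sum_(s <- K) (-1) ^+ #|` s|.+1)%R.

Lemma reduced_eulerE K : reduced_euler K = euler K.
Proof.
rewrite /reduced_euler; set n := `|_|.
have le_n s : s \in K -> #|` s| < n.
  by move=> /dimension_ub; rewrite /n /fdim; lia.
transitivity (\sum_(0 <= k < n) \sum_(s <- K | #|` s| == k) ((-1) ^+ #|` s|.+1 : int))%R.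
  apply: eq_bigr => k _.
  rewrite (_ : faces K _ = [fset s in K | #|` s| == k]); last first.
    by apply/fsetP => s; rewrite !inE /fdim; congr (_ && _); lia.
  have -> : ((-1) ^ (k%:Z - 1) = (-1) ^+ k.+1 :> int)%R.
    case: k => [|k] //; have -> : (k.+1%:Z - 1 = k%:Z)%R by lia.
    by rewrite -exprnP 2!exprS !mulN1r opprK.
  rewrite card_fset_sum1 /=.
  transitivity (\sum_(s <- [fset s in K | #|` s| == k]) (-1) ^+ k.+1 : int)%R; last first.
    by rewrite !big_fset /=; apply: eq_bigr => s /eqP ->.
  rewrite (big_morph Posz PoszD (erefl (Posz 0))) mulr_sumr.
  by apply: eq_bigr => s _; rewrite mulr1.
under eq_bigr => k _ do rewrite big_mkcond /=.
rewrite exchange_big /= /euler !big_seq; apply: eq_bigr => s /le_n lt_n.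
by rewrite -big_mkcond big_mkord (big_pred1 (Ordinal lt_n)).
Qed.
End Complexes.

Section Euler.
Variable V : choiceType.
Implicit Types (K L A B : {fset {fset V}}) (s t r : {fset V}) (l : seq (seq V)).

Lemma eulerU A B : [disjoint A & B]%fset -> euler (A `|` B) = (euler A + euler B)%R.
Proof.
move=> dAB; rewrite /euler (big_fsetID _ (mem A)) /=; congr (_ + _)%R; apply: eq_fbigl => s.
  by rewrite !inE /=; case: (s \in A) => //=; rewrite andbF.
rewrite !inE /=; have := fdisjointP dAB s; case: (s \in A) => //= ns; last by rewrite andbT.
by rewrite (negbTE (ns _)).

Qed.

Lemma eulerD A B : B `<=` A -> euler A = (euler B + euler (A `\` B))%R.
Proof.
move=> BA; rewrite -eulerU; last by apply/fdisjointP => s sB; rewrite inE sB.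
congr euler; apply/fsetP => s; rewrite !inE.
by case sB: (s \in B) => //=; rewrite (fsubsetP BA).
Qed.

Lemma euler1 s : euler [fset s] = ((-1) ^+ #|` s|.+1)%R.
Proof. by rewrite /euler big_seq_fset1. Qed.

(** Adding or deleting [x] is an involution of [A] that changes every sign, so the sum equals its
    own negative. Cones and the sets of faces removed by collapses both have this shape. *)
Lemma euler_toggle A x :
  (forall s, s \in A -> (x |` s \in A) && (s `\ x \in A)) -> euler A = 0%R.
Proof.
move=> tA; pose g s := if x \in s then s `\ x else x |` s.
have gA s : s \in A -> g s \in A by rewrite /g => /tA/andP[]; case: ifP.
have gK : involutive g.
  move=> s; rewrite /g; case: (boolP (x \in s)) => xs.
    by rewrite !inE eqxx fsetD1K.
  by rewrite !inE eqxx fsetU1K.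
have gAA : g @` A = A.
  apply/fsetP => s; apply/imfsetP/idP => [[r /= /gA rA ->] //|sA].
  by exists (g s); rewrite ?gK //=; apply: gA.
have : (euler A = - euler A)%R.
  rewrite -{1}gAA /euler big_imfset /=; last by move=> s r _ _; apply: (inv_inj gK).
  rewrite -sumrN; apply: eq_bigr => s _; rewrite /g; case: ifPn => xs.
    by rewrite [in RHS](cardfsD1 x s) xs add1n [in RHS]exprS mulN1r opprK.
  by rewrite cardfsU1 xs exprS mulN1r.
lia.
Qed.

Lemma euler_fpowerset s : s != fset0 -> euler (fpowerset s) = 0%R.
Proof.
case/fset0Pn => x xs; apply: (@euler_toggle _ x) => r; rewrite !fpowersetE => rs.
rewrite fsubUset fsub1set xs rs /=; exact: fsubset_trans (fsubD1set _ _) rs.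
Qed.

(** Inclusion-exclusion, where the full simplex contributes 0. *)
Lemma euler_addface K s : s != fset0 ->
  (euler (K `|` fpowerset s) = euler K - euler (K `&` fpowerset s))%R.
Proof.
move=> s0; rewrite (@eulerD (K `|` _) K) ?fsubsetUl //.
have -> : (K `|` fpowerset s) `\` K = fpowerset s `\` (K `&` fpowerset s).
  by apply/fsetP => r; rewrite !in_fsetD in_fsetI in_fsetU; case: (r \in K); case: (r \in fpowerset s).
have := @eulerD (fpowerset s) (K `&` fpowerset s) (fsubsetIr _ _).
by rewrite euler_fpowerset // => /eqP; rewrite eq_sym addrC addr_eq0 => /eqP ->.
Qed.

(** The part of [K] inside [s] is a cone with apex [x], so gluing the simplex along it changes
    nothing. *)
Lemma euler_addcone K s x : simplicial K -> x \in s ->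
  (forall r, r \in K -> r `<=` s -> x |` r \in K) ->
  euler (K `|` fpowerset s) = euler K.
Proof.
move=> sK xs cK; rewrite euler_addface; last by apply/fset0Pn; exists x.
rewrite [X in (_ - X)%R](@euler_toggle _ x) ?subr0 // => r; rewrite !in_fsetI !fpowersetE.
case/andP => rK rs; rewrite fsubUset fsub1set xs rs cK //=.
rewrite (sK r) ?fsubD1set //=; exact: fsubset_trans (fsubD1set _ _) rs.
Qed.

Lemma euler_addfull K s : s != fset0 -> s \notin K ->
  (forall r, r `<` s -> r \in K) ->
  (euler (K `|` fpowerset s) = euler K + (-1) ^+ #|` s|.+1)%R.
Proof.
move=> s0 sK bK.
have -> : K `|` fpowerset s = K `|` [fset s].
  apply/fsetP => r; rewrite !in_fsetU fpowersetE in_fset1; case: eqVneq => [->|rs].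
    by rewrite fsubset_refl.
  by rewrite orbF; apply/orP/idP => [[//|rs']|->]; [apply: bK; rewrite fproperEneq rs|left].
rewrite eulerU ?euler1 //; apply/fdisjointP => r rK; rewrite in_fset1.
by apply: contraNneq sK => <-.
Qed.

End Euler.

Section Collapse.
Variable V : choiceType.
Implicit Types (K L : {fset {fset V}}) (s t r : {fset V}).

Lemma facet_exists K r : r \in K -> exists2 s, facet K s & r `<=` s.
Proof.
have [n] := ubnP #|` [fset t in K | r `<=` t]|.
elim: n r => // n IH r lt_n rK; case: (pselect (facet K r)) => [|nf]; first by exists r.
have [t [tK rt tr]] : exists t, [/\ t \in K, r `<=` t & t <> r].
  apply: contra_notP nf => H; split=> // t tK rt.
  by apply: contra_notP H => tr; exists t.
have [|s fs ts] := IH t _ tK; last by exists s => //; apply: fsubset_trans ts.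
rewrite -ltnS; apply: leq_trans lt_n; rewrite ltnS; apply/fproper_ltn_card/fproperP; split.
  by apply/fsubsetP => u; rewrite !inE /= => /andP[-> tu]; apply: fsubset_trans tu.
exists r; rewrite !inE /= rK ?fsubset_refl //=.
by apply/negP => /(conj rt)/andP; rewrite -eqEfsubset => /eqP/esym.
Qed.

(** Every face extends to a facet, so uniqueness of the facet above [t] amounts to all faces
    containing [t] lying in [s], a form that can be tested without reference to facets. *)
Lemma elementary_collapseP K K' : elementary_collapse K K' ->
  exists t s, [/\ facet K s, t `<` s, forall r, r \in K -> t `<=` r -> r `<=` s &
    K' = [fset r in K | ~~ (t `<=` r)]].
Proof.
case=> t [s [tK ts fs ->]]; exists t, s.
have [fKs t_s] : facet K s /\ t `<=` s by apply/fs.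
split=> //; first by rewrite fproperEneq ts.
move=> r rK tr; have [u fu ru] := facet_exists rK.
by rewrite -(_ : u = s) //; apply/fs; split=> //; apply: fsubset_trans ru.
Qed.

Lemma elementary_collapseI K s t : facet K s -> t `<` s -> simplicial K ->
  (forall r, r \in K -> t `<=` r -> r `<=` s) ->
  elementary_collapse K [fset r in K | ~~ (t `<=` r)].
Proof.
move=> fs ts sK ub; have [sK' ms] := fs; exists t, s; split=> //.
- by apply: sK sK' _; apply: fproper_sub.
- by move: ts; rewrite fproperEneq => /andP[].
move=> r; split=> [[fr tr]|->]; last by split=> //; apply: fproper_sub.
have [rK mr] := fr; apply/esym/mr => //; exact: ub.
Qed.

Lemma elementary_collapse_simplicial K K' :
  simplicial K -> elementary_collapse K K' -> simplicial K'.
Proof.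
move=> sK [t [s [_ _ _ ->]]] r u; rewrite !inE /= => /andP[rK tr] ur.
rewrite (sK r) //=; apply: contraNN tr => tu; exact: fsubset_trans ur.
Qed.

Lemma elementary_collapse_euler K K' :
  simplicial K -> elementary_collapse K K' -> euler K = euler K'.
Proof.
move=> sK /elementary_collapseP[t [s [[sK' _] ts ub ->]]].
set K1 := [fset r in K | _].
rewrite (@eulerD _ K K1); last by apply/fsubsetP => r; rewrite !inE => /andP[].
have /fproperP[t_s [x xs xt]] := ts.
(* The removed faces are those between [t] and [s]; toggling a vertex [x] of [s] outside [t]
   permutes them. *)
rewrite (@euler_toggle _ (K `\` K1) x) ?addr0 // => r.
rewrite !inE /= => /andP[]; case rK : (r \in K) => //=; rewrite negbK => tr _.
have rs := ub r rK tr.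
rewrite (sK s) ?fsubUset ?fsub1set ?xs //= (sK r) ?fsubD1set //= negbK negbK.
rewrite (fsubset_trans tr) ?fsubsetUr //=; rewrite andbT; apply/fsubsetP => y yt; rewrite !inE.
by rewrite (fsubsetP tr) // andbT; apply: contraNneq xt => <-.
Qed.

Lemma collapsible_euler K : simplicial K -> collapsible K -> euler K = 0%R.
Proof.
move=> sK [v _ cK]; transitivity (euler [fset fset0; [fset v]]).
  move: cK sK; elim=> // {}K K' L cK _ IH sK.
  by rewrite (elementary_collapse_euler sK cK) IH //; apply: elementary_collapse_simplicial cK.
apply: (@euler_toggle _ _ v) => s; rewrite !inE => /orP[] /eqP ->.
  by rewrite fsetU0 eqxx orbT fset0D eqxx.
by rewrite fsetUid eqxx orbT fsetDv eqxx.
Qed.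

Lemma collapses_trans K1 K2 K3 : collapses K1 K2 -> collapses K2 K3 -> collapses K1 K3.
Proof. by elim=> // K K' L cK _ IH /IH; apply: collapses_step. Qed.

(* No face of S can ever become part of a free pair. *)
Lemma core_not_collapsible K (S : {fset V} -> Prop) :
  (forall s, s \in K -> #|` s| <= 3) ->
  (exists s, S s) -> (forall s, S s -> s \in K /\ #|` s| = 3) ->
  (forall s x, S s -> x \in s -> exists s', [/\ S s', s' <> s & s `\ x `<=` s']) ->
  ~ collapsible K.
Proof.
move=> dK [s0 Ss0] SK coreS [v _ cK].
suff: s0 \in [fset fset0; [fset v]].
  by case: (SK _ Ss0) => _ + /fset2P[] E; rewrite E ?cardfs0 ?cardfs1.
have {Ss0} : S s0 by [].
elim: cK dK SK s0 => [L|{}K K' L eK _ IH] dK SK s0 Ss0; first by case: (SK _ Ss0).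
apply: IH Ss0 => [s|s Ss].
  by case: eK => t [s' [_ _ _ ->]]; rewrite !inE => /andP[/dK].
have [sK s3] := SK _ Ss; split=> //.
have [t [s' [[sK' ms'] ts ub ->]]] := elementary_collapseP eK.
rewrite !inE sK /=; apply/negP => t_s.
have maxS r u : S r -> u \in K -> r `<=` u -> r = u.
  move=> Sr uK ru; apply/eqP; rewrite eqEfcard ru (SK _ Sr).2; exact: dK.
have Es' : s = s' by apply: maxS => //; apply: ub.
(* If the collapse removed [s], then [s] would be its facet. Dropping a vertex [x] outside [t]
   leaves an edge of [s] that still contains [t] and lies in another triangle of [S], against the
   uniqueness of the facet. *)
have /fproperP[_ [x xs xt]] := ts.
have [|r [Sr rs sr]] := coreS s x Ss; first by rewrite Es'.
apply: rs; rewrite Es'; apply: maxS => //; apply: ub; first by case: (SK _ Sr).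
apply: fsubset_trans sr; apply/fsubsetP => y yt; rewrite !inE (fsubsetP t_s) // andbT.
by apply: contraNneq xt => <-.
Qed.

End Collapse.

(** * Shellings and removal of triangles *)

Section Triangles.
Variable V : choiceType.
Implicit Types (K L T : {fset {fset V}}) (s t r e th : {fset V}) (l : seq (seq V)).

(** The restriction to a natural number [d] matters: -1 is also the default of the maximum over an
    empty complex. *)
Lemma dimension_attained K (d : nat) : dimension K = Posz d -> exists2 s, s \in K & #|` s| = d.+1.
Proof.
move=> dK; apply: contrapT => H.
suff: (dimension K <= d%:Z - 1)%R by rewrite dK; lia.
have lt_d s : s \in K -> #|` s| <= d.
  move=> sK; have := dimension_ub sK; rewrite dK /fdim => le_s.
  have: #|` s| <> d.+1 by move=> E; apply: H; exists s.
  lia.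
rewrite /dimension big_seq; apply: (big_ind (fun x => (x <= d%:Z - 1)%R)); first by lia.
  by move=> x y hx hy; rewrite ge_max hx.
by move=> s /lt_d; rewrite /fdim; lia.
Qed.

Lemma card_le_dimension K (d : nat) s : dimension K = Posz d -> s \in K -> #|` s| <= d.+1.
Proof. by move=> dK /dimension_ub; rewrite dK /fdim; lia. Qed.

Lemma pure_facet K (d : nat) s : pure K -> dimension K = Posz d -> facet K s -> #|` s| = d.+1.
Proof.
move=> pK dK fs; have [r rK rd] := dimension_attained dK.
have [u fu ru] := facet_exists rK.
have ud : #|` u| = d.+1.
  have := fsubset_leq_card ru; have := card_le_dimension dK fu.1; lia.
by have := pK _ _ fs fu; rewrite /fdim ud; lia.
Qed.

Lemma fsubset_rem r s x : r `<=` s -> x \notin r -> r `<=` s `\ x.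
Proof.
move=> rs xr; apply/fsubsetP => y yr; rewrite !inE (fsubsetP rs) // andbT.
by apply: contraNneq xr => <-.
Qed.

Lemma cardfsD1_in s x n : #|` s| = n.+1 -> x \in s -> #|` s `\ x| = n.
Proof. by move=> sn xs; have := cardfsD1 x s; rewrite sn xs => -[]. Qed.

Lemma coatomP e s n : #|` s| = n.+1 -> #|` e| = n -> e `<=` s ->
  exists2 x, x \in s & e = s `\ x.
Proof.
move=> sn en es; have : e `<` s by rewrite fproperEcard es sn en /=.
case/fproperP => _ [x xs xe]; exists x => //; apply/eqP.
by rewrite eqEfcard fsubset_rem //= (cardfsD1_in sn) // en.
Qed.

Lemma vertices_sub K L : K `<=` L -> vertices K `<=` vertices L.
Proof.
move=> KL; apply/fsubsetP => x /bigfcupP[s /andP[sK _] xs].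
by apply/bigfcupP; exists s; rewrite ?(fsubsetP KL).
Qed.

Lemma collapsible_step K K' : elementary_collapse K K' -> collapsible K' -> collapsible K.
Proof.
move=> eK [v vK cK]; exists v; last exact: collapses_step cK.
apply: (fsubsetP (vertices_sub _)) vK.
by case: eK => t [s [_ _ _ ->]]; apply/fsubsetP => r; rewrite !inE => /andP[].
Qed.

Lemma fpowerset_simplicial s : simplicial (fpowerset s).
Proof. by move=> r u; rewrite !fpowersetE => rs ur; apply: fsubset_trans rs. Qed.

(** A vertex of a simplex with at least two vertices is a free face, and removing it leaves the
    opposite simplex. *)
Lemma fpowerset_collapsible s : s != fset0 -> collapsible (fpowerset s).
Proof.
have [n] := ubnP #|` s|; elim: n s => // n IH s lt_n s0.
have /fset0Pn[x xs] := s0; have sx := cardfsD1 x s; rewrite xs /= in sx.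
have [s1|s1] := eqVneq (s `\ x) fset0.
  have {}s1 : s = [fset x] by rewrite -(fsetD1K xs) s1 fsetU0.
  exists x; first by apply/bigfcupP; exists s; rewrite ?fpowersetE ?fsubset_refl.
  rewrite s1 (_ : fpowerset _ = [fset fset0; [fset x]]); first exact: collapses_refl.
  by apply/fsetP => r; rewrite fpowersetE !inE fsubset1 orbC.
apply: collapsible_step (IH (s `\ x) _ s1); last by move: lt_n; rewrite sx ltnS.
have -> : fpowerset (s `\ x) = [fset r in fpowerset s | ~~ ([fset x] `<=` r)].
  apply/fsetP => r; rewrite !inE /= !fpowersetE fsub1set; apply/idP/andP.
    move=> rs; split; first exact: fsubset_trans rs (fsubD1set _ _).
    by apply/negP => /(fsubsetP rs); rewrite !inE eqxx.
  by case=> rs xr; apply: fsubset_rem.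
apply: (@elementary_collapseI _ _ s) => //.
- split; first by rewrite fpowersetE fsubset_refl.
  by move=> r; rewrite fpowersetE => rs sr; apply/eqP; rewrite eqEfsubset rs.
- apply/fproperP; split; first by rewrite fsub1set.
  have /fset0Pn[y] := s1; rewrite !inE => /andP[yx ys].
  by exists y; rewrite ?inE.
- exact: fpowerset_simplicial.
by move=> r; rewrite fpowersetE.
Qed.

Section Remove.
Variable L : {fset {fset V}}.
Hypotheses (sL : simplicial L) (pL : pure L) (dL : dimension L = 2%R).

Let facet3 th : facet L th -> #|` th| = 3.
Proof. by move/(pure_facet pL dL). Qed.

(** A pure 1-dimensional intersection short of the whole boundary consists of one edge or of two.
    The new faces are then those containing the vertex opposite to the single edge, or those
    containing the third edge; this vertex or edge is the free face of the collapse. *)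
Lemma minimal_new_face K th : simplicial K -> #|` th| = 3 ->
  pure (fpowerset th `&` K) -> dimension (fpowerset th `&` K) = 1%R ->
  ~ (forall r, r `<` th -> r \in K) ->
  exists2 t, t `<` th & forall r, r `<=` th -> (r \in K) = ~~ (t `<=` r).
Proof.
move=> sK th3 pI dI nfull.
have [e] := @dimension_attained _ 1 dI; rewrite in_fsetI fpowersetE => /andP[eth eK] e2.
have [c cth Ee] := coatomP th3 e2 eth; subst e.
case cK : ([fset c] \in K); last first.
  exists [fset c].
    apply/fproperP; split; first by rewrite fsub1set.
    have : th `\ c != fset0 by rewrite -cardfs_gt0 e2.
    by case/fset0Pn => x; rewrite !inE => /andP[xc xth]; exists x; rewrite ?inE.
  move=> r rth; rewrite fsub1set; apply/idP/idP => [rK|cr].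
    by apply: contraFN cK => cr; apply: sK rK _; rewrite fsub1set.
  by apply: sK eK _; apply: fsubset_rem.
(* The vertex [c] opposite to the first edge is present, and purity provides a second edge through
   it. *)
have cI : [fset c] \in fpowerset th `&` K by rewrite in_fsetI fpowersetE fsub1set cth.
have [e fe ce] := facet_exists cI; rewrite fsub1set in ce.
have e2' := @pure_facet _ 1 _ pI dI fe.
case: fe; rewrite in_fsetI fpowersetE => /andP[eth' eK'] _.
have [a ath Ee] := coatomP th3 e2' eth'; subst e.
have ca : c != a by move: ce; rewrite !inE => /andP[].
exists [fset a; c].
  rewrite fproperEcard fsubUset !fsub1set ath cth th3 cardfs2 eq_sym ca.
  by [].
move=> r rth; apply/idP/idP => [rK|].
  (* With [a] and [c] in one face of [K], all three edges of [th] would be present, against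
     [nfull]. *)
  apply/negP; rewrite fsubUset !fsub1set => /andP[ar cr]; apply: nfull => u /fproperP[uth [x xth xu]].
  case: (boolP (a \in u)) => au; last by apply: sK eK' _; apply: fsubset_rem.
  case: (boolP (c \in u)) => cu; last by apply: sK eK _; apply: fsubset_rem.
  apply: (sK r) => //; apply/fsubsetP => y yu.
  have : #|` th `\ a `\ c| = 1.
    by rewrite (cardfsD1_in (cardfsD1_in th3 ath)) // !inE ca.
  move/eqP/cardfs1P => [b Eb].
  have xb : x = b.
    apply/eqP; rewrite -in_fset1 -Eb !inE xth andbT.
    by apply/andP; split; apply: contraNneq xu => ->.
  have : y \notin [fset b] by rewrite in_fset1 -xb; apply: contraNneq xu => <-.
  rewrite -Eb !inE (fsubsetP uth y yu) andbT negb_and !negbK.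
  by case/orP => /eqP ->.
rewrite fsubUset !fsub1set negb_and => /orP[]?.
  by apply: sK eK' _; apply: fsubset_rem.
by apply: sK eK _; apply: fsubset_rem.
Qed.

Lemma spanned_rcons p th : th \in L -> spanned L (rcons p th) = spanned L p `|` fpowerset th.
Proof.
move=> thL; apply/fsetP => s; rewrite in_fsetU fpowersetE !inE /= -cats1 has_cat /= orbF.
case: (boolP (s `<=` th)) => sth; rewrite ?orbF // !orbT andbT.
by rewrite (sL thL).
Qed.

Lemma spanned_simplicial p : simplicial (spanned L p).
Proof.
move=> s t; rewrite !inE /= => /andP[sL' /hasP[th thp sth]] ts.
by rewrite (sL sL' ts); apply/hasP; exists th => //; apply: fsubset_trans sth.
Qed.

(** Induction over the shelling: a last triangle with full boundary joins [T], any other is removed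
    by the collapse that [minimal_new_face] provides. The size of [T] is not followed here, since
    [removal_card] recovers it. *)
Lemma shelling_collapsible ths : uniq ths ->
  (forall s, s \in ths -> facet L s) ->
  (forall i, 0 < i < size ths ->
    let I := spanned L [:: nth fset0 ths i] `&` spanned L (take i ths) in
    pure I /\ dimension I = 1%R) ->
  ths != [::] ->
  exists T, [/\ T `<=` [fset s in ths] & collapsible (spanned L ths `\` T)].
Proof.
elim/last_ind: ths => // p th IH uth fth good _.
have fL : facet L th by apply: fth; rewrite mem_rcons mem_head.
have th3 := facet3 fL.
have span1 : spanned L [:: th] = fpowerset th.
  apply/fsetP => s; rewrite !inE /= orbF fpowersetE; apply: andb_idl => sth.
  exact: sL fL.1 sth.
have [->|p0] := eqVneq p [::].
  exists fset0; split; first exact: fsub0set.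
  rewrite fsetD0 /= span1; apply: fpowerset_collapsible.
  by rewrite -cardfs_gt0 th3.
move: uth; rewrite rcons_uniq => /andP[thp up].
have [|i lt_i|//|T [Tp cT]] := IH up.
- by move=> s sp; apply: fth; rewrite mem_rcons inE sp orbT.
- have := good i; rewrite size_rcons nth_rcons -cats1 takel_cat; last by lia.
  case/andP: lt_i => i0 lt_i; rewrite lt_i; apply; lia.
have [] := good (size p); first by rewrite size_rcons ltnS leqnn lt0n size_eq0 p0.
rewrite nth_rcons ltnn eqxx -cats1 take_size_cat // span1 cats1 => pI dI.
rewrite spanned_rcons; last by case: fL.
set K := spanned L p in cT pI dI *.
have thK : th \notin K.
  rewrite !inE /=; apply/negP => /andP[_ /hasP[u up' thu]]; case/negP: thp.
  have fu : facet L u by apply: fth; rewrite mem_rcons inE up' orbT.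
  by rewrite -(fL.2 _ fu.1 thu).
have T3 s : s \in T -> #|` s| = 3 /\ s != th.
  move/(fsubsetP Tp); rewrite !inE /= => sp; split; first by apply/facet3/fth; rewrite mem_rcons inE sp orbT.
  by apply: contraNneq thp => <-.
have Tsub s : s `<=` th -> s \notin T.
  move=> sth; apply/negP => /T3[s3 /negP[]].
  by rewrite eqEfcard sth th3 s3.
have sKK : simplicial K by apply: spanned_simplicial.
case: (pselect (forall r, r `<` th -> r \in K)) => [full|nfull].
  exists (th |` T); split.
    apply/fsubsetP => s; rewrite !inE /= mem_rcons inE => /orP[->//|/(fsubsetP Tp)].
    by rewrite !inE => ->; rewrite orbT.
  rewrite (_ : _ `\` _ = K `\` T) //; apply/fsetP => s; rewrite !in_fsetD 2!in_fsetU in_fset1 fpowersetE negb_or.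
  case: eqVneq => [->|sth] /=; first by rewrite (negbTE thK) andbF.
  congr (_ && _); apply/orP/idP => [[//|s_th]|->]; last by left.
  by apply: full; rewrite fproperEneq sth.
have [t tth tK] := minimal_new_face sKK th3 pI dI nfull.
exists T; split.
  apply/fsubsetP => s /(fsubsetP Tp); rewrite !inE /= mem_rcons inE => ->.
  by rewrite orbT.
apply: collapsible_step cT.
have -> : K `\` T = [fset r in (K `|` fpowerset th) `\` T | ~~ (t `<=` r)].
  apply/fsetP => r; rewrite in_fsep !in_fsetD in_fsetU fpowersetE -andbA.
  congr (_ && _); case: (boolP (r `<=` th)) => rth; rewrite ?orbT ?orbF; first by rewrite tK // andbb.
  apply/idP/andP => [rK|[]//]; split=> //.
  apply/negP => tr; have := sKK _ _ rK tr.
  by rewrite tK ?fsubset_refl // fproper_sub.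
have ub r : r \in (K `|` fpowerset th) `\` T -> t `<=` r -> r `<=` th.
  rewrite in_fsetD in_fsetU fpowersetE => /andP[_ /orP[rK|//]] tr.
  have := sKK _ _ rK tr; rewrite tK ?fsubset_refl //; exact: fproper_sub.
apply: (@elementary_collapseI _ _ th) => //.
- split; first by rewrite in_fsetD in_fsetU fpowersetE fsubset_refl orbT Tsub.
  move=> r rK thr; apply/eqP; rewrite eqEfsubset thr andbT; apply: ub => //.
  exact: fsubset_trans (fproper_sub tth) thr.
move=> s r; rewrite !in_fsetD !in_fsetU !fpowersetE => /andP[sT sK] rs.
have -> /= : r \notin T.
  apply: contraNN sT => rT; rewrite (_ : s = r) //; apply/esym/eqP.
  rewrite eqEfcard rs (T3 _ rT).1; apply: (@card_le_dimension _ 2 _ dL).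
  case/orP: sK => [|/(sL fL.1)//]; by rewrite !inE => /andP[].
case/orP: sK => [sK|sth]; first by rewrite (sKK s).
by rewrite (fsubset_trans rs sth) orbT.
Qed.

(** A collapsible complex has reduced Euler characteristic 0 and every triangle contributes 1, so
    the number of removed triangles is forced. *)
Lemma removal_card T : T `<=` faces L 2 -> collapsible (L `\` T) ->
  (euler L = #|` T|%:Z)%R.
Proof.
move=> Tf cL.
have T3 s : s \in T -> #|` s| = 3.
  by move/(fsubsetP Tf); rewrite in_faces (@fdimE _ s 2) => /andP[_ /eqP].
rewrite (@eulerD _ L (L `\` T)) ?fsubsetDl // fsetDK; last first.
  by apply: fsubset_trans Tf _; apply/fsubsetP => s; rewrite in_faces => /andP[].
rewrite collapsible_euler ?add0r //.
  rewrite /euler card_fset_sum1 (big_morph Posz PoszD (erefl (Posz 0))) !big_seq.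
  by apply: eq_bigr => s /T3 ->.
move=> s r; rewrite !in_fsetD => /andP[sT sL'] rs; rewrite (sL sL') // andbT.
apply: contraNN sT => rT; rewrite (_ : s = r) //; apply/esym/eqP.
by rewrite eqEfcard rs (T3 _ rT) (@card_le_dimension _ 2 _ dL).
Qed.

Lemma shellable_removal (n : nat) : shellable L -> (euler L = n%:Z)%R ->
  exists T, [/\ T `<=` faces L 2, #|` T| = n & collapsible (L `\` T)].
Proof.
case=> _ [ths [uth fth good]] eL.
have spanL : spanned L ths = L.
  apply/fsetP => s; rewrite !inE /=; apply: andb_idr => sL'.
  have [th fs sth] := facet_exists sL'; apply/hasP; exists th => //; exact/fth.
have [|i||T [Tths cT]] := @shelling_collapsible ths uth.
- by move=> s /fth.
- by move/good; rewrite dL.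
- apply/eqP => E; have [s /facet_exists[r /fth]] := @dimension_attained L 2 dL.
  by rewrite E.
rewrite spanL in cT; have TL : T `<=` faces L 2.
  apply/fsubsetP => s /(fsubsetP Tths); rewrite !inE /= => /fth fs.
  by rewrite fs.1 (@fdimE _ s 2) (facet3 fs).
by exists T; split=> //; have := removal_card TL cT; rewrite eL => -[].
Qed.

End Remove.
End Triangles.

(** * Shellings by attaching one triangle at a time *)

Section Building.
Variable V : choiceType.
Implicit Types (K L T : {fset {fset V}}) (s t r e th : {fset V}) (l : seq (seq V)).

Definition edge_in l x y := has (fun f => (x \in f) && (y \in f)) l.
Definition vertex_in l x := has (fun f => x \in f) l.

(** The ways for a new triangle to meet the earlier complex in a pure 1-dimensional complex: along
    at least two edges, or along one edge while the opposite vertex is new. In the first three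
    alternatives the third edge may or may not be present. *)
Definition attachable l (a b c : V) :=
  [|| edge_in l a b && edge_in l b c, edge_in l b c && edge_in l a c,
      edge_in l a b && edge_in l a c, edge_in l a b && ~~ vertex_in l c,
      edge_in l b c && ~~ vertex_in l a | edge_in l a c && ~~ vertex_in l b].

(* The triangles are listed in the reverse order of their insertion. *)
Inductive built : seq (seq V) -> Prop :=
| built_start a b c : uniq [:: a; b; c] -> built [:: [:: a; b; c]]
| built_cons a b c l : built l -> uniq [:: a; b; c] -> attachable l a b c ->
    built ([:: a; b; c] :: l).

Definition triangular l := forall f, f \in l -> uniq f && (size f == 3).

Definition fset_of (f : seq V) : {fset V} := [fset x in f].

Lemma in_fset_of f x : (x \in fset_of f) = (x \in f).
Proof. by rewrite !inE. Qed.

Lemma card_fset_of f : uniq f -> #|` fset_of f| = size f.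
Proof. by move=> uf; rewrite card_fseq undup_id. Qed.

Lemma triangular_card l f : triangular l -> f \in l -> #|` fset_of f| = 3.
Proof. by move=> tl /tl/andP[uf /eqP <-]; apply: card_fset_of. Qed.

Lemma fset_of_complex l f : f \in l -> fset_of f \in complex_of l.
Proof. by move=> fl; rewrite in_complex_of; apply/hasP; exists f. Qed.

Lemma complex_card_le l s : triangular l -> s \in complex_of l -> #|` s| <= 3.
Proof.
move=> tl; rewrite in_complex_of => /hasP[f fl sf].
by rewrite -(triangular_card tl fl) fsubset_leq_card.
Qed.

Lemma facet_complex l s : triangular l ->
  facet (complex_of l) s <-> s \in [seq fset_of f | f <- l].
Proof.
move=> tl; split=> [[]|/mapP[f fl ->]].
  rewrite in_complex_of => /hasP[f fl sf] ms; apply/mapP; exists f => //.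
  by apply/esym/ms => //; apply: fset_of_complex.
split; first exact: fset_of_complex.
move=> t tK ft; apply/esym/eqP; rewrite eqEfcard ft (triangular_card tl fl).
exact: complex_card_le tK.
Qed.

Lemma complex_pure l : triangular l -> pure (complex_of l).
Proof.
move=> tl s t /(facet_complex s tl)/mapP[f fl ->] /(facet_complex t tl)/mapP[g gl ->].
by rewrite /fdim !(triangular_card tl).
Qed.

Lemma complex_dim l : triangular l -> l != [::] -> dimension (complex_of l) = 2%R.
Proof.
move=> tl; case: l tl => // f l tl _; rewrite (@dimensionE _ _ 3) //.
  by move=> s; apply: complex_card_le.
exists (fset_of f); first by apply: fset_of_complex; rewrite mem_head.
by apply: (triangular_card tl); rewrite mem_head.
Qed.

Lemma built_triangular l : built l -> triangular l.
Proof.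
elim=> [a b c u f|a b c {}l _ IH u _ f]; rewrite !inE; first by move/eqP ->; rewrite u.
by case/orP => [/eqP ->|/IH]; rewrite ?u.
Qed.

(** The same condition for sets, with an edge named by the vertex opposite to it. *)
Definition attached th (p : seq {fset V}) :=
  (exists x y, [/\ x \in th, y \in th, x != y, has (fun r => th `\ x `<=` r) p &
                   has (fun r => th `\ y `<=` r) p]) \/
  (exists2 x, x \in th & has (fun r => th `\ x `<=` r) p /\ ~~ has (fun r => x \in r) p).

Lemma attachableP l p a b c : uniq [:: a; b; c] -> attachable l a b c ->
  p =i [seq fset_of f | f <- l] -> attached (fset_of [:: a; b; c]) p.
Proof.
rewrite /= !inE negb_or !andbT => /andP[/andP[ab ac] bc] att pl.
have has_p (P : pred {fset V}) : has P p = has (fun f => P (fset_of f)) l.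
  by rewrite (eq_has_r pl) has_map.
have edgeE x y z : fset_of [:: a; b; c] `\ z `<=` [fset x; y] -> edge_in l x y ->
    has (fun r => fset_of [:: a; b; c] `\ z `<=` r) p.
  move=> sub; rewrite has_p => /hasP[f fl /andP[xf yf]]; apply/hasP; exists f => //.
  by apply: fsubset_trans sub _; rewrite fsubUset !fsub1set !in_fset_of xf.
have vertE x : ~~ vertex_in l x -> ~~ has (fun r => x \in r) p.
  rewrite has_p; apply: contraNN => /hasP[f fl]; rewrite in_fset_of => xf.
  by apply/hasP; exists f.
have Ec : fset_of [:: a; b; c] `\ c `<=` [fset a; b].
  by apply/fsubsetP => z; rewrite !inE; do 3!case: eqP.
have Ea : fset_of [:: a; b; c] `\ a `<=` [fset b; c].
  by apply/fsubsetP => z; rewrite !inE; do 3!case: eqP.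
have Eb : fset_of [:: a; b; c] `\ b `<=` [fset a; c].
  by apply/fsubsetP => z; rewrite !inE; do 3!case: eqP.
have [ia ib ic] : [/\ a \in fset_of [:: a; b; c], b \in fset_of [:: a; b; c] &
    c \in fset_of [:: a; b; c]] by rewrite !in_fset_of !inE !eqxx !orbT.
case/or4P: att => [/andP[e1 e2]|/andP[e1 e2]|/andP[e1 e2]|].
- by left; exists a, c; split; rewrite ?(edgeE _ _ _ Ea) ?(edgeE _ _ _ Ec).
- by left; exists a, b; split; rewrite ?(edgeE _ _ _ Ea) ?(edgeE _ _ _ Eb).
- by left; exists b, c; split; rewrite ?(edgeE _ _ _ Eb) ?(edgeE _ _ _ Ec).
case/or3P => /andP[e1 e2]; right; first exists c => //; last first.
- by exists b => //; rewrite (edgeE _ _ _ Eb) ?vertE.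
- by exists a => //; rewrite (edgeE _ _ _ Ea) ?vertE.
by rewrite (edgeE _ _ _ Ec) ?vertE.
Qed.

Lemma built_order l : built l -> exists ths : seq {fset V},
  [/\ uniq ths, ths =i [seq fset_of f | f <- l] &
      forall i, 0 < i < size ths -> attached (nth fset0 ths i) (take i ths)].
Proof.
elim=> [a b c u|a b c {}l _ [ths [uths tl att]] u at_l].
  by exists [:: fset_of [:: a; b; c]]; split=> // -[|[]].
(* [built] does not exclude repetitions; a repeated triangle is left out of the order. *)
have [tths|tths] := boolP (fset_of [:: a; b; c] \in ths).
  exists ths; split=> // s; rewrite /= inE -tl.
  by case: eqP => // ->; rewrite tths.
exists (rcons ths (fset_of [:: a; b; c])); split=> [|s|i].
- by rewrite rcons_uniq tths.
- by rewrite mem_rcons /= !inE tl.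
rewrite size_rcons ltnS nth_rcons -cats1 => /andP[i0].
rewrite leq_eqVlt => /orP[/eqP ->|lt_i].
  by rewrite ltnn eqxx take_size_cat //; apply: attachableP at_l tl.
by rewrite lt_i takel_cat ?(ltnW lt_i) //; apply: att; rewrite i0.
Qed.

(** A face of the intersection that misses the vertex opposite to a shared edge lies in that edge,
    and a face containing the vertices opposite to two shared edges is itself an edge. *)
Lemma attached_pure K th p : simplicial K -> th \in K -> #|` th| = 3 ->
  (forall r, r \in p -> r \in K /\ #|` r| = 3) -> th \notin p -> attached th p ->
  let I := spanned K [:: th] `&` spanned K p in pure I /\ dimension I = 1%R.
Proof.
move=> sK thK th3 pK thp att I.
have inI s : (s \in I) = (s `<=` th) && has (fun r => s `<=` r) p.
  rewrite /I in_fsetI !in_fsep /= orbF; case: (boolP (s `<=` th)) => sth; rewrite ?andbF //=.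
  by rewrite (sK th).
have I2 s : s \in I -> s `<` th.
  rewrite inI => /andP[sth /hasP[r rp sr]]; rewrite fproperEneq sth andbT.
  apply: contraNneq thp => Es; rewrite -Es in sr *; have [_ r3] := pK r rp.
  suff /eqP -> : s == r by [].
  by rewrite eqEfcard sr r3 Es th3.
have I2c s : s \in I -> #|` s| <= 2.
  by move/I2/fproper_ltn_card; rewrite th3 ltnS.
have fI s : facet I s -> #|` s| = 2.
  case=> sI ms; have /fproperP[sth [z zth zs]] := I2 s sI.
  have sup x : x \in th -> has (fun r => th `\ x `<=` r) p -> x \notin s -> #|` s| = 2.
    move=> xth hx xs; rewrite -(ms (th `\ x)); first exact: cardfsD1_in th3 xth.
      by rewrite inI fsubD1set.
    exact: fsubset_rem.
  case: att => [[x [y [xth yth xy hx hy]]]|[x xth [hx nx]]]; last first.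
    apply: (sup x) => //; apply: contraNN nx => xs.
    move: sI; rewrite inI => /andP[_ /hasP[r rp /fsubsetP sr]].
    by apply/hasP; exists r => //; apply: sr.
  case: (boolP (x \in s)) => xs; last exact: sup hx _.
  case: (boolP (y \in s)) => ys; last exact: sup hy _.
  apply/eqP; rewrite eqn_leq I2c //.
  have <- : #|` [fset x; y]| = 2 by rewrite cardfs2 xy.
  by apply: fsubset_leq_card; rewrite fsubUset !fsub1set xs.
split; first by move=> s t /fI sc /fI tc; rewrite /fdim sc tc.
rewrite (@dimensionE _ _ 2) //.
have [x xth hx] : exists2 x, x \in th & has (fun r => th `\ x `<=` r) p.
  by case: att => [[x [y [xth _ _ hx _]]]|[x xth [hx _]]]; exists x.
exists (th `\ x); last exact: cardfsD1_in th3 xth.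
by rewrite inI fsubD1set.
Qed.

Lemma built_shellable l : built l -> shellable (complex_of l).
Proof.
move=> bl; have tl := built_triangular bl.
split; first exact: complex_pure.
have [ths [uths tths att]] := built_order bl.
have ths3 r : r \in ths -> r \in complex_of l /\ #|` r| = 3.
  rewrite tths => /mapP[f fl ->].
  by split; [apply: fset_of_complex|apply: triangular_card fl].
exists ths; split=> // [s|i lt_i]; first by rewrite tths facet_complex.
have ith : nth fset0 ths i \in ths by apply: mem_nth; case/andP: lt_i.
have [iK i3] := ths3 _ ith.
rewrite complex_dim //; last by case: bl.
apply: attached_pure => //.
- exact: complex_of_simplicial.
- by move=> r /mem_take/ths3.
- case/andP: lt_i => _ lt_i; rewrite in_take_leq ?(ltnW lt_i) //.
  by rewrite index_uniq // ltnn.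
exact: att.
Qed.

End Building.

(** * Collapses and weak saturation *)

Section Reach.
Variable V : choiceType.
Implicit Types (K L G S F : {fset {fset V}}) (s t r e : {fset V}).

Definition reach K u v :=
  exists2 p : seq V, path (fun x y => [fset x; y] \in K) u p & last u p = v.

Lemma reach_refl K u : reach K u u.
Proof. by exists [::]. Qed.

Lemma reach_trans K u v w : reach K u v -> reach K v w -> reach K u w.
Proof.
move=> [p pp lp] [q qq lq]; exists (p ++ q); rewrite ?cat_path ?last_cat lp ?pp //.
Qed.

Lemma reach1 K u v : [fset u; v] \in K -> reach K u v.
Proof. by move=> uv; exists [:: v]; rewrite //= uv. Qed.

Lemma reach_ind K u (P : V -> Prop) : P u ->
  (forall x y, P x -> [fset x; y] \in K -> P y) -> forall v, reach K u v -> P v.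
Proof.
move=> Pu PS v [p pp <-]; elim: p u Pu pp => //= x p IH u Pu /andP[ux pp].
by apply: IH pp; apply: PS ux.
Qed.

Lemma reach_sym K u v : reach K u v -> reach K v u.
Proof.
move: v; apply: reach_ind => [|x y xu xy]; first exact: reach_refl.
by apply: reach_trans xu; apply: reach1; rewrite fsetUC.
Qed.

Lemma cardfs2_ex s : #|` s| = 2 -> exists x y, x != y /\ s = [fset x; y].
Proof.
move=> s2; have /fset0Pn[x xs] : s != fset0 by rewrite -cardfs_gt0 s2.
have /eqP/cardfs1P[y Ey] := cardfsD1_in s2 xs.
have : y \in s `\ x by rewrite Ey in_fset1.
rewrite !inE => /andP[yx ys]; exists x, y; rewrite eq_sym yx; split=> //.
by rewrite -(fsetD1K xs) Ey.
Qed.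

Lemma cardfs_le1 s : #|` s| <= 1 -> s = fset0 \/ exists x, s = [fset x].
Proof.
rewrite leq_eqVlt => /orP[/cardfs1P|]; first by right.
by rewrite ltnS leqn0 cardfs_eq0 => /eqP; left.
Qed.

Lemma in_skeleton1 K s : (s \in skeleton 1 K) = (s \in K) && (#|` s| <= 2).
Proof. by rewrite in_fsep; congr (_ && _); rewrite /fdim; lia. Qed.

Lemma in_faces1 K s : (s \in faces K 1) = (s \in K) && (#|` s| == 2).
Proof. by rewrite in_faces (@fdimE _ s 1). Qed.

Lemma skeleton_simplicial K : simplicial K -> simplicial (skeleton 1 K).
Proof.
move=> sK s t; rewrite !in_skeleton1 => /andP[sk s2] ts; rewrite (sK s) //=.
exact: leq_trans (fsubset_leq_card ts) s2.
Qed.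

Lemma vertices_skeleton K : simplicial K -> vertices (skeleton 1 K) = vertices K.
Proof.
move=> sK; apply/fsetP => x; rewrite !in_vertices //; last exact: skeleton_simplicial.
by rewrite in_skeleton1 cardfs1 andbT.
Qed.

Lemma faces1_skeleton K : faces (skeleton 1 K) 1 = faces K 1.
Proof.
apply/fsetP => s; rewrite !in_faces1 in_skeleton1 -andbA; congr (_ && _).
by case: eqP => [->|]; rewrite ?andbF.
Qed.

Lemma add_edge_simplicial S x y : simplicial S -> [fset x] \in S ->
  simplicial (S `|` [fset [fset y]; [fset x; y]]).
Proof.
move=> sS xS s t; have S0 : fset0 \in S by apply: sS xS (fsub0set _).
rewrite !in_fsetU => /or3P[sS'|/fset1P ->|/fset1P ->] ts.
- by rewrite (sS s).
- by move: ts; rewrite fsubset1 => /orP[]/eqP ->; rewrite ?S0 // fset11 orbT.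
have [yt|yt] := boolP (y \in t).
  have [xt|xt] := boolP (x \in t).
    suff -> : t = [fset x; y] by rewrite fset11 !orbT.
    by apply/eqP; rewrite eqEfsubset ts fsubUset !fsub1set xt.
  suff -> : t = [fset y] by rewrite fset11 !orbT.
  apply/eqP; rewrite eqEfsubset fsub1set yt andbT; apply/fsubsetP => z zt.
  have := fsubsetP ts z zt; rewrite !inE => /orP[/eqP E|//].
  by rewrite -E zt in xt.
rewrite (sS [fset x]) //; apply/fsubsetP => z zt.
have := fsubsetP ts z zt; rewrite !inE => /orP[//|/eqP E].
by rewrite -E zt in yt.
Qed.

Lemma add_edge_collapse S x y : simplicial S -> [fset x] \in S -> [fset y] \notin S ->
  elementary_collapse (S `|` [fset [fset y]; [fset x; y]]) S.
Proof.
move=> sS xS yS; have xy : x != y by apply: contraNneq yS => <-.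
have nyS r : r \in S -> y \notin r.
  by move=> rS; apply: contraNN yS => yr; apply: sS rS _; rewrite fsub1set.
have E : S = [fset r in S `|` [fset [fset y]; [fset x; y]] | ~~ ([fset y] `<=` r)].
  apply/fsetP => r; rewrite in_fsep fsub1set !in_fsetU; apply/idP/andP => [rS|].
    by rewrite rS nyS.
  by case=> /or3P[//|/fset1P ->|/fset1P ->]; rewrite !inE eqxx ?orbT.
rewrite [X in elementary_collapse _ X]E.
have ub r : r \in S `|` [fset [fset y]; [fset x; y]] -> [fset y] `<=` r -> r `<=` [fset x; y].
  rewrite fsub1set !in_fsetU => /or3P[/nyS/negbTE -> //|/fset1P ->|/fset1P -> //] _.
  by rewrite fsub1set !inE eqxx orbT.
apply: (@elementary_collapseI _ _ [fset x; y]) => //; last exact: add_edge_simplicial.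
- split; first by rewrite !in_fsetU fset11 !orbT.
  move=> t tS xyt; apply/eqP; rewrite eqEfsubset xyt andbT; apply: ub => //.
  by apply: fsubset_trans xyt; rewrite fsub1set !inE eqxx orbT.
by rewrite fproperEcard fsub1set !inE eqxx orbT cardfs1 cardfs2 xy.
Qed.

Lemma vertices_add_edge S x y : simplicial S -> [fset x] \in S -> [fset y] \notin S ->
  #|` vertices (S `|` [fset [fset y]; [fset x; y]])| = #|` vertices S|.+1.
Proof.
move=> sS xS yS; have sS' := @add_edge_simplicial S x y sS xS.
have xy : x != y by apply: contraNneq yS => <-.
have -> : vertices (S `|` [fset [fset y]; [fset x; y]]) = y |` vertices S.
  apply/fsetP => z; rewrite in_fset1U !in_vertices // !in_fsetU.
  rewrite !in_fset1; apply/or3P/orP => [[zS|/eqP/fset1_inj ->|/eqP E]|[/eqP ->|zS]].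
  - by right.
  - by left.
  - by have := cardfs2 x y; rewrite -E cardfs1 xy.
  - by constructor 2.
  - by constructor 1.
by rewrite cardfsU1 in_vertices // yS.
Qed.

Lemma faces1_add_edge S x y : simplicial S -> [fset x] \in S -> [fset y] \notin S ->
  #|` faces (S `|` [fset [fset y]; [fset x; y]]) 1| = #|` faces S 1|.+1.
Proof.
move=> sS xS yS; have xy : x != y by apply: contraNneq yS => <-.
have -> : faces (S `|` [fset [fset y]; [fset x; y]]) 1 = [fset x; y] |` faces S 1.
  apply/fsetP => s; rewrite in_fset1U !in_faces1 !in_fsetU !in_fset1.
  case: (eqVneq s [fset x; y]) => [->|_]; first by rewrite !orbT cardfs2 xy.
  by rewrite orbF; case: eqVneq => [->|_]; rewrite ?orbF // cardfs1 !andbF.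
rewrite cardfsU1 in_faces1 negb_and; case: (boolP (_ \in S)) => // /sS.
by move/(_ [fset y]); rewrite (negbTE yS) fsub1set !inE eqxx orbT => /(_ isT).
Qed.

(** The tree grows one leaf at a time, so its growth read backwards is a collapse to the root, and
    the numbers of edges and vertices stay in step. *)
Lemma spanning_tree G : simplicial G -> connected G -> vertices G != fset0 ->
  exists S, [/\ S `<=` G, simplicial S, vertices S = vertices G, collapsible S &
    #|` faces S 1|.+1 = #|` vertices G|].
Proof.
move=> sG cG /fset0Pn[v vG].
have vG' : [fset v] \in G by rewrite -in_vertices.
suff H k : k < #|` vertices G| -> exists S, [/\ S `<=` G, simplicial S,
    [fset v] \in S, collapses S [fset fset0; [fset v]] &
    #|` vertices S| = k.+1 /\ #|` faces S 1| = k].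
  have n0 : 0 < #|` vertices G| by rewrite cardfs_gt0; apply/fset0Pn; exists v.
  have [|S [SG sS vS cS [nS fS]]] := H #|` vertices G|.-1; first by rewrite prednK.
  exists S; split=> //; last by rewrite fS prednK.
    by apply/eqP; rewrite eqEfcard vertices_sub // nS prednK // leqnn.
  by exists v; rewrite ?in_vertices.
elim: k => [|k IH] lt_k.
  exists [fset fset0; [fset v]]; split.
  - by rewrite fsubUset !fsub1set vG' (sG _ _ vG') // fsub0set.
  - move=> s t; rewrite !inE => /orP[]/eqP ->; first by rewrite fsubset0 => ->.
    by rewrite fsubset1 orbC.
  - by rewrite !inE eqxx orbT.
  - exact: collapses_refl.
  split; last first.
    apply/eqP; rewrite cardfs_eq0; apply/eqP/fsetP => s; rewrite in_faces1 !inE.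
    by apply/negP => /andP[/orP[]/eqP ->]; rewrite ?cardfs0 ?cardfs1.
  rewrite /vertices; have -> : \bigcup_(s <- [fset fset0; [fset v]]) s = [fset v].
    apply/fsetP => x; apply/bigfcupP/idP => [[s /andP[+ _] xs]|xv].
      by rewrite !inE => /orP[]/eqP E; move: xs; rewrite E !inE.
    by exists [fset v] => //; rewrite in_fset2 eqxx orbT.
  by rewrite cardfs1.
have [|S [SG sS vS cS [nS fS]]] := IH; first exact: ltnW.
(* Otherwise the vertices of [S] are closed under adjacency and, by connectedness, are all of
   [vertices G], against the count. *)
have [x [y [xS yS xyG]]] : exists x y, [/\ [fset x] \in S, [fset y] \notin S & [fset x; y] \in G].
  apply: contrapT => H; suff: vertices G `<=` vertices S.
    by move/fsubset_leq_card; rewrite nS leqNgt lt_k.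
  apply/fsubsetP => y yG; rewrite in_vertices //.
  apply: (@reach_ind G v (fun y => [fset y] \in S)) => // [x z xS xz|]; last exact: cG.
  by apply: contrapT => /negP zS; apply: H; exists x, z.
have xy : x != y by apply: contraNneq yS => <-.
exists (S `|` [fset [fset y]; [fset x; y]]); split.
- rewrite !fsubUset SG !fsub1set xyG (sG _ _ xyG) ?andbT //.
  by rewrite fsub1set !inE eqxx orbT.
- exact: add_edge_simplicial.
- by rewrite in_fsetU vS.
- by apply: collapses_step cS; apply: add_edge_collapse.
by rewrite vertices_add_edge // faces1_add_edge // nS fS.
Qed.

End Reach.

Section WeakSaturation.
Variable V : choiceType.
Implicit Types (K L G S F : {fset {fset V}}) (s t r e : {fset V}) (es : seq {fset V}).

Lemma in_K3 h : (h \in K3) = (h `<=` [fset x in [:: 0; 1; 2]]) && (#|` h| <= 2).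
Proof. by rewrite in_skeleton1 in_complex_of /= orbF. Qed.

Lemma vertex_K3 x : (x \in vertices K3) = (x < 3).
Proof.
rewrite in_vertices; last by apply/skeleton_simplicial/complex_of_simplicial.
by rewrite in_K3 cardfs1 andbT fsub1set !inE; case: x => [|[|[|]]].
Qed.

Lemma fsub2_K3 x y : x < 3 -> y < 3 -> [fset x; y] \in K3.
Proof.
move=> x3 y3; rewrite in_K3 cardfs2 fsubUset !fsub1set !inE.
by rewrite ltnS leq_b1 andbT; case: x y x3 y3 => [|[|[|]]] // [|[|[|]]].
Qed.

Lemma imfset_pair (T : choiceType) (f : nat -> T) u v : f @` [fset u; v] = [fset f u; f v].
Proof.
apply/fsetP => z; apply/imfsetP/idP => [[w /= + ->]|].
  by rewrite !inE => /orP[]/eqP ->; rewrite eqxx ?orbT.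
by rewrite !inE => /orP[]/eqP ->; [exists u|exists v]; rewrite //= !inE eqxx ?orbT.
Qed.

Lemma has_copyI G (x y w : V) : simplicial G -> x != y -> y != w -> x != w ->
  [fset x; y] \in G -> [fset y; w] \in G -> [fset x; w] \in G ->
  has_copy_through K3 G [fset x; y].
Proof.
move=> sG xy yw xw xyG ywG xwG; pose f n := nth x [:: x; y; w] n; exists f.
have vG : [/\ [fset x] \in G, [fset y] \in G & [fset w] \in G].
  by split; [apply: sG xyG _|apply: sG xyG _|apply: sG ywG _]; rewrite fsub1set !inE eqxx ?orbT.
have pairG a b : a < 3 -> b < 3 -> [fset f a; f b] \in G.
  case: vG => xG yG wG.
  by case: a b => [|[|[|]]] // [|[|[|]]] //= _ _; rewrite /f /= ?fsetUid // fsetUC.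
split.
- move=> a b; rewrite !vertex_K3.
  move: xy yw xw; rewrite /f; case: a b => [|[|[|]]] // [|[|[|]]] //= xy yw xw _ _ E; move: xy yw xw;
    by rewrite E eqxx.
- move=> h; rewrite in_K3 => /andP[/fsubsetP hs h2].
  have h3 a : a \in h -> a < 3 by move/hs; rewrite !inE; case: a => [|[|[|]]].
  have [a [b [a3 b3 hab]]] : exists a b, [/\ a < 3, b < 3 & h `<=` [fset a; b]].
    move: h2; rewrite leq_eqVlt => /orP[/eqP/cardfs2_ex[a [b [ab Eh]]]|].
      exists a, b; rewrite Eh fsubset_refl; split=> //; apply: h3; by rewrite Eh !inE eqxx ?orbT.
    rewrite ltnS => /cardfs_le1[->|[a Ea]]; first by exists 0, 0; rewrite fsub0set.
    exists a, a; rewrite Ea fsetUid fsubset_refl; split=> //; apply: h3; by rewrite Ea !inE.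
  apply: sG (pairG a b a3 b3) _; rewrite -imfset_pair; apply/fsubsetP => z /imfsetP[u /= uh ->].
  by apply/imfsetP; exists u => //=; apply: (fsubsetP hab).
by exists [fset 0; 1]; rewrite ?fsub2_K3 ?imfset_pair.
Qed.

Lemma has_copyE G e : #|` e| = 2 -> has_copy_through K3 G e ->
  exists x y w, [/\ x != y, y != w, x != w & e = [fset x; y]] /\
   [fset y; w] \in G /\ [fset x; w] \in G.
Proof.
move=> e2 [f [fi fG [h hK Eh]]].
have h2 : #|` h| = 2.
  apply/eqP; rewrite eqn_leq; move: (hK); rewrite in_K3 => /andP[_ ->] /=.
  by rewrite -e2 -Eh leq_imfset_card.
have [a [b [ab Eab]]] := cardfs2_ex h2.
have h3 x : x \in h -> x < 3.
  by move=> xh; move: hK; rewrite in_K3 => /andP[/fsubsetP/(_ x xh)]; rewrite !inE; case: x {xh} => [|[|[|]]].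
have a3 : a < 3 by apply: h3; rewrite Eab !inE eqxx.
have b3 : b < 3 by apply: h3; rewrite Eab !inE eqxx orbT.
have [c [c3 ac bc]] : exists c, [/\ c < 3, a != c & b != c].
  case: a b ab a3 b3 {Eab} => [|[|[|]]] // [|[|[|]]] //= _ _ _;
  by [exists 0|exists 1|exists 2].
have fne u v : u < 3 -> v < 3 -> u != v -> f u != f v.
  by move=> u3 v3; apply: contraNneq => /fi ->; rewrite ?vertex_K3.
exists (f a), (f b), (f c); split; first by rewrite !fne // -Eh Eab imfset_pair.
by split; rewrite -imfset_pair; apply/fG/fsub2_K3.
Qed.

End WeakSaturation.

(** * Percolation by triangles and collapses *)

Section Percolation.
Variable V : choiceType.
Implicit Types (K L G S F T : {fset {fset V}}) (s t r e : {fset V}) (es : seq {fset V}).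

(** A weak saturation by [K3] reduced to its combinatorics: each new edge comes with a vertex [w]
    whose two edges to its ends are already present. The list grows at its end because edges are
    added in list order. *)
Inductive percolates G : seq {fset V} -> Prop :=
| percolates0 : percolates G [::]
| percolatesS es x y w : percolates G es -> x != y -> y != w -> x != w ->
    [fset x; y] \notin G `|` [fset e in es] ->
    [fset y; w] \in G `|` [fset e in es] -> [fset x; w] \in G `|` [fset e in es] ->
    percolates G (rcons es [fset x; y]).

Lemma in_fsetU_seq G es e : (e \in G `|` [fset f in es]) = (e \in G) || (e \in es).
Proof. by rewrite !inE. Qed.

Lemma percolates_uniq G es : percolates G es -> uniq es.
Proof.
elim=> // {}es x y w _ ues _ _ _ + _ _.
by rewrite in_fsetU_seq negb_or rcons_uniq => /andP[_ ->].
Qed.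

Lemma percolates_card2 G es : percolates G es -> forall e, e \in es -> #|` e| = 2.
Proof.
elim=> // {}es x y w _ IH xy _ _ _ _ _ e.
by rewrite mem_rcons inE => /orP[/eqP ->|/IH //]; rewrite cardfs2 xy.
Qed.

Lemma percolates_sub G G' es : percolates G es -> G `<=` G' ->
  (forall e, e \in es -> e \notin G') -> percolates G' es.
Proof.
move=> pe GG'; elim: pe => [|{}es x y w _ IH xy yw xw xyn ywi xwi] nG'; first by constructor.
have sub e : e \in G `|` [fset f in es] -> e \in G' `|` [fset f in es].
  by rewrite !in_fsetU_seq => /orP[/(fsubsetP GG') ->|->] //; rewrite orbT.
apply: (@percolatesS _ _ _ _ w) => //; try exact: sub.
  by apply: IH => e ees; apply: nG'; rewrite mem_rcons inE ees orbT.
move: xyn; rewrite !in_fsetU_seq !negb_or => /andP[_ ->].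
by rewrite nG' // mem_rcons mem_head.
Qed.

Lemma percolates_copy G es : simplicial G -> percolates G es ->
  (forall e x, e \in es -> x \in e -> [fset x] \in G) ->
  forall i, i < size es ->
    has_copy_through K3 (G `|` [fset e in take i.+1 es]) (nth fset0 es i).
Proof.
move=> sG; elim=> // {}es x y w pe IH xy yw xw xyn ywi xwi vG i.
rewrite size_rcons ltnS leq_eqVlt => /orP[/eqP ->|lt_i]; last first.
  rewrite nth_rcons lt_i -cats1 takel_cat //; apply: IH => // e z ees ze.
  by apply: (vG e) => //; rewrite mem_rcons inE ees orbT.
rewrite nth_rcons ltnn eqxx take_oversize ?size_rcons //.
have sub e : e \in G `|` [fset f in es] -> e \in G `|` [fset f in rcons es [fset x; y]].
  by rewrite !in_fsetU_seq mem_rcons inE => /orP[]->; rewrite ?orbT.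
apply: (has_copyI (w := w)) => //; try exact: sub; last first.
  by rewrite in_fsetU_seq mem_rcons mem_head orbT.
have card2 e : e \in rcons es [fset x; y] -> #|` e| = 2.
  rewrite mem_rcons inE => /orP[/eqP ->|]; first by rewrite cardfs2 xy.
  exact: (percolates_card2 pe).
have G0 : fset0 \in G.
  by apply: (sG [fset x]) => //; apply: (vG [fset x; y]); rewrite ?mem_rcons ?mem_head // !inE eqxx.
move=> s t; rewrite !in_fsetU_seq => /orP[sG' ts|ses ts]; first by rewrite (sG s).
case: (eqVneq t s) => [->|nts]; first by rewrite ses orbT.
have : #|` t| <= 1.
  by rewrite -ltnS -(card2 _ ses); apply: fproper_ltn_card; rewrite fproperEneq nts.
case/cardfs_le1 => [->|[z Ez]]; first by rewrite G0.
by rewrite Ez (vG s) // -fsub1set -Ez.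
Qed.

Lemma copy_percolates G F es : uniq es -> (forall e, e \in es -> e \notin G /\ #|` e| = 2) ->
  (forall i, i < size es ->
    has_copy_through K3 (G `|` [fset e in take i.+1 es]) (nth fset0 es i)) ->
  percolates G es.
Proof.
elim/last_ind: es => [|es e IH]; first by constructor.
rewrite rcons_uniq => /andP[ees ues] nG cp.
have [eG e2] : e \notin G /\ #|` e| = 2 by apply: nG; rewrite mem_rcons mem_head.
have := cp (size es); rewrite size_rcons ltnSn nth_rcons ltnn eqxx take_oversize ?size_rcons //.
move=> /(_ isT)/has_copyE[] // x [y [w [[xy yw xw Ee] [ywi xwi]]]]; rewrite {}Ee in e2 eG ees nG cp ywi xwi *.
(* The other two edges of the copy miss [x] or [y], hence differ from the last edge and were present
   before it. *)
have sub z z' : z' \notin [fset z; w] -> z' \in [fset x; y] -> 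
    [fset z; w] \in G `|` [fset f in rcons es [fset x; y]] ->
    [fset z; w] \in G `|` [fset f in es].
  move=> nz zi; rewrite !in_fsetU_seq mem_rcons inE => /or3P[->//|/eqP E|->]; last by rewrite orbT.
  by move: nz; rewrite E zi.
apply: (@percolatesS _ _ _ _ w) => //.
- apply: IH => // [f fes|i lt_i].
    by apply: nG; rewrite mem_rcons inE fes orbT.
  have := cp i; rewrite size_rcons nth_rcons lt_i -cats1 takel_cat //; apply; lia.
- by rewrite in_fsetU_seq negb_or eG.
- by apply: (sub y x) => //; rewrite !inE ?eqxx // negb_or xy.
by apply: (sub x y) => //; rewrite !inE ?eqxx ?orbT // negb_or eq_sym xy.
Qed.

(** The ends of a new edge are already joined through [w], so percolation never merges
    components. *)
Lemma percolates_reach G es : percolates G es -> forall x y,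
  [fset x; y] \in G `|` [fset e in es] -> reach G x y.
Proof.
elim=> [|{}es a b w _ IH ab bw aw _ bwi awi] x y.
  by rewrite in_fsetU_seq orbF => /reach1.
rewrite in_fsetU_seq mem_rcons inE orbCA => /orP[/eqP E|]; last first.
  by rewrite -in_fsetU_seq => /IH.
have rab : reach G a b by apply: reach_trans (IH _ _ awi) (reach_sym (IH _ _ bwi)).
have : x \in [fset a; b] by rewrite -E !inE eqxx.
have : y \in [fset a; b] by rewrite -E !inE eqxx orbT.
rewrite !inE => /orP[]/eqP -> /orP[]/eqP ->; do ?exact: reach_refl; first exact: reach_sym.
exact: rab.
Qed.

(** The collapse is read from the final point upwards. A removed vertex contributes an edge to the
    tree [G], a removed triangle contributes an edge to the percolation, and a collapse of a
    triangle from a free vertex contributes both. *)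
Lemma collapsible_percolation K : simplicial K -> (forall s, s \in K -> #|` s| <= 3) -> collapsible K ->
  exists G es, [/\ simplicial G, G `<=` skeleton 1 K, vertices G = vertices K,
    percolates G es & es =i faces K 1 `\` faces G 1] /\
    #|` faces G 1|.+1 = #|` vertices K|.
Proof.
move=> sK K3 [v _ cK].
(* The additional claim [fset0 \in G] excludes a collapse whose free face is empty. *)
suff [G [es [H1 [H2 _]]]] : exists G es, [/\ simplicial G, G `<=` skeleton 1 K,
    vertices G = vertices K, percolates G es & es =i faces K 1 `\` faces G 1] /\
    #|` faces G 1|.+1 = #|` vertices K| /\ fset0 \in G by exists G, es.
move El : [fset fset0; [fset v]] cK => E cK.
elim: cK sK K3 El => [{}K|{}K K' L eK _ IH] sK K3 El.
  rewrite -{}El in sK *; exists [fset fset0; [fset v]], [::].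
  have fK : faces [fset fset0; [fset v]] 1 = fset0.
    apply/fsetP => s; rewrite in_faces1 !inE.
    by apply/negP => /andP[/orP[]/eqP ->]; rewrite ?cardfs0 ?cardfs1.
  split; first split=> //.
  - apply/fsubsetP => s sS; rewrite in_skeleton1 sS /=; move: sS; rewrite !inE.
    by case/orP => /eqP ->; rewrite ?cardfs0 ?cardfs1.
  - exact: percolates0.
  - by move=> s; rewrite fK !inE.
  rewrite fK cardfs0; split; last by rewrite !inE eqxx.
  suff -> : vertices [fset fset0; [fset v]] = [fset v] by rewrite cardfs1.
  apply/fsetP => x; rewrite in_vertices // !inE -cardfs_eq0 cardfs1 /=.
  by apply/eqP/eqP => [/fset1_inj|->].
have [t [s [[sK' ms] ts ub EK']]] := elementary_collapseP eK.
have sub r : r \in K' = (r \in K) && ~~ (t `<=` r) by rewrite EK' in_fsep.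
have sK1 := elementary_collapse_simplicial sK eK.
have {IH}[|G [es [[sG GK vG pG esE] [nG G0]]]] := IH sK1 _ El.
  by move=> r; rewrite sub => /andP[/K3].
have GK' r : r \in G -> r \in K' /\ #|` r| <= 2.
  by move/(fsubsetP GK); rewrite in_skeleton1 => /andP[].
have esP e : (e \in es) = [&& e \in K', #|` e| == 2 & e \notin G].
  rewrite esE in_fsetD !in_faces1.
  by case: (e \in K'); case: (#|` e| == 2); case: (e \in G).
have t0 : 0 < #|` t|.
  rewrite cardfs_gt0; apply/eqP => E0.
  by have := (GK' _ G0).1; rewrite sub E0 fsub0set andbF.
have lt_ts := fproper_ltn_card ts; have s3 := K3 _ sK'.
have [t1|t2] : #|` t| = 1 \/ #|` t| = 2 by lia.
  (* A vertex [c] is removed: it becomes a leaf of the tree, hung on another vertex [x] of the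
     facet. *)
  have /eqP/cardfs1P[c Et] := t1; subst t.
  have cs : c \in s by rewrite -fsub1set fproper_sub.
  have /fproperP[_ [x xs]] := ts; rewrite in_fset1 => xc.
  have xK' : [fset x] \in K' by rewrite sub (sK s) ?fsub1set // in_fset1 eq_sym.
  have xG : [fset x] \in G by rewrite -in_vertices // vG in_vertices.
  have ncK' r : r \in K' -> c \notin r by rewrite sub fsub1set => /andP[].
  have cG : [fset c] \notin G by apply/negP => /GK'[/ncK']; rewrite fset11.
  have sG' := @add_edge_simplicial _ G x c sG xG.
  have vK : #|` vertices K| = #|` vertices K'|.+1.
    suff -> : vertices K = c |` vertices K' by rewrite cardfsU1 in_vertices // sub fsubset_refl andbF.
    apply/fsetP => z; rewrite in_fset1U !in_vertices // sub fsub1set in_fset1.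
    case: eqVneq => [->|]; last by rewrite andbT.
    by apply: (sK s) => //; rewrite fsub1set.
  have cK : [fset c] \in K by apply: (sK s) => //; rewrite fsub1set.
  have xcK : [fset x; c] \in K by apply: (sK s) => //; rewrite fsubUset !fsub1set xs.
  have vGK : vertices (G `|` [fset [fset c]; [fset x; c]]) = vertices K.
    have GK1 : vertices (G `|` [fset [fset c]; [fset x; c]]) `<=` vertices K.
      apply: vertices_sub; rewrite !fsubUset !fsub1set cK xcK !andbT.
      by apply/fsubsetP => r /GK'[]; rewrite sub => /andP[].
    by apply/eqP; rewrite eqEfcard GK1 vertices_add_edge // vK vG leqnn.
  have pG' : percolates (G `|` [fset [fset c]; [fset x; c]]) es.
    apply: percolates_sub pG (fsubsetUl _ _) _ => e; rewrite esP => /and3P[eK1 _ eG].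
    rewrite !in_fsetU !in_fset1 !negb_or eG /=; apply/andP; split.
      by apply/eqP => E0; have := ncK' _ eK1; rewrite E0 !inE eqxx.
    by apply/eqP => E0; have := ncK' _ eK1; rewrite E0 !inE eqxx orbT.
  have skG : G `|` [fset [fset c]; [fset x; c]] `<=` skeleton 1 K.
    rewrite !fsubUset !fsub1set !in_skeleton1 cardfs1 cardfs2 xc cK xcK !andbT.
    by apply/fsubsetP => r /GK'[]; rewrite in_skeleton1 sub => /andP[-> _] ->.
  have nG' : #|` faces (G `|` [fset [fset c]; [fset x; c]]) 1|.+1 = #|` vertices K|.
    by rewrite faces1_add_edge // nG vK.
  have [s2|s2] : #|` s| = 2 \/ #|` s| = 3 by move: lt_ts s3; rewrite cardfs1; case: #|` s| => [|[|[|[|]]]] //; [left|right].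
    have Es : s = [fset x; c].
      by apply/esym/eqP; rewrite eqEfcard fsubUset !fsub1set xs cs s2 cardfs2 xc.
    exists (G `|` [fset [fset c]; [fset x; c]]), es; split; last by rewrite nG' in_fsetU G0.
    split=> // e; rewrite esP in_fsetD !in_faces1 !in_fsetU !in_fset1 sub fsub1set.
    case: (boolP (#|` e| == 2)) => e2; last by rewrite !andbF.
    rewrite !andbT; case: (boolP (c \in e)) => ce; rewrite ?andbF ?andbT /=.
      apply/esym/negP => /andP[+ eiK]; rewrite !negb_or => /and3P[_ _ /negP[]].
      rewrite -Es eqEfcard (eqP e2) s2 andbT; apply: ub => //; by rewrite fsub1set.
    rewrite andbC; case: (e \in K); rewrite ?andbF // !andbT.
    have -> : (e == [fset c]) = false by apply: contraNF ce => /eqP ->; rewrite !inE.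
    have -> : (e == [fset x; c]) = false by apply: contraNF ce => /eqP ->; rewrite !inE eqxx orbT.
    by rewrite !orbF.
  (* The facet is a triangle on [c], [x] and [y]; the edge from [y] to [c] percolates through
     [x]. *)
  have /eqP/cardfs1P[y Ey] : #|` s `\ c `\ x| = 1.
    by rewrite (cardfsD1_in (cardfsD1_in s2 cs)) // !inE xc.
  have : y \in s `\ c `\ x by rewrite Ey in_fset1.
  rewrite !inE => /and3P[yx yc ys].
  have sE z : z \in s -> [|| z == c, z == x | z == y].
    move=> zs; case: eqVneq => //= zc; case: eqVneq => //= zx.
    by rewrite -in_fset1 -Ey !inE zc zx.
  have EK e : e \in K -> #|` e| = 2 -> c \in e -> e = [fset x; c] \/ e = [fset y; c].
    move=> eiK e2 ce; have es' : e `<=` s by apply: ub => //; rewrite fsub1set.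
    case: (boolP (x \in e)) => xe; [left|right]; apply/esym/eqP.
      by rewrite eqEfcard fsubUset !fsub1set xe ce e2 cardfs2 xc.
    rewrite eq_sym eqEfcard e2 cardfs2 yc andbT; apply/fsubsetP => z ze.
    have := sE z (fsubsetP es' z ze); rewrite !inE => /or3P[-> |/eqP E0|->]; rewrite ?orbT //.
    by rewrite -E0 ze in xe.
  have ycn : [fset y; c] \notin (G `|` [fset [fset c]; [fset x; c]]) `|` [fset e in es].
    rewrite in_fsetU_seq !in_fsetU !in_fset1 !negb_or -!andbA; apply/and4P; split.
    - by apply/negP => /GK'[/ncK']; rewrite !inE eqxx orbT.
    - by apply/eqP => E0; have := cardfs2 y c; rewrite E0 cardfs1 yc.
    - apply/eqP => E0; have : y \in [fset x; c] by rewrite -E0 !inE eqxx.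
      by rewrite !inE (negbTE yx) (negbTE yc).
    - by rewrite esP; apply/negP => /and3P[/ncK']; rewrite !inE eqxx orbT.
  exists (G `|` [fset [fset c]; [fset x; c]]), (rcons es [fset y; c]).
  split; last by rewrite nG' in_fsetU G0.
  split=> //.
    apply: (@percolatesS _ _ _ _ x) => //; first by rewrite eq_sym.
      by rewrite in_fsetU_seq !in_fsetU !in_fset1 (fsetUC [fset c]) eqxx !orbT.
    have yxK' : [fset y; x] \in K'.
      rewrite sub fsub1set in_fset2 negb_or ![c == _]eq_sym yc xc andbT.
      by rewrite (sK s) // fsubUset !fsub1set ys.
    by rewrite in_fsetU_seq esP yxK' cardfs2 yx /= in_fsetU; case: (_ \in G); rewrite ?orbT.
  move=> e; rewrite mem_rcons inE esP in_fsetD !in_faces1 !in_fsetU !in_fset1 sub fsub1set.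
  case: (boolP (#|` e| == 2)) => e2; last first.
    rewrite !andbF orbF; apply/eqP => E0; by move: e2; rewrite E0 cardfs2 yc.
  rewrite !andbT; case: (boolP (c \in e)) => ce; rewrite ?andbF ?andbT /=.
    rewrite orbF; apply/eqP/andP => [->|[+ eiK]].
      split; last by apply: (sK s) => //; rewrite fsubUset !fsub1set ys.
      by move: ycn; rewrite in_fsetU_seq !in_fsetU !in_fset1 negb_or => /andP[].
    case: (EK e eiK (eqP e2) ce) => // ->.
    by rewrite eqxx !orbT.
  have -> : (e == [fset y; c]) = false by apply: contraNF ce => /eqP ->; rewrite !inE eqxx orbT.
  have -> : (e == [fset c]) = false by apply: contraNF ce => /eqP ->; rewrite !inE.
  have -> : (e == [fset x; c]) = false by apply: contraNF ce => /eqP ->; rewrite !inE eqxx orbT.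
  by rewrite !orbF /= andbC.
(* An edge is removed together with a triangle; it percolates through the third vertex [w]. *)
have [x [y [xy Et]]] := cardfs2_ex t2; subst t.
have s3' : #|` s| = 3 by lia.
have /fproperP[_ [w ws]] := ts; rewrite !inE negb_or => /andP[wx wy].
have [xs ys] : x \in s /\ y \in s.
  by apply/andP; rewrite -!fsub1set -fsubUset; apply: fproper_sub.
have vK : vertices K' = vertices K.
  apply/fsetP => z; rewrite !in_vertices // sub; apply: andb_idr => _.
  by apply/negP => /fsubset_leq_card; rewrite cardfs1 cardfs2 xy.
have K'w z : z \in s -> z != w -> ~~ ([fset x; y] `<=` [fset z; w]) -> [fset z; w] \in G `|` [fset e in es].
  move=> zs zw nz; rewrite in_fsetU_seq esP cardfs2 zw /= sub nz.
  rewrite (sK s) ?fsubUset ?fsub1set ?zs //=; by case: (_ \in G).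
exists G, (rcons es [fset x; y]); split; last by rewrite nG vK.
split=> //.
- by apply/fsubsetP => r /GK'[]; rewrite in_skeleton1 sub => /andP[-> _] ->.
- by rewrite vG vK.
- apply: (@percolatesS _ _ _ _ w) => //; rewrite 1?[_ == w]eq_sym //.
  + rewrite in_fsetU_seq negb_or esP sub fsubset_refl !andbF andbT.
    by apply/negP => /GK'[]; rewrite sub fsubset_refl andbF.
  + by apply: K'w => //; rewrite 1?eq_sym // fsubUset !fsub1set !inE negb_and !negb_or xy eq_sym wx.
  + by apply: K'w => //; rewrite 1?eq_sym // fsubUset !fsub1set !inE negb_and !negb_or [y == x]eq_sym xy [y == w]eq_sym wy orbT.
move=> e; rewrite mem_rcons inE esP in_fsetD !in_faces1 sub.
case: (boolP (#|` e| == 2)) => e2; last first.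
  by rewrite !andbF orbF; apply/eqP => E0; move: e2; rewrite E0 cardfs2 xy.
have -> : ([fset x; y] `<=` e) = (e == [fset x; y]).
  by rewrite eq_sym eqEfcard (eqP e2) t2 leqnn andbT.
case: eqVneq => [->|_]; last by rewrite /= !andbT /= andbC.
rewrite /= !andbT (sK s) ?fproper_sub // andbT; apply/esym/negP => /GK'[].
by rewrite sub fsubset_refl andbF.
Qed.

(** Each percolation step closes a 3-clique, whose triangle belongs to [L] by the clique hypothesis.
    Adding the edge and the triangle together is an elementary collapse read backwards, with the new
    edge as free face; [T] gathers these triangles. *)
Lemma percolation_collapse L G es : simplicial L -> (forall s, s \in L -> #|` s| <= 3) ->
  (forall x y w, x != y -> y != w -> x != w -> [fset x; y] \in L -> [fset y; w] \in L ->
     [fset x; w] \in L -> [fset x; y; w] \in L) ->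
  simplicial G -> G `<=` L -> (forall e, e \in es -> e \in L) -> percolates G es ->
  exists T, [/\ T `<=` faces L 2, simplicial (G `|` [fset e in es] `|` T) &
    collapses (G `|` [fset e in es] `|` T) G].
Proof.
move=> sL L3 flag sG GL; set S := fun es => G `|` [fset e in es].
move=> esL pe; elim: pe esL => [|{}es x y w pe IH xy yw xw xyn ywi xwi] esL.
  exists fset0; rewrite (_ : _ `|` _ = G); first by split; [exact: fsub0set| |exact: collapses_refl].
  by apply/fsetP => s; rewrite in_fsetU in_fsetU_seq !inE !orbF.
have [|T [TL sT cT]] := IH.
  by move=> e ees; apply: esL; rewrite mem_rcons inE ees orbT.
have SL e : e \in S es -> e \in L.
  rewrite in_fsetU_seq => /orP[/(fsubsetP GL) //|ees]; apply: esL.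
  by rewrite mem_rcons inE ees orbT.
set th := [fset x; y; w]; have thL : th \in L.
  by apply: flag => //; try exact: SL; apply: esL; rewrite mem_rcons mem_head.
have th3 : #|` th| = 3.
  by rewrite /th fsetUC cardfsU1 !inE cardfs2 xy negb_or ![w == _]eq_sym xw yw.
exists (th |` T).
set M := S es `|` T in sT cT.
have -> : G `|` [fset e in rcons es [fset x; y]] `|` (th |` T) = M `|` [fset [fset x; y]; th].
  apply/fsetP => s; rewrite /M /S !(in_fsetU, in_fset1) !(inE, mem_rcons) /=.
  by case: (s \in G); case: (s == _); case: (s \in es); case: (s == th); case: (s \in T).
have xyM : [fset x; y] \notin M.
  rewrite in_fsetU negb_or xyn /=; apply/negP => /(fsubsetP TL).
  by rewrite in_faces (@fdimE _ _ 2) cardfs2 xy andbF.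
have ML s : s \in M -> s \in L.
  rewrite in_fsetU => /orP[/SL//|/(fsubsetP TL)]; by rewrite in_faces => /andP[].
(* A proper face of the triangle other than the new edge lies in one of the two old edges. *)
have sub r : r `<=` th -> r != th -> r != [fset x; y] -> r \in M.
  move=> rth rne rxy; have /fproperP[_ [z zth zr]] : r `<` th by rewrite fproperEneq rne.
  have sub2 u v : [fset u; v] \in S es -> r `<=` [fset u; v] -> r \in M.
    by move=> uv; apply: sT; rewrite in_fsetU uv.
  have rz : r `<=` th `\ z by apply: fsubset_rem.
  have {}zth : [|| z == x, z == y | z == w] by move: zth; rewrite !inE -orbA.
  case/or3P: zth => /eqP E; rewrite E in zr rz.
  - apply: (sub2 _ _ ywi); apply: fsubset_trans rz _; apply/fsubsetP => u; rewrite !inE.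
    by case: eqP.
  - apply: (sub2 _ _ xwi); apply: fsubset_trans rz _; apply/fsubsetP => u; rewrite !inE.
    by case: eqP => //; case: eqP.
  have {}rz : r `<=` [fset x; y].
    apply: fsubset_trans rz _; apply/fsubsetP => u; rewrite !inE.
    by case: eqP => //; rewrite orbF.
  have /fproperP[_ [u uxy ur]] : r `<` [fset x; y] by rewrite fproperEneq rxy.
  have {}rz : r `<=` [fset x; y] `\ u by apply: fsubset_rem.
  have {}uxy : (u == x) || (u == y) by move: uxy; rewrite !inE.
  case/orP: uxy => /eqP Eu.
    apply: (sub2 _ _ ywi); apply: fsubset_trans rz _; apply/fsubsetP => v; rewrite !inE Eu.
    by case: eqP => //= _ ->.
  apply: (sub2 _ _ xwi); apply: fsubset_trans rz _; apply/fsubsetP => v; rewrite !inE Eu.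
  by case: eqP => //= _; rewrite orbF => ->.
clearbody M; have xyth : [fset x; y] `<=` th by rewrite /th; apply: fsubsetUl.
have sM : simplicial (M `|` [fset [fset x; y]; th]).
  move=> s t; rewrite !in_fsetU !in_fset1 => st ts.
  case: (eqVneq t [fset x; y]) => //= txy; first by rewrite orbT.
  case: (eqVneq t th) => //= tth; first by rewrite orbT.
  rewrite orbF; case/or3P: st ts => [sM|/eqP ->|/eqP ->] ts; first exact: sT ts.
    by apply: sub => //; apply: fsubset_trans xyth.
  exact: sub.
split=> //.
  rewrite fsubUset TL andbT fsub1set in_faces thL /=.
  by rewrite (@fdimE _ _ 2) th3.
apply: collapses_step cT.
have E : M = [fset r in M `|` [fset [fset x; y]; th] | ~~ ([fset x; y] `<=` r)].
  apply/fsetP => r; rewrite in_fsep in_fsetU in_fset2; apply/idP/andP => [rM|].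
    by rewrite rM; split=> //; apply: contraNN xyM; apply: sT.
  by case=> /orP[//|/orP[]/eqP ->]; rewrite ?fsubset_refl ?xyth.
rewrite [X in elementary_collapse _ X]E.
have ub r : r \in M `|` [fset [fset x; y]; th] -> [fset x; y] `<=` r -> r `<=` th.
  rewrite !in_fsetU !in_fset1 => /or3P[rM xyr|/eqP -> //|/eqP -> //].
  by case/negP: xyM; apply: sT xyr.
apply: (@elementary_collapseI _ _ th) => //.
  split; first by rewrite !in_fsetU !in_fset1 eqxx !orbT.
  move=> t tM tht; apply/eqP; rewrite eqEfsubset tht andbT; apply: ub => //.
  exact: fsubset_trans tht.
by rewrite fproperEcard xyth th3 cardfs2 xy.
Qed.

End Percolation.

Section BigMin.
Variables (I : eqType) (d : nat) (P : pred I) (f : I -> nat).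

Lemma bigmin_le (s : seq I) i : i \in s -> P i -> \big[minn/d]_(j <- s | P j) f j <= f i.
Proof.
elim: s => // j s IH; rewrite inE big_cons => /orP[/eqP <- ->|si Pi]; first exact: geq_minl.
by case: ifP => _; rewrite ?IH // (leq_trans (geq_minr _ _)) ?IH.
Qed.

Lemma bigmin_ge (s : seq I) c : c <= d -> (forall i, i \in s -> P i -> c <= f i) ->
  c <= \big[minn/d]_(j <- s | P j) f j.
Proof.
move=> cd H; rewrite big_seq_cond; apply: (big_ind (fun x => c <= x)) => //.
  by move=> x y; rewrite leq_min => -> ->.
by move=> i /andP[]; apply: H.
Qed.

Lemma bigmin_attained (s : seq I) : \big[minn/d]_(j <- s | P j) f j = d \/
  exists i, [/\ i \in s, P i & \big[minn/d]_(j <- s | P j) f j = f i].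
Proof.
elim: s => [|j s IH]; first by rewrite big_nil; left.
rewrite big_cons; case: ifP => Pj; last first.
  by case: IH => [->|[i [si Pi E]]]; [left|right; exists i; rewrite inE si orbT].
have [le_j|lt_j] := leqP (f j) (\big[minn/d]_(j <- s | P j) f j).
  by right; exists j; rewrite mem_head Pj.
by case: IH => [->|[i [si Pi E]]]; [left|right; exists i; rewrite inE si orbT].
Qed.

End BigMin.

(** * The weak saturation number and removal of triangles *)

Section RemovalSaturation.
Variable V : choiceType.
Variable L : {fset {fset V}}.
Implicit Types (G T : {fset {fset V}}).
Hypotheses (sL : simplicial L) (L3 : forall s, s \in L -> #|` s| <= 3).
Hypotheses (cL : connected L) (L0 : vertices L != fset0).

Let F := skeleton 1 L.

Lemma saturated_percolates G es : weakly_saturated K3 F G -> uniq es ->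
  es =i faces F 1 `\` faces G 1 ->
  (forall i, i < size es ->
      has_copy_through K3 (G `|` [fset e in take i.+1 es]) (nth fset0 es i)) ->
  percolates G es.
Proof.
move=> _ ues esE; apply: copy_percolates => // e; rewrite esE in_fsetD !in_faces1.
by case/andP => + /andP[_ e2]; rewrite e2 andbT => ->; rewrite (eqP e2).
Qed.

(** By [percolates_reach] the ends of every edge of [L] are connected within [G]. This is the source
    of the lower bound on the weak saturation number. *)
Lemma saturated_connected G : weakly_saturated K3 F G -> connected G.
Proof.
move=> wG; have [sG GF vG [es [ues esE cp]]] := wG.
have pG := saturated_percolates wG ues esE cp.
move=> u v; rewrite vG vertices_skeleton // => uL vL.
suff: reach G u v by [].
move: (cL uL vL); apply: (@reach_ind _ L u); first exact: reach_refl.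
move=> x y ux xyL; apply: reach_trans ux _.
case: (eqVneq x y) => [->|xy]; first exact: reach_refl.
apply: (percolates_reach pG); rewrite in_fsetU_seq esE in_fsetD !in_faces1 in_skeleton1.
by rewrite xyL cardfs2 xy /=; case: (_ \in G).
Qed.

Lemma saturated_card G : weakly_saturated K3 F G -> #|` vertices L| <= #|` faces G 1|.+1.
Proof.
move=> wG; have cG := saturated_connected wG.
have [sG GF vG _] := wG; have vGL : vertices G = vertices L by rewrite vG vertices_skeleton.
have [|S [SG _ _ _ eS]] := spanning_tree sG cG; first by rewrite vGL.
rewrite -vGL -eS ltnS; apply/fsubset_leq_card/fsubsetP => e.
by rewrite !in_faces1 => /andP[/(fsubsetP SG) -> ->].
Qed.

Lemma self_saturated : weakly_saturated K3 F F.
Proof.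
split=> //; first exact: skeleton_simplicial.
by exists [::]; split=> // e; rewrite fsetDv.
Qed.

(** Removing triangles leaves the graph unchanged, so the percolation extracted from the collapse
    saturates the graph of [L] itself, starting from a tree. The matching lower bound is
    [saturated_card]. *)
Lemma removal_wsat T : T `<=` faces L 2 -> collapsible (L `\` T) ->
  wsat F K3 = #|` vertices L| - 1.
Proof.
move=> TL cT; have T3 s : s \in T -> #|` s| = 3.
  by move/(fsubsetP TL); rewrite in_faces (@fdimE _ s 2) => /andP[_ /eqP].
have sLT : simplicial (L `\` T).
  move=> s r; rewrite !in_fsetD => /andP[sT sL'] rs; rewrite (sL sL') // andbT.
  apply: contraNN sT => rT; rewrite (_ : s = r) //; apply/esym/eqP.
  by rewrite eqEfcard rs (T3 _ rT) L3.
have small (s : {fset V}) : #|` s| <= 2 -> (s \in L `\` T) = (s \in L).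
  by move=> s2; rewrite in_fsetD andb_idl // => _; apply/negP => /T3; lia.
have skE : skeleton 1 (L `\` T) = F.
  apply/fsetP => s; rewrite !in_skeleton1; case: (leqP #|` s| 2) => s2; rewrite ?andbF //.
  by rewrite !andbT small.
have [|G [es [[sG GF vG pG esE] nG]]] := collapsible_percolation sLT _ cT.
  by move=> s; rewrite in_fsetD => /andP[_ /L3].
have fE : faces (L `\` T) 1 = faces F 1 by rewrite -skE faces1_skeleton.
have vE : vertices (L `\` T) = vertices L by rewrite -vertices_skeleton // skE vertices_skeleton.
rewrite skE in GF; rewrite fE in esE; rewrite vE in vG nG.
have sF : simplicial F by apply: skeleton_simplicial.
have wG : weakly_saturated K3 F G.
  split=> //; first by rewrite vertices_skeleton.
  exists es; split=> //; first exact: percolates_uniq pG.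
  apply: percolates_copy => // e x; rewrite esE in_fsetD !in_faces1 => /and3P[_ eF _] xe.
  rewrite -in_vertices // vG -(vertices_skeleton sL) in_vertices //.
  by apply: sF eF _; rewrite fsub1set.
apply/eqP; rewrite eqn_leq /wsat; apply/andP; split.
  rewrite -nG subn1 /=; apply: bigmin_le; first by rewrite fpowersetE.
  exact/asboolP.
apply: bigmin_ge => [|G' _ /asboolP wG'].
  by have := saturated_card self_saturated; rewrite subn1; case: #|` vertices L|.
by have := saturated_card wG'; rewrite subn1; case: #|` vertices L|.
Qed.

(** A saturated graph with the minimum number of edges is connected, hence equal to its spanning
    tree and collapsible. The triangles used by its percolation are kept, all others are removed. *)
Lemma wsat_removal :
  (forall x y w, x != y -> y != w -> x != w -> [fset x; y] \in L -> [fset y; w] \in L ->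
     [fset x; w] \in L -> [fset x; y; w] \in L) ->
  wsat F K3 = #|` vertices L| - 1 ->
  exists2 T, T `<=` faces L 2 & collapsible (L `\` T).
Proof.
move=> flag wE.
have n0 : 0 < #|` vertices L| by rewrite cardfs_gt0.
have [G wG nG] : exists2 G, weakly_saturated K3 F G & #|` faces G 1|.+1 = #|` vertices L|.
  (* If the minimum is its default value, the whole graph attains it. *)
  move: wE; rewrite /wsat; case: (bigmin_attained #|` faces F 1| (fun G => `[< weakly_saturated K3 F G >])
    (fun G => #|` faces G 1|) (fpowerset F)) => [->|].
    by move=> E; exists F; [exact: self_saturated|rewrite E subn1 prednK].
  by move=> [G [_ /asboolP wG ->]] E; exists G => //; rewrite E subn1 prednK.
have [sG GF vG [es [ues esE cp]]] := wG.
have vGL : vertices G = vertices L by rewrite vG vertices_skeleton.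
have pG := saturated_percolates wG ues esE cp.
have [|S [SG sS vS cS nS]] := spanning_tree sG (saturated_connected wG); first by rewrite vGL.
have GL : G `<=` L by apply: fsubset_trans GF _; apply/fsubsetP => s; rewrite in_skeleton1 => /andP[].
have G2 s : s \in G -> #|` s| <= 2 by move/(fsubsetP GF); rewrite in_skeleton1 => /andP[].
have n1 : #|` faces S 1| = #|` faces G 1| by apply/eqP; rewrite -eqSS nS nG vGL.
have f1 : faces S 1 = faces G 1.
  apply/eqP; rewrite eqEfcard n1 leqnn andbT; apply/fsubsetP => e.
  by rewrite !in_faces1 => /andP[/(fsubsetP SG) -> ->].
have [v vS' cSv] := cS.
have vG' : [fset v] \in G by rewrite -in_vertices // vGL -vGL -vS.
have G0 : fset0 \in G by apply: sG vG' _; apply: fsub0set.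
have ES : S = G.
  apply/eqP; rewrite eqEfsubset SG; apply/fsubsetP => s sG'.
  have := G2 s sG'; rewrite leq_eqVlt => /orP[s2|].
    have : s \in faces S 1 by rewrite f1 in_faces1 sG'.
    by rewrite in_faces1 => /andP[].
  rewrite ltnS => /cardfs_le1[->|[x Ex]]; first by rewrite (sS [fset v]) ?fsub0set // -in_vertices.
  by rewrite Ex -in_vertices // vS in_vertices // -Ex.
have GFe e : e \in es -> e \in L.
  by rewrite esE in_fsetD !in_faces1 in_skeleton1 => /and3P[_ /andP[-> _] _].
have [T [TL sT cT]] := percolation_collapse sL L3 flag sG GL GFe pG.
exists (faces L 2 `\` T); first exact: fsubsetDl.
have -> : L `\` (faces L 2 `\` T) = G `|` [fset e in es] `|` T.
  apply/fsetP => s; rewrite !in_fsetD in_faces (@fdimE _ s 2) in_fsetU in_fsetU_seq esE in_fsetD !in_faces1 in_skeleton1.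
  case: (boolP (s \in T)) => sTT.
    by move/(fsubsetP TL): sTT; rewrite in_faces => /andP[-> _] /=; rewrite orbT.
  rewrite /= orbF negb_and; case: (boolP (s \in G)) => sG'.
    rewrite (fsubsetP GL) // orTb andbT; have := G2 s sG'.
    by case: #|` s| => [|[|[|]]].
  case: (boolP (s \in L)) => sL' //=. rewrite andbT.
  have := L3 sL'; rewrite leq_eqVlt => /orP[/eqP -> //|].
  rewrite ltnS leq_eqVlt => /orP[/eqP -> //|].
  rewrite ltnS => /cardfs_le1[E|[x Ex]]; case/negP: sG'.
    by rewrite E.
  by rewrite Ex -in_vertices // vGL in_vertices // -Ex.
exists v; last by apply: collapses_trans cT _; rewrite -ES.
apply: (fsubsetP (vertices_sub _)) vS'; rewrite ES; apply/fsubsetP => s sG'.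
by rewrite !in_fsetU sG'.
Qed.

End RemovalSaturation.

(** * Regions *)

(* The hair h is the path Apex, Mid h, Tip h./2, so the hairs 2k and 2k+1 share
   the tip k. The vertices of the other four kinds lie in one region only. *)
Inductive vtx : Type :=
  | Apex | Mid of nat | Tip of nat | Ring of nat | Va of nat | Vb of nat | Vd of nat.

(** The residue modulo 7 records the kind and the quotient the index. Codes are thus affine in the
    index, which lets a program write them by copying unary counters. *)
Definition code (x : vtx) : nat :=
  match x with
  | Apex => 0 | Mid h => 7 * h + 1 | Tip k => 7 * k + 2 | Ring n => 7 * n + 3
  | Va n => 7 * n + 4 | Vb n => 7 * n + 5 | Vd n => 7 * n + 6
  end.

Definition decode (m : nat) : vtx :=
  let q := m %/ 7 in
  match m %% 7 with
  | 0 => Apex | 1 => Mid q | 2 => Tip q | 3 => Ring q | 4 => Va q | 5 => Vb q | _ => Vd q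
  end.

Lemma codeK : cancel code decode.
Proof.
have dE q r : r < 7 -> (7 * q + r) %/ 7 = q /\ (7 * q + r) %% 7 = r.
  by move=> r7; rewrite mulnC divnMDl // modnMDl divn_small // modn_small // addn0.
case=> [|n|n|n|n|n|n] //; rewrite /decode /code.
- by have [-> ->] := dE n 1 isT.
- by have [-> ->] := dE n 2 isT.
- by have [-> ->] := dE n 3 isT.
- by have [-> ->] := dE n 4 isT.
- by have [-> ->] := dE n 5 isT.
- by have [-> ->] := dE n 6 isT.
Qed.

HB.instance Definition _ := Choice.copy vtx (can_type codeK).

Lemma code_inj : injective code. Proof. exact: can_inj codeK. Qed.

Definition vtx_eqb x y : bool :=
  match x, y with
  | Apex, Apex => true
  | Mid n, Mid m | Tip n, Tip m | Ring n, Ring m | Va n, Va m | Vb n, Vb m | Vd n, Vd m => n == m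
  | _, _ => false
  end.

Lemma vtxE x y : (x == y) = vtx_eqb x y.
Proof.
apply/eqP/idP => [->|]; first by case: y => /=.
by case: x y => [|n|n|n|n|n|n] [|m|m|m|m|m|m] //= /eqP ->.
Qed.

Definition kind x : nat :=
  match x with
  | Apex => 0 | Mid _ => 1 | Tip _ => 2 | Ring _ => 3 | Va _ => 4 | Vb _ => 5 | Vd _ => 6
  end.

(* A disc with outer vertices v0, p, c, z, cut along the hair v0, m, u. *)
Definition block_tris (T : Type) (v0 p m u c a b d z : T) : seq (seq T) :=
  [:: [:: v0; p; m]; [:: p; m; a]; [:: m; u; a]; [:: u; a; d]; [:: p; a; d]; [:: p; d; c];
      [:: u; b; d]; [:: m; u; b]; [:: m; b; z]; [:: b; d; z]; [:: v0; m; z]; [:: d; z; c]].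

(** The block lies between the paths from the apex through [Ring n] and through [Ring n.+1] to
    [Tip k], and both edges of the hair [h] are interior to it. The vertices [Va], [Vb] and [Vd]
    keep [Tip h./2] apart from [Tip k] and from both ring vertices, so that no unfilled 3-clique
    arises. *)
Definition block k n h : seq (seq vtx) :=
  block_tris Apex (Ring n) (Mid h) (Tip h./2) (Tip k)
    (Va n.+1) (Vb n.+1) (Vd n.+1) (Ring n.+1).

(** Joins the boundary hair [k.*2] to the path through the first ring vertex; [footer] joins the
    path through the last ring vertex to the other boundary hair. *)
Definition header k n : seq (seq vtx) :=
  [:: [:: Apex; Mid k.*2; Ring n]; [:: Mid k.*2; Ring n; Tip k]].

Definition footer k n : seq (seq vtx) :=
  [:: [:: Apex; Ring n; Mid k.*2.+1]; [:: Ring n; Mid k.*2.+1; Tip k]].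

Arguments block : simpl never.
Arguments block_tris : simpl never.
Arguments header : simpl never.
Arguments footer : simpl never.

Fixpoint blocks k n hs : seq (seq vtx) :=
  if hs is h :: hs' then block k n h ++ blocks k n.+1 hs' else footer k n.

Lemma blocks_cons k n h hs : blocks k n (h :: hs) = block k n h ++ blocks k n.+1 hs.
Proof. by []. Qed.

(* The region (k, hs) is bounded by the hairs 2k and 2k+1 and covers the hairs hs. *)
Definition region : Type := (nat * seq nat)%type.

Definition region_tris n (r : region) : seq (seq vtx) :=
  header r.1 n ++ blocks r.1 n r.2.

(** A region covering [m] hairs uses the [m.+1] ring indices from [n] on, and no other region uses
    them; hence the step of the counter. *)
Fixpoint tris n (rs : seq region) : seq (seq vtx) :=
  if rs is r :: rs' then region_tris n r ++ tris (n + size r.2).+1 rs' else [::].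

Fixpoint placed n (rs : seq region) : seq (nat * region) :=
  if rs is r :: rs' then (n, r) :: placed (n + size r.2).+1 rs' else [::].

Definition coded : seq (seq vtx) -> seq (seq nat) := map (map code).

Lemma trisE n rs : tris n rs = flatten [seq region_tris x.1 x.2 | x <- placed n rs].
Proof. by elim: rs n => //= r rs IH n; rewrite IH. Qed.

Lemma tris_placed n rs f :
  reflect (exists2 x, x \in placed n rs & f \in region_tris x.1 x.2) (f \in tris n rs).
Proof. by rewrite trisE; apply: flatten_mapP. Qed.

Lemma placed_region n rs x : x \in placed n rs -> x.2 \in rs.
Proof.
by elim: rs n => //= r rs IH n; rewrite !inE => /orP[/eqP ->|/IH ->]; rewrite ?eqxx ?orbT.
Qed.

Lemma region_placed n rs r : r \in rs -> exists q, (q, r) \in placed n rs.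
Proof.
elim: rs n => //= r' rs IH n; rewrite inE => /orP[/eqP <-|/(IH (n + size r'.2).+1)[q qr]].
  by exists n; rewrite mem_head.
by exists q; rewrite inE qr orbT.
Qed.

Lemma placed_ge n rs x : x \in placed n rs -> n <= x.1.
Proof.
elim: rs n => //= r rs IH n; rewrite inE => /orP[/eqP -> //|/IH].
by move=> h; apply: leq_trans h; rewrite -addnS leq_addr.
Qed.

Definition owns (x : nat * region) q := x.1 <= q <= x.1 + size x.2.2.

Lemma owns_uniq n rs x y q : x \in placed n rs -> y \in placed n rs ->
  owns x q -> owns y q -> x = y.
Proof.
rewrite /owns; elim: rs n => //= r rs IH n.
rewrite !inE => /orP[/eqP ->|xP] /orP[/eqP ->|yP] //=.
- move=> /andP[_ h1] /andP[h2 _].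
  by have := leq_trans (placed_ge yP) (leq_trans h2 h1); rewrite ltnn.
- move=> /andP[h1 _] /andP[_ h2].
  by have := leq_trans (placed_ge xP) (leq_trans h1 h2); rewrite ltnn.
exact: IH xP yP.
Qed.

Lemma blocksP k n hs f : f \in blocks k n hs ->
  (exists2 i, i < size hs & f \in block k (n + i) (nth 0 hs i)) \/ f \in footer k (n + size hs).
Proof.
elim: hs n => [|h hs IH] n; first by rewrite addn0; right.
rewrite blocks_cons mem_cat => /orP[fb|/IH[[i lt_i fb]|fb]].
- by left; exists 0; rewrite // addn0.
- by left; exists i.+1; rewrite //= -addSnnS.
by right; rewrite /= -addSnnS.
Qed.

Lemma blocks_block k n hs i f : i < size hs -> f \in block k (n + i) (nth 0 hs i) ->
  f \in blocks k n hs.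
Proof.
elim: hs n i => // h hs IH n [|i] lt_i; rewrite blocks_cons mem_cat.
  by rewrite addn0 => ->.
by rewrite -addSnnS => /IH ->; rewrite ?orbT.
Qed.

Lemma blocks_footer k n hs f : f \in footer k (n + size hs) -> f \in blocks k n hs.
Proof.
elim: hs n => [|h hs IH] n; first by rewrite addn0.
by rewrite blocks_cons mem_cat -addSnnS => /IH ->; rewrite orbT.
Qed.

Section MapCode.

Lemma edge_in_coded l x y : edge_in (coded l) (code x) (code y) = edge_in l x y.
Proof.
rewrite /edge_in has_map; apply: eq_has => f /=.
by rewrite !(mem_map code_inj).
Qed.

Lemma vertex_in_coded l x : vertex_in (coded l) (code x) = vertex_in l x.
Proof. by rewrite /vertex_in has_map; apply: eq_has => f /=; rewrite (mem_map code_inj). Qed.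

Lemma uniq_coded f : uniq f -> uniq (map code f).
Proof. by rewrite (map_inj_uniq code_inj). Qed.

Lemma built_coded l : built l -> built (coded l).
Proof.
elim=> [a b c u|a b c {}l _ IH u at_l]; first by constructor; exact: (uniq_coded u).
apply: (built_cons IH (uniq_coded u)).
by rewrite /attachable !edge_in_coded !vertex_in_coded.
Qed.

Lemma vertex_in_ex l m : vertex_in (coded l) m -> exists2 x, m = code x & vertex_in l x.
Proof.
case/hasP => f /mapP[g gl ->] /mapP[x xg ->]; exists x => //.
by apply/hasP; exists g.
Qed.

Lemma edge_in_ex l m m' : edge_in (coded l) m m' ->
  exists x y, [/\ m = code x, m' = code y & edge_in l x y].
Proof.
case/hasP => f /mapP[g gl ->] /andP[/mapP[x xg ->] /mapP[y yg ->]]; exists x, y.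
by split=> //; apply/hasP; exists g => //; rewrite xg.
Qed.

End MapCode.

Lemma in_complex_edge (V : choiceType) (l : seq (seq V)) x y :
  ([fset x; y] \in complex_of l) = edge_in l x y.
Proof.
rewrite in_complex_of; apply: eq_has => f.
by rewrite fsubUset !fsub1set !inE.
Qed.

Lemma in_complex_vertex (V : choiceType) (l : seq (seq V)) x :
  ([fset x] \in complex_of l) = vertex_in l x.
Proof. by rewrite in_complex_of; apply: eq_has => f; rewrite fsub1set !inE. Qed.

(** Searches the list for a triangle containing the clique; the longest list searched is a block,
    with twelve triangles. *)
Ltac filled_by l tac :=
  let rec try_from i := first
    [ by exists (nth [::] l i); [tac|rewrite !inE !eqxx ?orbT]
    | lazymatch i with 12 => fail | _ => try_from (S i) end ] in
  try_from 0.

(** * Every 3-clique of the graph is a face *)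

Section Flag.
Variable rs : seq region.
Let X := placed 0 rs.
Let L := tris 0 rs.

(** [heads] and [feet] mark the first and the last ring index of a region with tip [k], [blocked]
    marks the block from [Ring q] to [Ring q.+1] covering [h], and [owned] any ring index of the
    region. The edges are described by these relations alone. *)
Definition heads q k := exists hs, (q, (k, hs)) \in X.
Definition feet q k := exists n hs, (n, (k, hs)) \in X /\ q = n + size hs.
Definition blocked q k h :=
  exists n hs i, [/\ (n, (k, hs)) \in X, i < size hs, q = n + i & h = nth 0 hs i].
Definition owned q k := exists n hs, (n, (k, hs)) \in X /\ n <= q <= n + size hs.

Lemma owned_uniq q k k' : owned q k -> owned q k' -> k = k'.
Proof.
move=> [n [hs [x1 o1]]] [n' [hs' [x2 o2]]].
by have [_ ->] := owns_uniq x1 x2 o1 o2.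
Qed.

Lemma heads_owned q k : heads q k -> owned q k.
Proof. by move=> [hs x]; exists q, hs; rewrite leqnn leq_addr. Qed.

Lemma feet_owned q k : feet q k -> owned q k.
Proof. by move=> [n [hs [x ->]]]; exists n, hs; rewrite leqnn leq_addr. Qed.

Lemma blocked_owned q k h : blocked q k h -> owned q k.
Proof.
by move=> [n [hs [i [x i1 -> _]]]]; exists n, hs; rewrite leq_addr leq_add2l ltnW.
Qed.

Lemma blocked_ownedS q k h : blocked q k h -> owned q.+1 k.
Proof.
by move=> [n [hs [i [x i1 -> _]]]]; exists n, hs; rewrite -addnS leq_addr leq_add2l.
Qed.

Lemma blocked_uniq q k h k' h' : blocked q k h -> blocked q k' h' -> k = k' /\ h = h'.
Proof.
move=> b b'; have Ek := owned_uniq (blocked_owned b) (blocked_owned b'); split=> //.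
case: b b' => n [hs [i [x i1 Eq ->]]] [n' [hs' [i' [x' i1' Eq' ->]]]].
have [En _ Eh] : (n, (k, hs)) = (n', (k', hs')).
  apply: (owns_uniq (q := q) x x'); rewrite /owns /=.
    by rewrite Eq leq_addr leq_add2l ltnW.
  by rewrite Eq' leq_addr leq_add2l ltnW.
subst; congr nth; lia.
Qed.

Lemma trisP f : f \in L -> [\/ exists q k, heads q k /\ f \in header k q,
  exists q k, feet q k /\ f \in footer k q | exists q k h, blocked q k h /\ f \in block k q h].
Proof.
case/tris_placed => -[n [k hs]] x; rewrite mem_cat => /orP[fh|/blocksP[[i i1 fb]|ff]].
- by constructor 1; exists n, k; split=> //; exists hs.
- by constructor 3; exists (n + i), k, (nth 0 hs i); split=> //; exists n, hs, i.
by constructor 2; exists (n + size hs), k; split=> //; exists n, hs.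
Qed.

Lemma header_tris q k f : heads q k -> f \in header k q -> f \in L.
Proof.
by move=> [hs x] fh; apply/tris_placed; exists (q, (k, hs)); rewrite // mem_cat fh.
Qed.

Lemma footer_tris q k f : feet q k -> f \in footer k q -> f \in L.
Proof.
move=> [n [hs [x ->]]] fh; apply/tris_placed; exists (n, (k, hs)); rewrite // mem_cat.
by rewrite blocks_footer ?orbT.
Qed.

Lemma block_in_tris q k h f : blocked q k h -> f \in block k q h -> f \in L.
Proof.
move=> [n [hs [i [x i1 -> ->]]]] fh; apply/tris_placed; exists (n, (k, hs)) => //.
by rewrite mem_cat (blocks_block i1) ?orbT.
Qed.

(* The edges of the complex, with endpoints ordered by kind. *)
Inductive adj : vtx -> vtx -> Prop :=
| adj_apex_mid h : adj Apex (Mid h)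
| adj_apex_ring q : adj Apex (Ring q)
| adj_mid_head q k : heads q k -> adj (Mid k.*2) (Ring q)
| adj_mid_foot q k : feet q k -> adj (Mid k.*2.+1) (Ring q)
| adj_mid_ring q k h : blocked q k h -> adj (Mid h) (Ring q)
| adj_mid_ringS q k h : blocked q k h -> adj (Mid h) (Ring q.+1)
| adj_mid_tip h : adj (Mid h) (Tip h./2)
| adj_mid_va q k h : blocked q k h -> adj (Mid h) (Va q.+1)
| adj_mid_vb q k h : blocked q k h -> adj (Mid h) (Vb q.+1)
| adj_tip_ring q k : owned q k -> adj (Tip k) (Ring q)
| adj_tip_va q k h : blocked q k h -> adj (Tip h./2) (Va q.+1)
| adj_tip_vb q k h : blocked q k h -> adj (Tip h./2) (Vb q.+1)
| adj_tip_vd q k h : blocked q k h -> adj (Tip h./2) (Vd q.+1)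
| adj_tip_vd' q k h : blocked q k h -> adj (Tip k) (Vd q.+1)
| adj_ring_va q k h : blocked q k h -> adj (Ring q) (Va q.+1)
| adj_ring_vb q k h : blocked q k h -> adj (Ring q.+1) (Vb q.+1)
| adj_ring_vd q k h : blocked q k h -> adj (Ring q) (Vd q.+1)
| adj_ring_vdS q k h : blocked q k h -> adj (Ring q.+1) (Vd q.+1)
| adj_va_vd q k h : blocked q k h -> adj (Va q.+1) (Vd q.+1)
| adj_vb_vd q k h : blocked q k h -> adj (Vb q.+1) (Vd q.+1).

Lemma edge_adj x y : edge_in L x y -> x != y -> adj x y \/ adj y x.
Proof.
case/hasP => f /trisP[[q [k [hk]]]|[q [k [hk]]]|[q [k [h [hk]]]]];
  rewrite ?/header ?/footer ?/block ?/block_tris !inE => fE /andP[].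
- have tip_mid : adj (Mid k.*2) (Tip k) by have := adj_mid_tip k.*2; rewrite doubleK.
  have own := heads_owned hk.
  case/orP: fE => /eqP ->; rewrite !inE => /or3P[]/eqP -> /or3P[]/eqP ->; rewrite ?eqxx // => _;
    by [left; econstructor; eauto|right; econstructor; eauto|left|right].
- have tip_mid : adj (Mid k.*2.+1) (Tip k).
    by have := adj_mid_tip k.*2.+1; rewrite /= uphalf_double.
  have own := feet_owned hk.
  case/orP: fE => /eqP ->; rewrite !inE => /or3P[]/eqP -> /or3P[]/eqP ->; rewrite ?eqxx // => _;
    by [left; econstructor; eauto|right; econstructor; eauto|left|right].
have own := blocked_owned hk; have ownS := blocked_ownedS hk.
do 11?[case/orP: fE => [/eqP -> |fE]]; last move/eqP: fE => ->;
  rewrite !inE => /or3P[]/eqP -> /or3P[]/eqP ->; rewrite ?eqxx // => _;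
  by [left; econstructor; eauto|right; econstructor; eauto].
Qed.

Hypothesis hairs_ok : forall k hs h, (k, hs) \in rs -> h \in hs -> h./2 != k.

Lemma blocked_tip q k h : blocked q k h -> h./2 != k.
Proof.
move=> [n [hs [i [/placed_region x i1 _ ->]]]].
by apply: hairs_ok x _; apply: mem_nth.
Qed.

Definition clique_filled x y w := exists2 f, f \in L & [&& x \in f, y \in f & w \in f].

(** The edges are directed by kind, so inversion leaves finitely many cases. Uniqueness of the owner
    of an index identifies the parameters of the three edges, after which the clique is found in a
    single block, header or footer. *)
Lemma adj_clique x y w : adj x y -> adj y w -> adj x w -> clique_filled x y w.
Proof.
have inH q k i : heads q k -> i < 2 -> nth [::] (header k q) i \in L.
  by move=> hk i1; apply: (header_tris hk); apply: mem_nth.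
have inF q k i : feet q k -> i < 2 -> nth [::] (footer k q) i \in L.
  by move=> hk i1; apply: (footer_tris hk); apply: mem_nth.
have inB q k h i : blocked q k h -> i < 12 -> nth [::] (block k q h) i \in L.
  by move=> hk i1; apply: (block_in_tris hk); apply: mem_nth.
(* The tip of a covered hair is not the tip of the covering region, so it is joined to no ring
   vertex of that region. *)
have tipN q k h : blocked q k h -> owned q h./2 -> False.
  by move=> b o; have := blocked_tip b; rewrite (owned_uniq o (blocked_owned b)) eqxx.
have tipNS q k h : blocked q k h -> owned q.+1 h./2 -> False.
  by move=> b o; have := blocked_tip b; rewrite (owned_uniq o (blocked_ownedS b)) eqxx.
have Kd k : k.*2.+1./2 = k by rewrite /= uphalf_double.
move=> xy yw xw; inversion xy; subst; inversion yw; subst; inversion xw; subst;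
  rewrite ?Kd ?doubleK;
  try (match goal with B : blocked ?q _ _, O : owned ?q _ |- _ => by case: (tipN _ _ _ B O) end);
  try (match goal with B : blocked ?q _ _, O : owned ?q.+1 _ |- _ => by case: (tipNS _ _ _ B O) end);
  repeat match goal with B : blocked ?q ?k ?h, B' : blocked ?q ?k' ?h' |- _ =>
    case: (blocked_uniq B B') => ? ?; subst; clear B' end;
  try (match goal with B : blocked ?q ?k _, O : owned ?q ?k' |- _ =>
    have ? := owned_uniq O (blocked_owned B); subst end);
  try (match goal with B : blocked ?q ?k _, O : owned ?q.+1 ?k' |- _ =>
    have ? := owned_uniq O (blocked_ownedS B); subst end).
all: try lia.
all: match goal with
  | B : blocked ?q ?k ?h |- _ => filled_by (block k q h) ltac:(exact: inB)
  | B : heads ?q ?k |- _ => filled_by (header k q) ltac:(exact: inH)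
  | B : feet ?q ?k |- _ => filled_by (footer k q) ltac:(exact: inF)
  end.
Qed.

Lemma kind_adj x y : adj x y -> kind x < kind y.
Proof. by case. Qed.

Lemma tris_flag x y w : x != y -> y != w -> x != w ->
  edge_in L x y -> edge_in L y w -> edge_in L x w -> clique_filled x y w.
Proof.
have perm u v z a b c : clique_filled u v z -> (forall f : seq vtx, [&& u \in f, v \in f & z \in f] =
    [&& a \in f, b \in f & c \in f]) -> clique_filled a b c.
  by move=> [f fL fuv] E; exists f; rewrite // -E.
(* Of the eight orientations two are cyclic and contradict the order by kind; each of the others is
   sorted into an instance of [adj_clique]. *)
move=> xy yw xw /edge_adj/(_ xy) [] a1 /edge_adj/(_ yw) [] a2 /edge_adj/(_ xw) [] a3.
- exact: adj_clique a1 a2 a3.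
- by have := kind_adj a1; have := kind_adj a2; have := kind_adj a3; lia.
- apply: (perm _ _ _ _ _ _ (adj_clique a3 a2 a1)) => f.
  by case: (x \in f); case: (y \in f); case: (w \in f).
- apply: (perm _ _ _ _ _ _ (adj_clique a3 a1 a2)) => f.
  by case: (x \in f); case: (y \in f); case: (w \in f).
- apply: (perm _ _ _ _ _ _ (adj_clique a1 a3 a2)) => f.
  by case: (x \in f); case: (y \in f); case: (w \in f).
- apply: (perm _ _ _ _ _ _ (adj_clique a2 a3 a1)) => f.
  by case: (x \in f); case: (y \in f); case: (w \in f).
- by have := kind_adj a1; have := kind_adj a2; have := kind_adj a3; lia.
apply: (perm _ _ _ _ _ _ (adj_clique a2 a1 a3)) => f.
by case: (x \in f); case: (y \in f); case: (w \in f).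
Qed.

Lemma coded_flag x y w : x != y -> y != w -> x != w ->
  [fset x; y] \in complex_of (coded L) -> [fset y; w] \in complex_of (coded L) ->
  [fset x; w] \in complex_of (coded L) -> [fset x; y; w] \in complex_of (coded L).
Proof.
move=> xy yw xw; rewrite !in_complex_edge.
move=> /edge_in_ex[a [b [Ex Ey ab]]] e2 e3; subst x y.
have [c [_ [Ew _ _]]] : exists c d, [/\ w = code c, code b = code d & edge_in L d c].
  by case/edge_in_ex: e2 => d [c [Ed Ec dc]]; exists c, d.
subst w; rewrite !edge_in_coded in e2 e3.
have ne u v : code u != code v -> u != v by apply: contraNneq => ->.
have [f fL /and3P[af bf cf]] := tris_flag (ne _ _ xy) (ne _ _ yw) (ne _ _ xw) ab e2 e3.
rewrite in_complex_of; apply/hasP; exists (map code f); first exact: map_f.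
by rewrite !fsubUset !fsub1set !inE !(mem_map code_inj) af bf.
Qed.

End Flag.

(** * Euler characteristic of a union of regions *)

Section EulerLists.
Variable V : choiceType.
Implicit Types (l : seq (seq V)) (f : seq V) (a b c x y : V).

Lemma complex_of_cons f l : complex_of (f :: l) = complex_of l `|` fpowerset (fset_of f).
Proof.
apply/fsetP => s; rewrite in_fsetU fpowersetE !in_complex_of /= orbC.
by [].
Qed.

Lemma edge_in_cons f l x y : edge_in (f :: l) x y = (x \in f) && (y \in f) || edge_in l x y.
Proof. by []. Qed.

Lemma vertex_in_cons f l x : vertex_in (f :: l) x = (x \in f) || vertex_in l x.
Proof. by []. Qed.

Lemma edge_inC l x y : edge_in l x y = edge_in l y x.
Proof. by apply: eq_has => f; rewrite andbC. Qed.

Lemma edge_in_cat l l' x y : edge_in (l ++ l') x y = edge_in l x y || edge_in l' x y.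
Proof. exact: has_cat. Qed.

Lemma vertex_in_cat l l' x : vertex_in (l ++ l') x = vertex_in l x || vertex_in l' x.
Proof. exact: has_cat. Qed.

Lemma edge_inF l x y : vertex_in l x = false -> edge_in l x y = false.
Proof.
by move=> xl; apply: contraFF xl => /hasP[f fl /andP[xf _]]; apply/hasP; exists f.
Qed.

Lemma edge_inFr l x y : vertex_in l y = false -> edge_in l x y = false.
Proof. by rewrite edge_inC; apply: edge_inF. Qed.

Lemma eq_complex_of l l' : l =i l' -> complex_of l = complex_of l'.
Proof. by move=> E; apply/fsetP => s; rewrite !in_complex_of (eq_has_r E). Qed.

Let Kl l s t : s \in complex_of l -> t `<=` s -> t \in complex_of l.
Proof. exact: complex_of_simplicial. Qed.

(** A triangle glued along one edge meets the complex in a cone with apex [a]; in [euler_new_edge]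
    it is glued along two edges, a cone with apex [b]. Only a complete boundary, as in
    [euler_closing], changes the characteristic. *)
Lemma euler_new_vertex l f a b c : f =i [:: a; b; c] -> edge_in l a b ->
  vertex_in l c = false -> euler (complex_of (f :: l)) = euler (complex_of l).
Proof.
move=> fE ab nc; rewrite complex_of_cons; apply: (@euler_addcone _ _ _ a).
- exact: complex_of_simplicial.
- by rewrite in_fset_of fE !inE eqxx.
move=> r rK rf; apply: (Kl (s := [fset a; b])); first by rewrite in_complex_edge.
rewrite fsubUset fsub1set !inE eqxx /=; apply/fsubsetP => x xr.
have := fsubsetP rf x xr; rewrite in_fset_of fE !inE => /or3P[->|->|/eqP E]; rewrite ?orbT //.
suff : vertex_in l c by rewrite nc.
by rewrite -E -in_complex_vertex; apply: (Kl rK); rewrite fsub1set.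
Qed.

Lemma euler_new_edge l f a b c : f =i [:: a; b; c] -> edge_in l b a -> edge_in l b c ->
  edge_in l a c = false -> euler (complex_of (f :: l)) = euler (complex_of l).
Proof.
move=> fE ba bc nac; rewrite complex_of_cons; apply: (@euler_addcone _ _ _ b).
- exact: complex_of_simplicial.
- by rewrite in_fset_of fE !inE eqxx orbT.
move=> r rK rf.
have sub x y : x \notin r -> edge_in l b y -> fset_of [:: a; b; c] `\ x `<=` [fset b; y] ->
    b |` r \in complex_of l.
  move=> xr byl sxy; apply: (Kl (s := [fset b; y])); first by rewrite in_complex_edge.
  rewrite fsubUset fsub1set !inE eqxx /=; apply/fsubsetP => z zr.
  apply: (fsubsetP sxy); rewrite in_fsetD1 in_fset_of -fE -in_fset_of (fsubsetP rf) // andbT.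
  by apply: contraNneq xr => <-.
case: (boolP (a \in r)) => ar.
  case: (boolP (c \in r)) => cr.
    suff : edge_in l a c by rewrite nac.
    by rewrite -in_complex_edge; apply: (Kl rK); rewrite fsubUset !fsub1set ar.
  apply: sub cr ba _; apply/fsubsetP => z; rewrite !inE.
  by case: (z == a); case: (z == b); case: (z == c).
apply: sub ar bc _; apply/fsubsetP => z; rewrite !inE.
by case: (z == a); case: (z == b); case: (z == c).
Qed.

Lemma euler_closing l f a b c : uniq [:: a; b; c] -> f =i [:: a; b; c] ->
  edge_in l a b -> edge_in l b c -> edge_in l a c ->
  ~~ has (fun g => [&& a \in g, b \in g & c \in g]) l ->
  (euler (complex_of (f :: l)) = euler (complex_of l) + 1)%R.
Proof.
move=> uabc fE ab bc ac nabc; rewrite complex_of_cons.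
have fsE : fset_of f = fset_of [:: a; b; c] by apply/fsetP => x; rewrite !in_fset_of fE.
rewrite fsE euler_addfull ?card_fset_of //.
- by apply/fset0Pn; exists a; rewrite in_fset_of mem_head.
- apply: contraNN nabc; rewrite in_complex_of => /hasP[g gl /fsubsetP sg].
  apply/hasP; exists g => //; have sub x : x \in [:: a; b; c] -> x \in g.
    by move=> xi; have := sg x; rewrite !inE => ->; rewrite // -?in_fset_of; move: xi; rewrite !inE.
  by rewrite !sub // !inE eqxx ?orbT.
move=> r /fproperP[rs [x xs xr]].
have sub u v : edge_in l u v -> fset_of [:: a; b; c] `\ x `<=` [fset u; v] -> r \in complex_of l.
  move=> uv sxy; apply: (Kl (s := [fset u; v])); first by rewrite in_complex_edge.
  by apply: fsubset_trans sxy; apply: fsubset_rem.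
move: xs; rewrite in_fset_of !inE => /or3P[]/eqP E; subst x.
- by apply: sub bc _; apply/fsubsetP => z; rewrite !inE; case: (z == a); case: (z == b); case: (z == c).
- by apply: sub ac _; apply/fsubsetP => z; rewrite !inE; case: (z == a); case: (z == b); case: (z == c).
- by apply: sub ab _; apply/fsubsetP => z; rewrite !inE; case: (z == a); case: (z == b); case: (z == c).
Qed.

Lemma euler_new_leaf l a c : vertex_in l a -> vertex_in l c = false ->
  euler (complex_of ([:: a; c] :: l)) = euler (complex_of l).
Proof.
move=> al nc; rewrite complex_of_cons; apply: (@euler_addcone _ _ _ a).
- exact: complex_of_simplicial.
- by rewrite in_fset_of mem_head.
move=> r rK rf; apply: (Kl (s := [fset a])); first by rewrite in_complex_vertex.
rewrite fsubUset fsubset_refl; apply/fsubsetP => x xr.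
have := fsubsetP rf x xr; rewrite in_fset_of !inE => /orP[//|/eqP E].
suff : vertex_in l c by rewrite nc.
by rewrite -E -in_complex_vertex; apply: (Kl rK); rewrite fsub1set.
Qed.

Lemma euler_closing_edge l a c : a != c -> vertex_in l a -> vertex_in l c ->
  edge_in l a c = false ->
  (euler (complex_of ([:: a; c] :: l)) = euler (complex_of l) - 1)%R.
Proof.
move=> ac al cl nac; rewrite complex_of_cons.
have fE : fset_of [:: a; c] = [fset a; c] by apply/fsetP => x; rewrite in_fset_of !inE.
rewrite fE euler_addfull ?cardfs2 ?ac //.
- by apply/fset0Pn; exists a; rewrite !inE eqxx.
- by rewrite in_complex_edge nac.
move=> r rs; have [rE|[x rE]] : r = fset0 \/ exists x, r = [fset x].
- by apply: cardfs_le1; have := fproper_ltn_card rs; rewrite cardfs2 ac ltnS.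
- rewrite rE; apply: (Kl (s := [fset a])); rewrite ?in_complex_vertex //; exact: fsub0set.
have := fproper_sub rs; rewrite rE fsub1set !inE in_complex_vertex.
by case/orP => /eqP ->.
Qed.

End EulerLists.

Ltac mem3 := let w := fresh in move=> w; rewrite !inE; repeat match goal with |- context [w == ?x] => case: (w == x) end; done.
Ltac edgeT := rewrite !edge_in_cons !inE !vtxE /= ?eqxx ?orbT //.

Section RegionEuler.
Implicit Types (l : seq (seq vtx)).

Definition vertex_num x : nat :=
  match x with Ring n | Va n | Vb n | Vd n => n.+1 | _ => 0 end.

Definition fresh_from n l := forall x, n < vertex_num x -> vertex_in l x = false.

Lemma eqSn_false n : (n.+1 == n) = false. Proof. by elim: n. Qed.
Lemma eqnS_false n : (n == n.+1) = false. Proof. by elim: n. Qed.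

(** Once the hair is present, each of the twelve triangles in the listed order brings a new vertex
    or exactly one new edge, so none closes a circle. The list is reversed because complexes are
    extended at the head of the list. *)
Lemma euler_block l k n h : h./2 != k -> fresh_from n.+1 l ->
  edge_in l Apex (Ring n) -> edge_in l (Ring n) (Tip k) ->
  edge_in l Apex (Mid h) -> edge_in l (Mid h) (Tip h./2) ->
  edge_in l (Ring n) (Mid h) = false ->
  euler (complex_of (rev (block k n h) ++ l)) = euler (complex_of l).
Proof.
move=> hk fr e1 e2 e3 e4 n1.
have khF : (k == h./2) = false by rewrite eq_sym (negbTE hk).
have {hk} hkF : (h./2 == k) = false by exact: negbTE.
have fa : vertex_in l (Va n.+1) = false by exact: fr.
have fb : vertex_in l (Vb n.+1) = false by exact: fr.
have fd : vertex_in l (Vd n.+1) = false by exact: fr.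
have fz : vertex_in l (Ring n.+1) = false by exact: fr.
have Ea := edge_inF _ fa; have Eb := edge_inF _ fb; have Ed := edge_inF _ fd; have Ez := edge_inF _ fz.
have Ea' := edge_inFr _ fa; have Eb' := edge_inFr _ fb; have Ed' := edge_inFr _ fd; have Ez' := edge_inFr _ fz.
rewrite /block /block_tris /rev /=.
rewrite (@euler_new_edge _ _ _ (Ring n.+1) (Vd n.+1) (Tip k)); [|by mem3|by edgeT|by edgeT|]; last first.
  by edgeT; rewrite ?Ea ?Eb ?Ed ?Ez ?Ea' ?Eb' ?Ed' ?Ez' ?eqSn_false ?eqnS_false ?hkF ?khF.
rewrite (@euler_new_edge _ _ _ (Apex) (Mid h) (Ring n.+1)); [|by mem3|by edgeT|by edgeT|]; last first.
  by edgeT; rewrite ?Ea ?Eb ?Ed ?Ez ?Ea' ?Eb' ?Ed' ?Ez' ?eqSn_false ?eqnS_false ?hkF ?khF.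
rewrite (@euler_new_edge _ _ _ (Vd n.+1) (Vb n.+1) (Ring n.+1)); [|by mem3|by edgeT|by edgeT|]; last first.
  by edgeT; rewrite ?Ea ?Eb ?Ed ?Ez ?Ea' ?Eb' ?Ed' ?Ez' ?eqSn_false ?eqnS_false ?hkF ?khF.
rewrite (@euler_new_vertex _ _ _ (Mid h) (Vb n.+1) (Ring n.+1)); [|by mem3|by edgeT|]; last first.
  by rewrite !vertex_in_cons !inE !vtxE /= fz ?eqSn_false.
rewrite (@euler_new_edge _ _ _ (Mid h) (Tip h./2) (Vb n.+1)); [|by mem3|by edgeT|by edgeT|]; last first.
  by edgeT; rewrite ?Ea ?Eb ?Ed ?Ez ?Ea' ?Eb' ?Ed' ?Ez' ?eqSn_false ?eqnS_false ?hkF ?khF.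
rewrite (@euler_new_vertex _ _ _ (Tip h./2) (Vd n.+1) (Vb n.+1)); [|by mem3|by edgeT|]; last first.
  by rewrite !vertex_in_cons !inE !vtxE /= fb ?eqSn_false.
rewrite (@euler_new_edge _ _ _ (Vd n.+1) (Ring n) (Tip k)); [|by mem3|by edgeT|by edgeT|]; last first.
  by edgeT; rewrite ?Ea ?Eb ?Ed ?Ez ?Ea' ?Eb' ?Ed' ?Ez' ?eqSn_false ?eqnS_false ?hkF ?khF.
rewrite (@euler_new_edge _ _ _ (Ring n) (Va n.+1) (Vd n.+1)); [|by mem3|by edgeT|by edgeT|]; last first.
  by edgeT; rewrite ?Ea ?Eb ?Ed ?Ez ?Ea' ?Eb' ?Ed' ?Ez' ?eqSn_false ?eqnS_false ?hkF ?khF.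
rewrite (@euler_new_vertex _ _ _ (Tip h./2) (Va n.+1) (Vd n.+1)); [|by mem3|by edgeT|]; last first.
  by rewrite !vertex_in_cons !inE !vtxE /= fd ?eqSn_false.
rewrite (@euler_new_edge _ _ _ (Tip h./2) (Mid h) (Va n.+1)); [|by mem3|by edgeT|by edgeT|]; last first.
  by edgeT; rewrite ?Ea ?Eb ?Ed ?Ez ?Ea' ?Eb' ?Ed' ?Ez' ?eqSn_false ?eqnS_false ?hkF ?khF.
rewrite (@euler_new_vertex _ _ _ (Ring n) (Mid h) (Va n.+1)); [|by mem3|by edgeT|]; last first.
  by rewrite !vertex_in_cons !inE !vtxE /= fa ?eqSn_false.
rewrite (@euler_new_edge _ _ _ (Ring n) Apex (Mid h)) //; by mem3.
Qed.

End RegionEuler.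

Ltac numT := by move/eqP => ->; rewrite /= ?ltnS ?leqnn ?leqnSn.

Section RegionsEuler.
Implicit Types (l : seq (seq vtx)).

Lemma vertex_in_rev l x : vertex_in (rev l) x = vertex_in l x.
Proof. by rewrite /vertex_in has_rev. Qed.

Lemma edge_in_rev l x y : edge_in (rev l) x y = edge_in l x y.
Proof. by rewrite /edge_in has_rev. Qed.

Lemma block_num k n h x : vertex_in (block k n h) x -> vertex_num x <= n.+2.
Proof.
rewrite /vertex_in /block /block_tris /= !inE orbF -!orbA.
do ?[case/orP; first numT]; numT.
Qed.

(** Only the last triangle of the footer closes a circle. The hypotheses on hairs include [k.*2.+1]
    because the footer runs into this boundary hair as a block runs into the hair it covers. *)
Lemma euler_blocks k hs l n : (forall h, h \in hs -> h./2 != k) -> uniq hs ->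
  fresh_from n.+1 l -> edge_in l Apex (Ring n) -> edge_in l (Ring n) (Tip k) ->
  (forall h, h \in k.*2.+1 :: hs -> [/\ edge_in l Apex (Mid h), edge_in l (Mid h) (Tip h./2) &
     edge_in l (Ring n) (Mid h) = false]) ->
  (euler (complex_of (blocks k n hs ++ l)) = euler (complex_of l) + 1)%R.
Proof.
elim: hs l n => [|h hs IH] l n hk uhs fr e1 e2 hE.
  have [e3 + n1] := hE k.*2.+1 (mem_head _ _).
  rewrite /= uphalf_double => e4.
  transitivity (euler (complex_of (rev (footer k n) ++ l))).
    congr euler; apply: (@eq_complex_of _ (footer k n ++ l)) => f.
    by rewrite [LHS]mem_cat [RHS]mem_cat mem_rev.
  rewrite /rev /footer /=.
  rewrite (@euler_closing _ _ _ (Ring n) (Mid k.*2.+1) (Tip k)) //.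
  - congr (_ + _)%R; apply: (@euler_new_edge _ _ _ (Ring n) Apex (Mid k.*2.+1)) => //.
    by mem3.
  - by rewrite /= !inE !vtxE.
  - by edgeT.
  - by edgeT.
  - by edgeT.
  rewrite /= !inE !vtxE /= ?andbF /= ?orbF. apply/negP => /hasP[g gl /and3P[g1 g2 _]].
  suff: edge_in l (Ring n) (Mid k.*2.+1) by rewrite n1.
  by apply/hasP; exists g; rewrite ?g1.
have hh : h \in h :: hs by rewrite mem_head.
have [e3 e4 n1] := hE h (mem_behead (s := [:: _, h & hs]) (hh)).
have eE : euler (complex_of (rev (block k n h) ++ l)) = euler (complex_of l).
  by apply: euler_block => //; apply: hk.
have /= /andP[hhs uhs'] := uhs.
transitivity (euler (complex_of (blocks k n.+1 hs ++ (rev (block k n h) ++ l)))).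
  congr euler; apply: (@eq_complex_of _ (blocks k n (h :: hs) ++ l)) => f.
  by rewrite blocks_cons !mem_cat mem_rev orbCA orbA.
rewrite IH ?eE //.
- by move=> h' h'i; apply: hk; rewrite inE h'i orbT.
- move=> x nx; rewrite vertex_in_cat vertex_in_rev [X in _ || X]fr ?orbF; last exact: ltnW.
  by apply: contraTF nx => /block_num; rewrite -leqNgt.
- by rewrite edge_in_cat edge_in_rev /block /block_tris; edgeT.
- by rewrite edge_in_cat edge_in_rev /block /block_tris; edgeT.
move=> h' h'i; have h'i' : h' \in [:: k.*2.+1, h & hs].
  by move: h'i; rewrite !inE => /orP[->|->] //; rewrite !orbT.
have [e5 e6 n2] := hE h' h'i'.
rewrite !edge_in_cat e5 e6 !orbT; split=> //.
have hh' : (h' == h) = false.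
  move: h'i; rewrite inE => /orP[/eqP ->|h'i]; last by apply: contraNF hhs => /eqP <-.
  have := hk h hh; apply: contraNF => /eqP <- /=; by rewrite uphalf_double.
rewrite edge_in_rev /block /block_tris [X in _ || X]edge_inF; last exact: fr.
by rewrite orbF; edgeT; rewrite ?eqSn_false ?hh'.
Qed.

Definition hairs_in l (k : nat) := forall h, h./2 = k ->
  edge_in l Apex (Mid h) /\ edge_in l (Mid h) (Tip k).

Lemma blocks_num k n hs x : vertex_in (blocks k n hs) x -> vertex_num x <= (n + size hs).+1.
Proof.
case/hasP => f /blocksP[[i lt_i fb]|ff] xf.
  apply: leq_trans (_ : (n + i).+2 <= _); last by rewrite ltnS -addnS leq_add2l.
  by apply: (@block_num k _ (nth 0 hs i)); apply/hasP; exists f.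
have : vertex_in (footer k (n + size hs)) x by apply/hasP; exists f.
rewrite /vertex_in /footer /= !inE orbF -!orbA.
do ?[case/orP; first numT]; numT.
Qed.

Lemma region_num n r x : vertex_in (region_tris n r) x -> vertex_num x <= (n + size r.2).+1.
Proof.
rewrite vertex_in_cat => /orP[|]; last exact: blocks_num.
rewrite /vertex_in /header /= !inE orbF -!orbA => H; apply: (@leq_trans n.+1); last first.
  by rewrite ltnS leq_addr.
by move: H; do ?[case/orP; first numT]; numT.
Qed.

Lemma euler_region n r l : (forall h, h \in r.2 -> h./2 != r.1) -> uniq r.2 ->
  fresh_from n l -> hairs_in l r.1 -> (forall h, h \in r.2 -> hairs_in l h./2) ->
  (euler (complex_of (region_tris n r ++ l)) = euler (complex_of l) + 1)%R.
Proof.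
case: r => k hs /= hk uhs fr hl hhs; rewrite /region_tris /=.
have [e1 e2] := hl k.*2 (doubleK k).
have fz : vertex_in l (Ring n) = false by exact: fr.
have Ez := edge_inF _ fz; have Ez' := edge_inFr _ fz.
transitivity (euler (complex_of (blocks k n hs ++ (rev (header k n) ++ l)))).
  congr euler; apply: (@eq_complex_of _ ((header k n ++ blocks k n hs) ++ l)) => f.
  by rewrite !mem_cat mem_rev orbCA orbA.
rewrite euler_blocks //.
- congr (_ + _)%R; rewrite /rev /header /=.
  rewrite (@euler_new_edge _ _ _ (Ring n) (Mid k.*2) (Tip k)); [|by mem3|by edgeT|by edgeT|]; last first.
    by edgeT; rewrite Ez.
  by apply: (@euler_new_vertex _ _ _ Apex (Mid k.*2) (Ring n)).
- move=> x nx; rewrite vertex_in_cat vertex_in_rev [X in _ || X]fr ?orbF; last exact: ltnW.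
  apply: contraTF nx; rewrite -leqNgt /vertex_in /header /= !inE orbF -!orbA.
  do ?[case/orP; first numT]; numT.
- by rewrite edge_in_cat edge_in_rev /header; edgeT.
- by rewrite edge_in_cat edge_in_rev /header; edgeT.
move=> h; rewrite inE => hi.
have [e3 e4] : edge_in l Apex (Mid h) /\ edge_in l (Mid h) (Tip h./2).
  case/orP: hi => [/eqP ->|/hhs]; last exact.
  by have := hl k.*2.+1; rewrite /= uphalf_double; apply.
rewrite !edge_in_cat e3 e4 !orbT Ez orbF; split=> //.
have hkF : (h == k.*2) = false.
  case/orP: hi => [/eqP ->|/hk]; first exact: eqSn_false.
  by apply: contraNF => /eqP ->; rewrite doubleK.
by rewrite edge_in_rev /header; edgeT; rewrite hkF.
Qed.

Lemma euler_tris rs n l :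
  (forall r h, r \in rs -> h \in r.2 -> h./2 != r.1) -> (forall r, r \in rs -> uniq r.2) ->
  fresh_from n l ->
  (forall r, r \in rs -> hairs_in l r.1 /\ forall h, h \in r.2 -> hairs_in l h./2) ->
  (euler (complex_of (tris n rs ++ l)) = euler (complex_of l) + (size rs)%:Z)%R.
Proof.
elim: rs n l => [|r rs IH] n l hk uhs fr hl; first by rewrite addr0.
transitivity (euler (complex_of (tris (n + size r.2).+1 rs ++ (region_tris n r ++ l)))).
  congr euler; apply: (@eq_complex_of _ ((region_tris n r ++ tris (n + size r.2).+1 rs) ++ l)) => f.
  by rewrite !mem_cat orbCA orbA.
have rr : r \in r :: rs by rewrite mem_head.
have rin r' : r' \in rs -> r' \in r :: rs by move=> ri; rewrite inE ri orbT.
have [hl1 hl2] := hl r rr.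
rewrite IH.
- rewrite euler_region //; [|by move=> h; apply: hk|exact: uhs].
  by rewrite -addrA; congr (_ + _)%R; rewrite -PoszD.
- by move=> r' h /rin; apply: hk.
- by move=> r' /rin; apply: uhs.
- move=> x nx; rewrite vertex_in_cat [X in _ || X]fr ?orbF; last first.
    apply: leq_ltn_trans nx; apply: leq_trans (leqnSn _); exact: leq_addr.
  by apply: contraTF nx => /region_num; rewrite -leqNgt.
have sub k : hairs_in l k -> hairs_in (region_tris n r ++ l) k.
  by move=> hk' h /hk'[e1 e2]; rewrite !edge_in_cat e1 e2 !orbT.
by move=> r' /rin/hl[/sub ? H]; split=> // h /H/sub.
Qed.

(** One circle through the apex for each tip. Placed below the regions, it lets every region be
    glued along hairs that are already present. *)
Definition hair_graph (ks : seq nat) : seq (seq vtx) :=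
  flatten [seq [:: [:: Mid k.*2.+1; Tip k]; [:: Apex; Mid k.*2.+1];
                   [:: Mid k.*2; Tip k]; [:: Apex; Mid k.*2]] | k <- ks] ++ [:: [:: Apex]].

Lemma hair_graph_num ks x : vertex_in (hair_graph ks) x -> vertex_num x = 0.
Proof.
rewrite vertex_in_cat => /orP[/hasP[f /flatten_mapP[k _ fk] xf]|]; last first.
  by rewrite /vertex_in /= !inE orbF => /eqP ->.
have : vertex_in [:: [:: Mid k.*2.+1; Tip k]; [:: Apex; Mid k.*2.+1];
    [:: Mid k.*2; Tip k]; [:: Apex; Mid k.*2]] x by apply/hasP; exists f.
rewrite /vertex_in /= !inE orbF -!orbA.
do ?[case/orP; first numT]; numT.
Qed.

Lemma hairs_in_graph ks k : k \in ks -> hairs_in (hair_graph ks) k.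
Proof.
move=> kks h hk; have sub f : f \in [:: [:: Mid k.*2.+1; Tip k]; [:: Apex; Mid k.*2.+1];
    [:: Mid k.*2; Tip k]; [:: Apex; Mid k.*2]] -> f \in hair_graph ks.
  by move=> fk; rewrite mem_cat; apply/orP; left; apply/flatten_mapP; exists k.
have [->|->] : h = k.*2 \/ h = k.*2.+1.
  by rewrite -(odd_double_half h) hk; case: (odd h); [right|left].
  split; apply/hasP.
    by exists [:: Apex; Mid k.*2]; rewrite ?sub // !inE ?eqxx ?orbT.
  by exists [:: Mid k.*2; Tip k]; rewrite ?sub // !inE ?eqxx ?orbT.
split; apply/hasP.
  by exists [:: Apex; Mid k.*2.+1]; rewrite ?sub // !inE ?eqxx ?orbT.
by exists [:: Mid k.*2.+1; Tip k]; rewrite ?sub // !inE ?eqxx ?orbT.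
Qed.

Lemma euler_hair_graph ks : uniq ks ->
  (euler (complex_of (hair_graph ks)) = - (size ks)%:Z)%R.
Proof.
elim: ks => [_|k ks IH /= /andP[kks uks]].
  rewrite /hair_graph /= (@euler_toggle _ _ Apex) // => s.
  rewrite !in_complex_of /= !orbF => sA.
  rewrite fsubUset fsub1set !inE eqxx sA /=; exact: fsubset_trans (fsubD1set _ _) sA.
have nM h : h./2 = k -> vertex_in (hair_graph ks) (Mid h) = false.
  move=> hk; apply: contraNF kks; rewrite vertex_in_cat => /orP[/hasP[f /flatten_mapP[k' k'k fk] xf]|]; last first.
    by rewrite /vertex_in /= !inE !vtxE.
  have : vertex_in [:: [:: Mid k'.*2.+1; Tip k']; [:: Apex; Mid k'.*2.+1];
    [:: Mid k'.*2; Tip k']; [:: Apex; Mid k'.*2]] (Mid h) by apply/hasP; exists f.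
  rewrite /vertex_in /= !inE !vtxE /= ?orbF => H.
  have -> // : k = k'; rewrite -hk.
  have [->|->] : h = k'.*2.+1 \/ h = k'.*2 by lia.
    by rewrite /= uphalf_double.
  by rewrite doubleK.
have nT : vertex_in (hair_graph ks) (Tip k) = false.
  apply: contraNF kks; rewrite vertex_in_cat => /orP[/hasP[f /flatten_mapP[k' k'k fk] xf]|]; last first.
    by rewrite /vertex_in /= !inE !vtxE.
  have : vertex_in [:: [:: Mid k'.*2.+1; Tip k']; [:: Apex; Mid k'.*2.+1];
    [:: Mid k'.*2; Tip k']; [:: Apex; Mid k'.*2]] (Tip k) by apply/hasP; exists f.
  rewrite /vertex_in /= !inE !vtxE /= ?orbF orbb => /eqP E; by rewrite E.
have vA : vertex_in (hair_graph ks) Apex by rewrite vertex_in_cat [X in _ || X]/vertex_in /= ?inE ?eqxx ?orbT.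
have n1 := nM _ (doubleK k); have n2 : vertex_in (hair_graph ks) (Mid k.*2.+1) = false.
  by apply: nM; rewrite /= uphalf_double.
rewrite [hair_graph _]/= -/(hair_graph ks).
rewrite euler_closing_edge; last first.
- by rewrite !edge_in_cons edge_inF // !inE !vtxE /= ?eqSn_false ?andbF.
- by rewrite ?vertex_in_cons ?inE ?vtxE /= ?eqxx ?orbT ?eqSn_false ?n1 ?n2 ?nT ?vA ?orbT.
- by rewrite ?vertex_in_cons ?inE ?vtxE /= ?eqxx ?orbT ?eqSn_false ?n1 ?n2 ?nT ?vA ?orbT.
- by rewrite vtxE.
rewrite euler_new_leaf; [|by rewrite ?vertex_in_cons ?inE ?vtxE /= ?eqxx ?orbT ?eqSn_false ?n1 ?n2 ?nT ?vA ?orbT|by rewrite ?vertex_in_cons ?inE ?vtxE /= ?eqxx ?orbT ?eqSn_false ?n1 ?n2 ?nT ?vA ?orbT].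
rewrite euler_new_leaf; [|by rewrite ?vertex_in_cons ?inE ?vtxE /= ?eqxx ?orbT ?eqSn_false ?n1 ?n2 ?nT ?vA ?orbT|by rewrite ?vertex_in_cons ?inE ?vtxE /= ?eqxx ?orbT ?eqSn_false ?n1 ?n2 ?nT ?vA ?orbT].
rewrite euler_new_leaf // IH //=; lia.
Qed.

Lemma complex_of_cat_sub (V : choiceType) (l l' : seq (seq V)) :
  (forall f, f \in l' -> exists2 g, g \in l & {subset f <= g}) ->
  complex_of (l ++ l') = complex_of l.
Proof.
move=> H; apply/fsetP => s; rewrite !in_complex_of has_cat orb_idr //.
move=> /hasP[f /H[g gl fg] sf]; apply/hasP; exists g => //.
apply: fsubset_trans sf _; apply/fsubsetP => x; rewrite !inE; exact: fg.
Qed.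

(** The hairs are edge paths of the regions, so adding [hair_graph] does not change the complex; it
    contributes -1 for each tip, and each region then fills one circle. *)
Lemma euler_region_complex (rs : seq region) : 0 < size rs ->
  (forall r h, r \in rs -> h \in r.2 -> h./2 != r.1) -> (forall r, r \in rs -> uniq r.2) ->
  (forall r h, r \in rs -> h \in r.2 -> h./2 \in map fst rs) ->
  (euler (complex_of (tris 0 rs)) = (size rs)%:Z - (size (undup (map fst rs)))%:Z)%R.
Proof.
move=> rs0 hk uhs hin; set ks := undup (map fst rs).
have ksE k : (k \in ks) = (k \in map fst rs) by rewrite mem_undup.
rewrite -(@complex_of_cat_sub _ _ (hair_graph ks)).
  rewrite euler_tris // ?euler_hair_graph ?undup_uniq //; first by rewrite addrC.
    by move=> x nx; apply/negP => /hair_graph_num E; rewrite E in nx.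
  move=> r rr; split=> [|h hr]; apply: hairs_in_graph; rewrite ksE; first exact: map_f.
  exact: hin hr.
move=> f; rewrite mem_cat => /orP[/flatten_mapP[k]|].
  rewrite ksE => /mapP[r rr ->] fk; have [q qr] := region_placed 0 rr.
  have in1 g : g \in header r.1 q \/ g \in footer r.1 (q + size r.2) -> g \in tris 0 rs.
    move=> H; apply/tris_placed; exists (q, r) => //; rewrite mem_cat; case: H => [-> //|H].
    by rewrite blocks_footer ?orbT.
  move: fk; rewrite !inE => /or4P[]/eqP ->.
  - exists [:: Ring (q + size r.2); Mid r.1.*2.+1; Tip r.1]; first by apply: in1; right; rewrite !inE eqxx orbT.
    by move=> x; rewrite !inE => ->; rewrite orbT.
  - exists [:: Apex; Ring (q + size r.2); Mid r.1.*2.+1]; first by apply: in1; right; rewrite !inE eqxx.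
    by move=> x; rewrite !inE => /orP[]->; rewrite ?orbT.
  - exists [:: Mid r.1.*2; Ring q; Tip r.1]; first by apply: in1; left; rewrite !inE eqxx orbT.
    by move=> x; rewrite !inE => /orP[]->; rewrite ?orbT.
  exists [:: Apex; Mid r.1.*2; Ring q]; first by apply: in1; left; rewrite !inE eqxx.
  by move=> x; rewrite !inE => /orP[]->; rewrite ?orbT.
rewrite inE => /eqP ->; case: rs rs0 {hk uhs hin ks ksE} => // r rs _.
exists [:: Apex; Mid r.1.*2; Ring 0]; first by rewrite /= !inE eqxx.
by move=> x; rewrite !inE => ->.
Qed.

Lemma euler_coded l : euler (complex_of (coded l)) = euler (complex_of l).
Proof.
pose im (s : {fset vtx}) := code @` s.
have imI : injective im.
  move=> s t E; apply/fsetP => x; have := congr1 (fun u : {fset nat} => code x \in u) E.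
  by rewrite /im !(mem_imfset _ _ code_inj).
have -> : complex_of (coded l) = im @` complex_of l.
  apply/fsetP => s; rewrite in_complex_of; apply/hasP/imfsetP => [[f /mapP[g gl ->] sg]|[t /= + ->]].
    exists [fset decode x | x in s].
      rewrite /= in_complex_of; apply/hasP; exists g => //; apply/fsubsetP => x /imfsetP[y /= ys ->].
      have := fsubsetP sg y ys; rewrite !inE => /mapP[z zg ->]; by rewrite codeK.
    apply/fsetP => x; apply/idP/imfsetP => [xs|[y /= /imfsetP[z /= zs ->] ->]].
      have := fsubsetP sg x xs; rewrite !inE => /mapP[z zg E].
      by exists z => //=; apply/imfsetP; exists x => //; rewrite E codeK.
    have := fsubsetP sg z zs; rewrite !inE => /mapP[u ug E].
    by rewrite E codeK -E.
  rewrite in_complex_of => /hasP[g gl tg]; exists (map code g); first exact: map_f.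
  apply/fsubsetP => x /imfsetP[y /= yt ->]; have := fsubsetP tg y yt; rewrite !inE => yg.
  exact: map_f.
rewrite /euler big_imfset /=; last by move=> s t _ _; apply: imI.
by apply: eq_bigr => s _; rewrite card_imfset //; apply: code_inj.
Qed.

End RegionsEuler.

(** * Subcomplexes without free edges *)

Section Core.
Implicit Types (U : seq (seq vtx)) (f g : seq vtx) (y z w x : vtx).

(** The nine vertices of a block in the order of the arguments of [block_tris]. A block is thereby
    the image of one fixed complex on the numbers below 9, whose incidences are decided by
    computation. *)
Definition name k n h : nat -> vtx :=
  nth Apex [:: Apex; Ring n; Mid h; Tip h./2; Tip k; Va n.+1; Vb n.+1; Vd n.+1; Ring n.+1].

Lemma name_inj k n h i j : h./2 != k -> i < 9 -> j < 9 -> (name k n h i == name k n h j) = (i == j).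
Proof.
move=> hk i9 j9; rewrite /name nth_uniq //= !inE !vtxE /= (negbTE hk).
by rewrite eqn_leq ltnn andbF.
Qed.

Lemma block_name k n h :
  block k n h = map (map (name k n h)) (block_tris 0 1 2 3 4 5 6 7 8).
Proof. by []. Qed.

(** The vertex [w] outside [f] witnesses that the triangles differ as sets, which an inequality of
    lists would not. *)
Definition shared U f y z := exists2 g, g \in U &
  [/\ y \in g, z \in g & exists2 w, w \in g & w \notin f].

Lemma sharedC U f y z : shared U f y z -> shared U f z y.
Proof. by move=> [g gU [yg zg w]]; exists g. Qed.

Lemma shared_sub U U' f y z : {subset U <= U'} -> shared U f y z -> shared U' f y z.
Proof. by move=> sU [g /sU gU H]; exists g. Qed.

(* The boundary of the block as a disc slit along its hair: the only edges of a
   block lying in a single triangle of it. *)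
Definition side k n y z :=
  [\/ y = Apex /\ z = Ring n, y = Ring n /\ z = Tip k |
      (y = Apex /\ z = Ring n.+1) \/ (y = Ring n.+1 /\ z = Tip k)].

Lemma block_shared k n h f y z : h./2 != k -> f \in block k n h -> y \in f -> z \in f -> y != z ->
  [\/ shared (block k n h) f y z, side k n y z | side k n z y].
Proof.
move=> hk; rewrite block_name; set T0 := block_tris _ _ _ _ _ _ _ _ _.
case/mapP => f0 f0T -> /mapP[y0 y0f ->] /mapP[z0 z0f ->] yz.
have lt9 (g : seq nat) (x : nat) : g \in T0 -> x \in g -> x < 9.
  have : all (all (fun i => i < 9)) T0 by [].
  by move/allP => H /H/allP; apply.
(* The four listed pairs are the edges of [side], numbered as in [name]. *)
have /allP/(_ _ f0T)/allP/(_ _ y0f)/allP/(_ _ z0f) : all (fun p => all (fun a => all (fun b => (a == b) ||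
    has (fun q => [&& a \in q, b \in q & has (fun c => c \notin p) q]) T0 ||
    ((a, b) \in [:: (0, 1); (1, 4); (0, 8); (8, 4)]) ||
    ((b, a) \in [:: (0, 1); (1, 4); (0, 8); (8, 4)])) p) p) T0 by vm_compute.
have yz0 : (y0 == z0) = false by apply: contraNF yz => /eqP ->.
rewrite yz0 orFb -orbA => /or3P[/hasP[g gT /and3P[yg zg /hasP[w wg wf]]]|H|H].
- constructor 1; exists (map (name k n h) g); first exact: map_f.
  split; [exact: map_f|exact: map_f|]; exists (name k n h w); first exact: map_f.
  apply: contra wf => /mapP[v vf /eqP]; rewrite (name_inj _ hk (lt9 _ _ gT wg) (lt9 _ _ f0T vf)).
  by move=> /eqP ->.
- constructor 2; move: H; rewrite !inE !xpair_eqE.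
  case/or4P => /andP[/eqP -> /eqP ->]; rewrite /name /= /side.
  + by constructor 1.
  + by constructor 2.
  + by constructor 3; left.
  + by constructor 3; right.
constructor 3; move: H; rewrite !inE !xpair_eqE.
case/or4P => /andP[/eqP -> /eqP ->]; rewrite /name /= /side.
+ by constructor 1.
+ by constructor 2.
+ by constructor 3; left.
+ by constructor 3; right.
Qed.

Definition no_free_edge U f := forall y z, y \in f -> z \in f -> y != z -> shared U f y z.

(** The excluded list consists of the vertices of the two header or footer triangles at [Ring q], so
    [g] is a further triangle on the edge of the hair. *)
Definition boundary_shared U k q h := forall e, e \in [:: Apex; Tip k] ->
  exists2 g, g \in U & [/\ e \in g, Mid h \in g &
    exists2 w, w \in g & w \notin [:: Apex; Ring q; Mid h; Tip k]].

Lemma tip_end k : Tip k \in [:: Apex; Tip k]. Proof. by rewrite !inE eqxx orbT. Qed.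

Lemma pair_cases (P : vtx -> vtx -> Prop) a b c : (forall y z, P y z -> P z y) ->
  P a b -> P b c -> P a c -> forall y z, y \in [:: a; b; c] -> z \in [:: a; b; c] -> y != z -> P y z.
Proof.
move=> sP ab bc ac y z; rewrite !inE => /or3P[]/eqP -> /or3P[]/eqP ->; rewrite ?eqxx // => _;
  by [|apply: sP].
Qed.

(** Consecutive blocks share the two edges at a ring vertex. The hypothesis on [Ring n] describes
    the triangle before it, in the previous block or in the header, by a vertex that cannot occur in
    the blocks to come. *)
Lemma blocks_no_free_edge U k hs n : (forall h, h \in hs -> h./2 != k) -> uniq hs ->
  {subset blocks k n hs <= U} ->
  (forall e, e \in [:: Apex; Tip k] -> exists2 g, g \in U & [/\ e \in g, Ring n \in g &
     exists2 w, w \in g & w = Vd n \/ exists2 h, h \notin k.*2.+1 :: hs & w = Mid h]) ->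
  boundary_shared U k (n + size hs) k.*2.+1 ->
  forall f, f \in blocks k n hs -> no_free_edge U f.
Proof.
elim: hs n => [|h hs IH] n hk uhs sU prev bd f.
  rewrite addn0 in bd.
  have [gA gAU [A1 A2 [wA wAg wA']]] := prev Apex (mem_head _ _).
  have [gT gTU [T1 T2 [wT wTg wT']]] := prev (Tip k) (tip_end k).
  have nw w (x : vtx) : w = Vd n \/ (exists2 h, h \notin [:: k.*2.+1] & w = Mid h) ->
      w \notin [:: Apex; Ring n; Mid k.*2.+1; Tip k].
    case=> [->|[h hi ->]]; rewrite !inE !vtxE //=; move: hi; by rewrite inE orbF.
  have [bA bAU [B1 B2 [v vb vn]]] := bd Apex (mem_head _ _).
  have [bT bTU [C1 C2 [v' vb' vn']]] := bd (Tip k) (tip_end k).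
  have sub1 w : w \notin [:: Apex; Ring n; Mid k.*2.+1; Tip k] -> w \notin [:: Apex; Ring n; Mid k.*2.+1].
    by apply: contra; rewrite !inE => /or3P[]->; rewrite ?orbT.
  have sub2 w : w \notin [:: Apex; Ring n; Mid k.*2.+1; Tip k] -> w \notin [:: Ring n; Mid k.*2.+1; Tip k].
    by apply: contra; rewrite !inE => /or3P[]->; rewrite ?orbT.
  have f1U : [:: Apex; Ring n; Mid k.*2.+1] \in U by apply: sU; rewrite !inE eqxx.
  have f2U : [:: Ring n; Mid k.*2.+1; Tip k] \in U by apply: sU; rewrite !inE eqxx orbT.
  rewrite !inE => /orP[]/eqP ->; apply: pair_cases; try exact: sharedC.
  - by exists gA => //; split=> //; exists wA => //; apply/sub1/nw.
  - exists [:: Ring n; Mid k.*2.+1; Tip k] => //; split; rewrite ?inE ?eqxx ?orbT //.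
    by exists (Tip k); rewrite ?inE ?eqxx ?orbT // !vtxE.
  - by exists bA => //; split=> //; exists v => //; apply: sub1.
  - exists [:: Apex; Ring n; Mid k.*2.+1] => //; split; rewrite ?inE ?eqxx ?orbT //.
    by exists Apex; rewrite ?inE ?eqxx ?orbT // !vtxE.
  - by exists bT => //; split=> //; exists v' => //; apply: sub2.
  by exists gT => //; split=> //; exists wT => //; apply/sub2/nw.
have hh : h \in h :: hs by rewrite mem_head.
have /andP[hhs uhs'] : (h \notin hs) && uniq hs by exact: uhs.
have h2k : h != k.*2.+1.
  by apply: contraNneq (hk h hh) => -> /=; rewrite uphalf_double.
have bU : {subset block k n h <= U} by move=> g gb; apply: sU; rewrite blocks_cons mem_cat gb.
have bsU : {subset blocks k n.+1 hs <= U}.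
  by move=> g gb; apply: sU; rewrite blocks_cons mem_cat gb orbT.
have inB i : i < 12 -> nth [::] (block k n h) i \in U by move=> i12; apply/bU/mem_nth.
rewrite blocks_cons mem_cat => /orP[fb|]; last first.
  apply: IH => //; first by move=> h' h'i; apply: hk; rewrite inE h'i orbT.
    move=> e; rewrite !inE => /orP[]/eqP ->.
      exists (nth [::] (block k n h) 10); first exact: inB.
      split; rewrite ?inE ?eqxx ?orbT //; exists (Mid h); rewrite ?inE ?eqxx ?orbT //.
      by right; exists h; rewrite // inE negb_or h2k.
    exists (nth [::] (block k n h) 11); first exact: inB.
    split; rewrite ?inE ?eqxx ?orbT //; exists (Vd n.+1); rewrite ?inE ?eqxx ?orbT //.
    by left.
  by move: bd; rewrite /= -addSnnS.
have vertB x : x \in f -> exists2 i, i < 9 & x = name k n h i.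
  move: fb; rewrite block_name => /mapP[f0 f0T ->] /mapP[i if0 ->]; exists i => //.
  have : all (all (fun i => i < 9)) (block_tris 0 1 2 3 4 5 6 7 8) by [].
  by move/allP/(_ _ f0T)/allP; apply.
have nb w : w = Vd n \/ (exists2 h', h' \notin [:: k.*2.+1, h & hs] & w = Mid h') -> w \notin f.
  move=> H; apply/negP => /vertB[i i9 E]; case: H => [|[h' h'i]]; rewrite {}E.
    by move: i i9 => [|[|[|[|[|[|[|[|[|]]]]]]]]] // _ []; lia.
  move: i i9 => [|[|[|[|[|[|[|[|[|]]]]]]]]] //= _ [E].
  by move: h'i; rewrite !inE -E eqxx orbT.
have nb2 w : w = Vd n.+2 \/ (exists2 h', h' != h & w = Mid h') -> w \notin f.
  move=> H; apply/negP => /vertB[i i9 E]; case: H => [|[h' h'i]]; rewrite {}E.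
    by move: i i9 => [|[|[|[|[|[|[|[|[|]]]]]]]]] // _ []; lia.
  by move: i i9 => [|[|[|[|[|[|[|[|[|]]]]]]]]] //= _ [E]; rewrite -E eqxx in h'i.
(* Dually, the following block or the footer provides the second triangle at [Ring n.+1]. *)
have next e : e \in [:: Apex; Tip k] -> exists2 g, g \in U & [/\ e \in g, Ring n.+1 \in g &
     exists2 w, w \in g & w \notin f].
  case: {IH bd prev uhs sU hh} hs bsU hk hhs uhs' nb => [|h' hs] bsU hk hhs uhs' nb;
    rewrite !inE => /orP[]/eqP ->.
  - exists [:: Apex; Ring n.+1; Mid k.*2.+1]; first by apply: bsU; rewrite !inE eqxx.
    split; rewrite ?inE ?eqxx ?orbT //; exists (Mid k.*2.+1); rewrite ?inE ?eqxx ?orbT //.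
    by apply: nb2; right; exists k.*2.+1; rewrite // eq_sym.
  - exists [:: Ring n.+1; Mid k.*2.+1; Tip k]; first by apply: bsU; rewrite !inE eqxx orbT.
    split; rewrite ?inE ?eqxx ?orbT //; exists (Mid k.*2.+1); rewrite ?inE ?eqxx ?orbT //.
    by apply: nb2; right; exists k.*2.+1; rewrite // eq_sym.
  - exists (nth [::] (block k n.+1 h') 0).
      by apply: bsU; rewrite blocks_cons mem_cat mem_nth.
    split; rewrite ?inE ?eqxx ?orbT //; exists (Mid h'); rewrite ?inE ?eqxx ?orbT //.
    apply: nb2; right; exists h' => //; apply: contraNneq hhs => <-; exact: mem_head.
  exists (nth [::] (block k n.+1 h') 5).
    by apply: bsU; rewrite blocks_cons mem_cat mem_nth.
  split; rewrite ?inE ?eqxx ?orbT //; exists (Vd n.+2); rewrite ?inE ?eqxx ?orbT //.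
  by apply: nb2; left.
have sideS y z : side k n y z -> shared U f y z.
  case=> [[-> ->]|[-> ->]|[[-> ->]|[-> ->]]].
  - have [g gU [g1 g2 [w wg wf]]] := prev Apex (mem_head _ _).
    by exists g => //; split=> //; exists w => //; apply: nb.
  - have [g gU [g1 g2 [w wg wf]]] := prev (Tip k) (tip_end k).
    by exists g => //; split=> //; exists w => //; apply: nb.
  - by have [g gU [g1 g2 w]] := next Apex (mem_head _ _); exists g.
  by have [g gU [g1 g2 w]] := next (Tip k) (tip_end k); exists g.
move=> y z yf zf yz; case: (block_shared (hk h hh) fb yf zf yz) => [| |/sideS/sharedC//].
  exact: shared_sub.
exact: sideS.
Qed.

Lemma region_no_free_edge U n r : (forall h, h \in r.2 -> h./2 != r.1) -> uniq r.2 ->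
  {subset region_tris n r <= U} ->
  boundary_shared U r.1 n r.1.*2 -> boundary_shared U r.1 (n + size r.2) r.1.*2.+1 ->
  forall f, f \in region_tris n r -> no_free_edge U f.
Proof.
case: r => k hs /= hk uhs sU bd1 bd2 f.
have bsU : {subset blocks k n hs <= U} by move=> g gb; apply: sU; rewrite mem_cat gb orbT.
have f1U : [:: Apex; Mid k.*2; Ring n] \in U by apply: sU; rewrite !inE eqxx.
have f2U : [:: Mid k.*2; Ring n; Tip k] \in U by apply: sU; rewrite !inE eqxx orbT.
have k2 : k.*2 \notin k.*2.+1 :: hs.
  rewrite inE negb_or eqn_leq ltnn andbF /=; apply/negP => /hk.
  by rewrite doubleK eqxx.
rewrite mem_cat => /orP[fh|]; last first.
  apply: blocks_no_free_edge => // e; rewrite !inE => /orP[]/eqP ->.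
    exists [:: Apex; Mid k.*2; Ring n] => //; split; rewrite ?inE ?eqxx ?orbT //.
    by exists (Mid k.*2); rewrite ?inE ?eqxx ?orbT //; right; exists k.*2.
  exists [:: Mid k.*2; Ring n; Tip k] => //; split; rewrite ?inE ?eqxx ?orbT //.
  by exists (Mid k.*2); rewrite ?inE ?eqxx ?orbT //; right; exists k.*2.
have next e : e \in [:: Apex; Tip k] -> exists2 g, g \in U & [/\ e \in g, Ring n \in g &
     exists2 w, w \in g & w \notin [:: Apex; Mid k.*2; Ring n; Tip k]].
  case: hs bsU hk k2 {uhs sU bd2 fh} => [|h' hs] bsU hk k2; rewrite !inE => /orP[]/eqP ->.
  - exists [:: Apex; Ring n; Mid k.*2.+1]; first by apply: bsU; rewrite !inE eqxx.
    split; rewrite ?inE ?eqxx ?orbT //; exists (Mid k.*2.+1); rewrite ?inE ?eqxx ?orbT //.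
    by rewrite !vtxE /= eqn_leq ltnn.
  - exists [:: Ring n; Mid k.*2.+1; Tip k]; first by apply: bsU; rewrite !inE eqxx orbT.
    split; rewrite ?inE ?eqxx ?orbT //; exists (Mid k.*2.+1); rewrite ?inE ?eqxx ?orbT //.
    by rewrite !vtxE /= eqn_leq ltnn.
  - exists (nth [::] (block k n h') 0).
      by apply: bsU; rewrite blocks_cons mem_cat mem_nth.
    split; rewrite ?inE ?eqxx ?orbT //; exists (Mid h'); rewrite ?inE ?eqxx ?orbT //.
    rewrite !vtxE /= orbF; apply: contraNneq k2 => <-; by rewrite !inE eqxx orbT.
  exists (nth [::] (block k n h') 5).
    by apply: bsU; rewrite blocks_cons mem_cat mem_nth.
  split; rewrite ?inE ?eqxx ?orbT //; exists (Vd n.+1); rewrite ?inE ?eqxx ?orbT //.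
  by rewrite !vtxE.
have [bA bAU [B1 B2 [v vb vn]]] := bd1 Apex (mem_head _ _).
have [bT bTU [C1 C2 [v' vb' vn']]] := bd1 (Tip k) (tip_end k).
have [nA nAU [N1 N2 [w wn ww]]] := next Apex (mem_head _ _).
have [nT nTU [M1 M2 [w' wn' ww']]] := next (Tip k) (tip_end k).
move: fh; rewrite !inE => /orP[]/eqP ->; apply: pair_cases; try exact: sharedC.
- exists bA => //; split=> //; exists v => //; apply: contra vn; rewrite !inE.
  by case/or3P => ->; rewrite ?orbT.
- exists [:: Mid k.*2; Ring n; Tip k] => //; split; rewrite ?inE ?eqxx ?orbT //.
  by exists (Tip k); rewrite ?inE ?eqxx ?orbT // !vtxE.
- exists nA => //; split=> //; exists w => //; apply: contra ww; rewrite !inE.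
  by case/or3P => ->; rewrite ?orbT.
- exists [:: Apex; Mid k.*2; Ring n] => //; split; rewrite ?inE ?eqxx ?orbT //.
  by exists Apex; rewrite ?inE ?eqxx ?orbT // !vtxE.
- exists nT => //; split=> //; exists w' => //; apply: contra ww'; rewrite !inE.
  by case/or3P => ->; rewrite ?orbT.
exists bT => //; split=> //; exists v' => //; apply: contra vn'; rewrite !inE.
by case/or3P => ->; rewrite ?orbT.
Qed.

End Core.

Lemma tris_triangular n rs : triangular (tris n rs).
Proof.
move=> f /tris_placed[[q [k hs]] _]; rewrite mem_cat => /orP[|/blocksP[[i _]|]].
- by rewrite !inE => /orP[]/eqP ->; rewrite /= !inE !vtxE.
- rewrite !inE => H; do 11?[case/orP: H => [/eqP -> |H]; first by rewrite /= !inE !vtxE].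
  by move/eqP: H => ->; rewrite /= !inE !vtxE.
by rewrite !inE => /orP[]/eqP ->; rewrite /= !inE !vtxE.
Qed.

Lemma coded_triangular l : triangular l -> triangular (coded l).
Proof. by move=> tl _ /mapP[f /tl fl ->]; rewrite (map_inj_uniq code_inj) size_map. Qed.

Definition face_of (f : seq vtx) : {fset nat} := fset_of (map code f).

Lemma in_face_of f x : (code x \in face_of f) = (x \in f).
Proof. by rewrite in_fset_of (mem_map code_inj). Qed.

(** * Families of regions whose boundary hairs are covered or doubled *)

Section CoreRegions.
Variables (rs : seq region) (Us : seq (nat * region)).
Hypothesis hk : forall r h, r \in rs -> h \in r.2 -> h./2 != r.1.
Hypothesis uhs : forall r, r \in rs -> uniq r.2.
Hypothesis UX : {subset Us <= placed 0 rs}.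
Hypothesis bdU : forall x h, x \in Us -> h./2 = x.2.1 ->
  (exists2 y, y \in Us & h \in y.2.2) \/ (exists2 y, y \in Us & y != x /\ y.2.1 = x.2.1).

Definition core_tris := flatten [seq region_tris x.1 x.2 | x <- Us].

Lemma core_tris_region x : x \in Us -> {subset region_tris x.1 x.2 <= core_tris}.
Proof. by move=> xU f fx; apply/flatten_mapP; exists x. Qed.

(** A covered hair is interior to a block, and a hair that bounds a second region lies in the header
    or footer of that region; either way another triangle is found on each of its edges. *)
Lemma core_boundary x q h : x \in Us -> h./2 = x.2.1 -> owns x q ->
  boundary_shared core_tris x.2.1 q h.
Proof.
move=> xU hx ox e eE; case: (bdU xU hx) => [[y yU hy]|[y yU [yx yk]]].
  have hi : index h y.2.2 < size y.2.2 by rewrite index_mem.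
  have inB i : i < 12 -> nth [::] (block y.2.1 (y.1 + index h y.2.2) h) i \in core_tris.
    move=> i12; apply: (core_tris_region yU); rewrite mem_cat; apply/orP; right.
    by apply: (blocks_block hi); rewrite nth_index // mem_nth.
  move: eE; rewrite !inE => /orP[]/eqP ->.
    (* The edge from the apex lies in two triangles of the block with different ring vertices; the
       one whose ring vertex is not [Ring q] is taken. *)
    case: (eqVneq (y.1 + index h y.2.2) q) => [E|ne].
      exists (nth [::] (block y.2.1 (y.1 + index h y.2.2) h) 10); first exact: inB.
      split; rewrite ?inE ?eqxx ?orbT //; exists (Ring (y.1 + index h y.2.2).+1);
        rewrite ?inE ?eqxx ?orbT //.
      by rewrite !vtxE /= E eqn_leq ltnn.
    exists (nth [::] (block y.2.1 (y.1 + index h y.2.2) h) 0); first exact: inB.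
    split; rewrite ?inE ?eqxx ?orbT //; exists (Ring (y.1 + index h y.2.2));
      rewrite ?inE ?eqxx ?orbT //.
    by rewrite !vtxE /= (negbTE ne).
  exists (nth [::] (block y.2.1 (y.1 + index h y.2.2) h) 2); first exact: inB.
  split; rewrite -?hx ?inE ?eqxx ?orbT //; exists (Va (y.1 + index h y.2.2).+1);
    rewrite ?inE ?eqxx ?orbT //.
  by rewrite !vtxE.
have no r : owns y r -> (Ring r == Ring q) = false.
  move=> oy; rewrite vtxE /=; apply: contraNF yx => /eqP E; rewrite E in oy.
  by apply/eqP; apply: (owns_uniq (UX yU) (UX xU) oy ox).
have inH i : i < 2 -> nth [::] (header y.2.1 y.1) i \in core_tris.
  by move=> i2; apply: (core_tris_region yU); rewrite mem_cat mem_nth.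
have inF i : i < 2 -> nth [::] (footer y.2.1 (y.1 + size y.2.2)) i \in core_tris.
  by move=> i2; apply: (core_tris_region yU); rewrite mem_cat blocks_footer ?orbT // mem_nth.
have n1 : (Ring y.1 == Ring q) = false by apply: no; rewrite /owns leqnn leq_addr.
have n2 : (Ring (y.1 + size y.2.2) == Ring q) = false by apply: no; rewrite /owns leqnn leq_addr.
rewrite -yk in hx eE *; have [->|->] : h = y.2.1.*2 \/ h = y.2.1.*2.+1.
- by rewrite -(odd_double_half h) hx; case: (odd h); [right|left].
- move: eE; rewrite !inE => /orP[]/eqP ->.
    exists (nth [::] (header y.2.1 y.1) 0); first exact: inH.
    split; rewrite ?inE ?eqxx ?orbT //; exists (Ring y.1); rewrite ?inE ?eqxx ?orbT //.
    by rewrite n1 !vtxE.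
  exists (nth [::] (header y.2.1 y.1) 1); first exact: inH.
  split; rewrite ?inE ?eqxx ?orbT //; exists (Ring y.1); rewrite ?inE ?eqxx ?orbT //.
  by rewrite n1 !vtxE.
move: eE; rewrite !inE => /orP[]/eqP ->.
  exists (nth [::] (footer y.2.1 (y.1 + size y.2.2)) 0); first exact: inF.
  split; rewrite ?inE ?eqxx ?orbT //; exists (Ring (y.1 + size y.2.2)); rewrite ?inE ?eqxx ?orbT //.
  by rewrite n2 !vtxE.
exists (nth [::] (footer y.2.1 (y.1 + size y.2.2)) 1); first exact: inF.
split; rewrite ?inE ?eqxx ?orbT //; exists (Ring (y.1 + size y.2.2)); rewrite ?inE ?eqxx ?orbT //.
by rewrite n2 !vtxE.
Qed.

Lemma core_no_free_edge f : f \in core_tris -> no_free_edge core_tris f.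
Proof.
case/flatten_mapP => x xU fx; have xrs := placed_region (UX xU).
apply: region_no_free_edge fx.
- by move=> h; apply: hk.
- exact: uhs.
- exact: core_tris_region.
- by apply: core_boundary => //; rewrite ?doubleK // /owns leqnn leq_addr.
by apply: core_boundary => //; rewrite /= ?uphalf_double // /owns leqnn leq_addr.
Qed.

Lemma core_regions (K : {fset {fset nat}}) : (forall s, s \in K -> #|` s| <= 3) -> Us != [::] ->
  (forall f, f \in core_tris -> face_of f \in K) -> ~ collapsible K.
Proof.
move=> K3 U0 UK.
have tri f : f \in core_tris -> uniq f /\ size f = 3.
  case/flatten_mapP => x xU fx; have : f \in tris 0 rs by apply/tris_placed; exists x => //; apply: UX.
  by move/tris_triangular => /andP[uf /eqP].
apply: (@core_not_collapsible _ K (fun s => exists2 f, f \in core_tris & s = face_of f)) => //.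
- case: Us U0 core_tris_region => // x l _ H.
  exists (face_of [:: Apex; Mid x.2.1.*2; Ring x.1]), [:: Apex; Mid x.2.1.*2; Ring x.1] => //.
  by apply: (H x); rewrite ?mem_head // mem_cat !inE eqxx.
- move=> s [f fU ->]; split; first exact: UK.
  by have [uf sf] := tri f fU; rewrite card_fset_of ?size_map // (map_inj_uniq code_inj).
move=> s x [f fU ->]; rewrite in_fset_of => /mapP[a af ->].
have [uf sf] := tri f fU.
have sh y z : y \in f -> z \in f -> y != z -> {subset f <= [:: a; y; z]} ->
    exists s', [/\ exists2 f, f \in core_tris & s' = face_of f, s' <> face_of f
      & face_of f `\ code a `<=` s'].
  move=> yf zf yz sub; have [g gU [yg zg [w wg wf]]] := core_no_free_edge fU yf zf yz.
  exists (face_of g); split; first by exists g.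
    by move=> E; move: wf; rewrite -in_face_of -E in_face_of wg.
  apply/fsubsetP => u; rewrite in_fsetD1 in_fset_of => /andP[ua /mapP[v vf E]].
  rewrite E in ua *; rewrite in_face_of; move: (sub v vf) ua.
  by rewrite !inE => /or3P[]/eqP -> //; rewrite eqxx.
case: f sf uf af {fU} sh => [|b [|c [|d [|]]]] // _ /=.
rewrite !inE negb_or andbT => /andP[/andP[bc bd] cd] /or3P[]/eqP -> sh.
- by apply: (sh c d); rewrite ?inE ?eqxx ?orbT // => v; rewrite !inE.
- apply: (sh b d); rewrite ?inE ?eqxx ?orbT // => v; rewrite !inE.
  by case/or3P => ->; rewrite ?orbT.
apply: (sh b c); rewrite ?inE ?eqxx ?orbT // => v; rewrite !inE.
by case/or3P => ->; rewrite ?orbT.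
Qed.

End CoreRegions.

(** * Shelling a union of regions *)

Section Reachable.
Variable V : choiceType.
Implicit Types (l : seq (seq V)) (a b c : V).

(** [built] fixes an order of insertion; here only the set of triangles matters, so each
    construction may choose its own order. *)
Definition reachable l := exists2 l', built l' & l' =i l.

Lemma eq_reachable l l' : l =i l' -> reachable l -> reachable l'.
Proof. by move=> E [s bs sE]; exists s => // f; rewrite sE E. Qed.

Lemma reachable_add l a b c : reachable l -> uniq [:: a; b; c] -> attachable l a b c ->
  reachable ([:: a; b; c] :: l).
Proof.
move=> [s bs sE] u at_l; exists ([:: a; b; c] :: s).
  apply: built_cons => //; move: at_l.
  have eE x y : edge_in l x y = edge_in s x y by apply: eq_has_r => f; rewrite sE.
  have vE x : vertex_in l x = vertex_in s x by apply: eq_has_r => f; rewrite sE.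
  by rewrite /attachable !eE !vE.
by move=> f; rewrite !inE sE.
Qed.

Lemma reachable_ab_bc l a b c : reachable l -> uniq [:: a; b; c] ->
  edge_in l a b -> edge_in l b c -> reachable ([:: a; b; c] :: l).
Proof. by move=> rl u e1 e2; apply: reachable_add => //; rewrite /attachable e1 e2. Qed.

Lemma reachable_bc_ac l a b c : reachable l -> uniq [:: a; b; c] ->
  edge_in l b c -> edge_in l a c -> reachable ([:: a; b; c] :: l).
Proof. by move=> rl u e1 e2; apply: reachable_add => //; rewrite /attachable e1 e2 !orbT. Qed.

Lemma reachable_ab_ac l a b c : reachable l -> uniq [:: a; b; c] ->
  edge_in l a b -> edge_in l a c -> reachable ([:: a; b; c] :: l).
Proof. by move=> rl u e1 e2; apply: reachable_add => //; rewrite /attachable e1 e2 !orbT. Qed.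

Lemma reachable_new_c l a b c : reachable l -> uniq [:: a; b; c] ->
  edge_in l a b -> vertex_in l c = false -> reachable ([:: a; b; c] :: l).
Proof. by move=> rl u e1 e2; apply: reachable_add => //; rewrite /attachable e1 e2 !orbT. Qed.

Lemma reachable_new_a l a b c : reachable l -> uniq [:: a; b; c] ->
  edge_in l b c -> vertex_in l a = false -> reachable ([:: a; b; c] :: l).
Proof. by move=> rl u e1 e2; apply: reachable_add => //; rewrite /attachable e1 e2 !orbT. Qed.

Lemma reachable_new_b l a b c : reachable l -> uniq [:: a; b; c] ->
  edge_in l a c -> vertex_in l b = false -> reachable ([:: a; b; c] :: l).
Proof. by move=> rl u e1 e2; apply: reachable_add => //; rewrite /attachable e1 e2 !orbT. Qed.

Lemma reachable_swap l f g : reachable (f :: g :: l) -> reachable (g :: f :: l).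
Proof. by apply: eq_reachable => h; rewrite !inE orbCA. Qed.

End Reachable.

Ltac uniqT := by rewrite /= !inE !vtxE.
Ltac edgeE := by rewrite !edge_in_cons !inE !vtxE /= ?eqxx ?orbT.

Section Fill.
Implicit Types (l : seq (seq vtx)) (k n h : nat).

(** The ten triangles of the block that avoid the apex; the other two are in [star_blocks] and are
    inserted earlier. *)
Definition fill_block k n h : seq (seq vtx) :=
  [:: [:: Ring n; Mid h; Va n.+1]; [:: Mid h; Tip h./2; Va n.+1]; [:: Tip h./2; Va n.+1; Vd n.+1];
      [:: Ring n; Va n.+1; Vd n.+1]; [:: Ring n; Vd n.+1; Tip k]; [:: Tip h./2; Vb n.+1; Vd n.+1];
      [:: Mid h; Tip h./2; Vb n.+1]; [:: Mid h; Vb n.+1; Ring n.+1];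
      [:: Vb n.+1; Vd n.+1; Ring n.+1]; [:: Vd n.+1; Ring n.+1; Tip k]].

(** If the edge [m u] is present, the triangle on it comes first; if [u] is new, the other one does.
    A vertex [u] that is present without this edge would produce the forbidden meeting in an edge
    and an isolated vertex; the condition [fillable] excludes this case. *)
Lemma reachable_tip l a m u d : reachable l -> uniq [:: m; u; a] -> uniq [:: u; a; d] ->
  edge_in l m a -> edge_in l a d ->
  edge_in l m u \/ vertex_in l u = false -> reachable ([:: m; u; a] :: [:: u; a; d] :: l).
Proof.
move=> rl u1 u2 ma ad [mu|nu].
  apply/reachable_swap/reachable_ab_bc => //; last by rewrite edge_in_cons ad orbT.
    exact: reachable_ab_ac.
  by rewrite edge_in_cons !inE !eqxx !orbT.
apply: reachable_bc_ac => //; last by rewrite edge_in_cons ma orbT.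
  exact: reachable_new_a.
by rewrite edge_in_cons !inE !eqxx !orbT.
Qed.

Section Block.
Variables (l : seq (seq vtx)) (k n h : nat).
Hypotheses (rl : reachable l) (hk : h./2 != k).
Hypotheses (fa : vertex_in l (Va n.+1) = false) (fb : vertex_in l (Vb n.+1) = false).
Hypotheses (fd : vertex_in l (Vd n.+1) = false).
Hypotheses (pm : edge_in l (Ring n) (Mid h)) (mz : edge_in l (Mid h) (Ring n.+1)).
Hypothesis tipH : edge_in l (Mid h) (Tip h./2) \/ vertex_in l (Tip h./2) = false.

Let hkF : (h./2 == k) = false := negbTE hk.
Let khF : (k == h./2) = false.
Proof. by rewrite eq_sym. Qed.
Let mp : edge_in l (Mid h) (Ring n). Proof. by rewrite edge_inC. Qed.
Let zm : edge_in l (Ring n.+1) (Mid h). Proof. by rewrite edge_inC. Qed.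

Ltac eT := by rewrite ?edge_in_cons !inE !vtxE /= ?eqxx ?pm ?mz ?mp ?zm ?orbT.
Ltac vT := by rewrite ?vertex_in_cons ?inE ?vtxE /= ?fa ?fb ?fd.

Lemma fill_block_left : edge_in l (Ring n) (Tip k) -> reachable (fill_block k n h ++ l).
Proof.
move=> e; have e' : edge_in l (Tip k) (Ring n) by rewrite edge_inC.
have H0 : reachable ([:: Ring n; Vd n.+1; Tip k] :: l).
  by apply: (reachable_new_b rl); [uniqT|by rewrite ?edge_in_cons ?inE ?vtxE /= ?eqxx ?pm ?mz ?mp ?zm ?e ?e' ?orbT|vT].
have H1 : reachable ([:: Ring n; Va n.+1; Vd n.+1] :: [:: Ring n; Vd n.+1; Tip k] :: l).
  by apply: (reachable_new_b H0); [uniqT|by rewrite ?edge_in_cons ?inE ?vtxE /= ?eqxx ?pm ?mz ?mp ?zm ?e ?e' ?orbT|vT].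
have H2 : reachable ([:: Ring n; Mid h; Va n.+1] :: [:: Ring n; Va n.+1; Vd n.+1] :: [:: Ring n; Vd n.+1; Tip k] :: l).
  by apply: (reachable_ab_ac H1); [uniqT|by rewrite ?edge_in_cons ?inE ?vtxE /= ?eqxx ?pm ?mz ?mp ?zm ?e ?e' ?orbT|by rewrite ?edge_in_cons ?inE ?vtxE /= ?eqxx ?pm ?mz ?mp ?zm ?e ?e' ?orbT].
have H3 : reachable ([:: Mid h; Tip h./2; Va n.+1] :: [:: Tip h./2; Va n.+1; Vd n.+1] :: [:: Ring n; Mid h; Va n.+1] :: [:: Ring n; Va n.+1; Vd n.+1] :: [:: Ring n; Vd n.+1; Tip k] :: l).
  apply: (reachable_tip H2); [uniqT|uniqT|eT|eT|].
  case: tipH => [mu|nu]; [left|right].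
    by rewrite !edge_in_cons mu ?orbT.
  by rewrite !vertex_in_cons !inE !vtxE /= ?hkF ?khF ?nu.
have H4 : reachable ([:: Tip h./2; Vb n.+1; Vd n.+1] :: [:: Mid h; Tip h./2; Va n.+1] :: [:: Tip h./2; Va n.+1; Vd n.+1] :: [:: Ring n; Mid h; Va n.+1] :: [:: Ring n; Va n.+1; Vd n.+1] :: [:: Ring n; Vd n.+1; Tip k] :: l).
  by apply: (reachable_new_b H3); [uniqT|by rewrite ?edge_in_cons ?inE ?vtxE /= ?eqxx ?pm ?mz ?mp ?zm ?e ?e' ?orbT|vT].
have H5 : reachable ([:: Mid h; Tip h./2; Vb n.+1] :: [:: Tip h./2; Vb n.+1; Vd n.+1] :: [:: Mid h; Tip h./2; Va n.+1] :: [:: Tip h./2; Va n.+1; Vd n.+1] :: [:: Ring n; Mid h; Va n.+1] :: [:: Ring n; Va n.+1; Vd n.+1] :: [:: Ring n; Vd n.+1; Tip k] :: l).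
  by apply: (reachable_ab_bc H4); [uniqT|by rewrite ?edge_in_cons ?inE ?vtxE /= ?eqxx ?pm ?mz ?mp ?zm ?e ?e' ?orbT|by rewrite ?edge_in_cons ?inE ?vtxE /= ?eqxx ?pm ?mz ?mp ?zm ?e ?e' ?orbT].
have H6 : reachable ([:: Mid h; Vb n.+1; Ring n.+1] :: [:: Mid h; Tip h./2; Vb n.+1] :: [:: Tip h./2; Vb n.+1; Vd n.+1] :: [:: Mid h; Tip h./2; Va n.+1] :: [:: Tip h./2; Va n.+1; Vd n.+1] :: [:: Ring n; Mid h; Va n.+1] :: [:: Ring n; Va n.+1; Vd n.+1] :: [:: Ring n; Vd n.+1; Tip k] :: l).
  by apply: (reachable_ab_ac H5); [uniqT|by rewrite ?edge_in_cons ?inE ?vtxE /= ?eqxx ?pm ?mz ?mp ?zm ?e ?e' ?orbT|by rewrite ?edge_in_cons ?inE ?vtxE /= ?eqxx ?pm ?mz ?mp ?zm ?e ?e' ?orbT].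
have H7 : reachable ([:: Vb n.+1; Vd n.+1; Ring n.+1] :: [:: Mid h; Vb n.+1; Ring n.+1] :: [:: Mid h; Tip h./2; Vb n.+1] :: [:: Tip h./2; Vb n.+1; Vd n.+1] :: [:: Mid h; Tip h./2; Va n.+1] :: [:: Tip h./2; Va n.+1; Vd n.+1] :: [:: Ring n; Mid h; Va n.+1] :: [:: Ring n; Va n.+1; Vd n.+1] :: [:: Ring n; Vd n.+1; Tip k] :: l).
  by apply: (reachable_ab_ac H6); [uniqT|by rewrite ?edge_in_cons ?inE ?vtxE /= ?eqxx ?pm ?mz ?mp ?zm ?e ?e' ?orbT|by rewrite ?edge_in_cons ?inE ?vtxE /= ?eqxx ?pm ?mz ?mp ?zm ?e ?e' ?orbT].
have H8 : reachable ([:: Vd n.+1; Ring n.+1; Tip k] :: [:: Vb n.+1; Vd n.+1; Ring n.+1] :: [:: Mid h; Vb n.+1; Ring n.+1] :: [:: Mid h; Tip h./2; Vb n.+1] :: [:: Tip h./2; Vb n.+1; Vd n.+1] :: [:: Mid h; Tip h./2; Va n.+1] :: [:: Tip h./2; Va n.+1; Vd n.+1] :: [:: Ring n; Mid h; Va n.+1] :: [:: Ring n; Va n.+1; Vd n.+1] :: [:: Ring n; Vd n.+1; Tip k] :: l).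
  by apply: (reachable_ab_ac H7); [uniqT|by rewrite ?edge_in_cons ?inE ?vtxE /= ?eqxx ?pm ?mz ?mp ?zm ?e ?e' ?orbT|by rewrite ?edge_in_cons ?inE ?vtxE /= ?eqxx ?pm ?mz ?mp ?zm ?e ?e' ?orbT].
apply: eq_reachable H8 => f; rewrite [RHS]mem_cat !inE.
by repeat (case: (f == _) => /=; rewrite ?orbT //).
Qed.

(** Mirror image of [fill_block_left]. Both directions are needed because either boundary hair of a
    region may be the one that is already present. *)
Lemma fill_block_right : edge_in l (Ring n.+1) (Tip k) -> reachable (fill_block k n h ++ l).
Proof.
move=> e; have e' : edge_in l (Tip k) (Ring n.+1) by rewrite edge_inC.
have H0 : reachable ([:: Vd n.+1; Ring n.+1; Tip k] :: l).
  by apply: (reachable_new_a rl); [uniqT|by rewrite ?edge_in_cons ?inE ?vtxE /= ?eqxx ?pm ?mz ?mp ?zm ?e ?e' ?orbT|vT].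
have H1 : reachable ([:: Vb n.+1; Vd n.+1; Ring n.+1] :: [:: Vd n.+1; Ring n.+1; Tip k] :: l).
  by apply: (reachable_new_a H0); [uniqT|by rewrite ?edge_in_cons ?inE ?vtxE /= ?eqxx ?pm ?mz ?mp ?zm ?e ?e' ?orbT|vT].
have H2 : reachable ([:: Mid h; Vb n.+1; Ring n.+1] :: [:: Vb n.+1; Vd n.+1; Ring n.+1] :: [:: Vd n.+1; Ring n.+1; Tip k] :: l).
  by apply: (reachable_bc_ac H1); [uniqT|by rewrite ?edge_in_cons ?inE ?vtxE /= ?eqxx ?pm ?mz ?mp ?zm ?e ?e' ?orbT|by rewrite ?edge_in_cons ?inE ?vtxE /= ?eqxx ?pm ?mz ?mp ?zm ?e ?e' ?orbT].
have H3 : reachable ([:: Mid h; Tip h./2; Vb n.+1] :: [:: Tip h./2; Vb n.+1; Vd n.+1] :: [:: Mid h; Vb n.+1; Ring n.+1] :: [:: Vb n.+1; Vd n.+1; Ring n.+1] :: [:: Vd n.+1; Ring n.+1; Tip k] :: l).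
  apply: (reachable_tip H2); [uniqT|uniqT|eT|eT|].
  case: tipH => [mu|nu]; [left|right].
    by rewrite !edge_in_cons mu ?orbT.
  by rewrite !vertex_in_cons !inE !vtxE /= ?hkF ?khF ?nu.
have H4 : reachable ([:: Tip h./2; Va n.+1; Vd n.+1] :: [:: Mid h; Tip h./2; Vb n.+1] :: [:: Tip h./2; Vb n.+1; Vd n.+1] :: [:: Mid h; Vb n.+1; Ring n.+1] :: [:: Vb n.+1; Vd n.+1; Ring n.+1] :: [:: Vd n.+1; Ring n.+1; Tip k] :: l).
  by apply: (reachable_new_b H3); [uniqT|by rewrite ?edge_in_cons ?inE ?vtxE /= ?eqxx ?pm ?mz ?mp ?zm ?e ?e' ?orbT|vT].
have H5 : reachable ([:: Mid h; Tip h./2; Va n.+1] :: [:: Tip h./2; Va n.+1; Vd n.+1] :: [:: Mid h; Tip h./2; Vb n.+1] :: [:: Tip h./2; Vb n.+1; Vd n.+1] :: [:: Mid h; Vb n.+1; Ring n.+1] :: [:: Vb n.+1; Vd n.+1; Ring n.+1] :: [:: Vd n.+1; Ring n.+1; Tip k] :: l).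
  by apply: (reachable_ab_bc H4); [uniqT|by rewrite ?edge_in_cons ?inE ?vtxE /= ?eqxx ?pm ?mz ?mp ?zm ?e ?e' ?orbT|by rewrite ?edge_in_cons ?inE ?vtxE /= ?eqxx ?pm ?mz ?mp ?zm ?e ?e' ?orbT].
have H6 : reachable ([:: Ring n; Mid h; Va n.+1] :: [:: Mid h; Tip h./2; Va n.+1] :: [:: Tip h./2; Va n.+1; Vd n.+1] :: [:: Mid h; Tip h./2; Vb n.+1] :: [:: Tip h./2; Vb n.+1; Vd n.+1] :: [:: Mid h; Vb n.+1; Ring n.+1] :: [:: Vb n.+1; Vd n.+1; Ring n.+1] :: [:: Vd n.+1; Ring n.+1; Tip k] :: l).
  by apply: (reachable_ab_bc H5); [uniqT|by rewrite ?edge_in_cons ?inE ?vtxE /= ?eqxx ?pm ?mz ?mp ?zm ?e ?e' ?orbT|by rewrite ?edge_in_cons ?inE ?vtxE /= ?eqxx ?pm ?mz ?mp ?zm ?e ?e' ?orbT].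
have H7 : reachable ([:: Ring n; Va n.+1; Vd n.+1] :: [:: Ring n; Mid h; Va n.+1] :: [:: Mid h; Tip h./2; Va n.+1] :: [:: Tip h./2; Va n.+1; Vd n.+1] :: [:: Mid h; Tip h./2; Vb n.+1] :: [:: Tip h./2; Vb n.+1; Vd n.+1] :: [:: Mid h; Vb n.+1; Ring n.+1] :: [:: Vb n.+1; Vd n.+1; Ring n.+1] :: [:: Vd n.+1; Ring n.+1; Tip k] :: l).
  by apply: (reachable_ab_bc H6); [uniqT|by rewrite ?edge_in_cons ?inE ?vtxE /= ?eqxx ?pm ?mz ?mp ?zm ?e ?e' ?orbT|by rewrite ?edge_in_cons ?inE ?vtxE /= ?eqxx ?pm ?mz ?mp ?zm ?e ?e' ?orbT].
have H8 : reachable ([:: Ring n; Vd n.+1; Tip k] :: [:: Ring n; Va n.+1; Vd n.+1] :: [:: Ring n; Mid h; Va n.+1] :: [:: Mid h; Tip h./2; Va n.+1] :: [:: Tip h./2; Va n.+1; Vd n.+1] :: [:: Mid h; Tip h./2; Vb n.+1] :: [:: Tip h./2; Vb n.+1; Vd n.+1] :: [:: Mid h; Vb n.+1; Ring n.+1] :: [:: Vb n.+1; Vd n.+1; Ring n.+1] :: [:: Vd n.+1; Ring n.+1; Tip k] :: l).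
  by apply: (reachable_ab_bc H7); [uniqT|by rewrite ?edge_in_cons ?inE ?vtxE /= ?eqxx ?pm ?mz ?mp ?zm ?e ?e' ?orbT|by rewrite ?edge_in_cons ?inE ?vtxE /= ?eqxx ?pm ?mz ?mp ?zm ?e ?e' ?orbT].
apply: eq_reachable H8 => f; rewrite [RHS]mem_cat !inE.
by repeat (case: (f == _) => /=; rewrite ?orbT //).
Qed.

End Block.
End Fill.

Section Fill.
Implicit Types (l : seq (seq vtx)) (k n h : nat) (hs : seq nat).

Fixpoint fill_blocks k n hs : seq (seq vtx) :=
  if hs is h :: hs' then fill_block k n h ++ fill_blocks k n.+1 hs'
  else [:: [:: Ring n; Mid k.*2.+1; Tip k]].

Fixpoint star_blocks k n hs : seq (seq vtx) :=
  if hs is h :: hs' then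
    [:: [:: Apex; Ring n; Mid h]; [:: Apex; Mid h; Ring n.+1]] ++ star_blocks k n.+1 hs'
  else [:: [:: Apex; Ring n; Mid k.*2.+1]].

Definition fill_region (x : nat * region) : seq (seq vtx) :=
  [:: Mid x.2.1.*2; Ring x.1; Tip x.2.1] :: fill_blocks x.2.1 x.1 x.2.2.

Definition star_region (x : nat * region) : seq (seq vtx) :=
  [:: Apex; Mid x.2.1.*2; Ring x.1] :: star_blocks x.2.1 x.1 x.2.2.

Lemma fill_blocks_cons k n h hs :
  fill_blocks k n (h :: hs) = fill_block k n h ++ fill_blocks k n.+1 hs.
Proof. by []. Qed.

Lemma star_blocks_cons k n h hs : star_blocks k n (h :: hs) =
  [:: [:: Apex; Ring n; Mid h]; [:: Apex; Mid h; Ring n.+1]] ++ star_blocks k n.+1 hs.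
Proof. by []. Qed.

Lemma blocks_split k n hs : blocks k n hs =i star_blocks k n hs ++ fill_blocks k n hs.
Proof.
elim: hs n => [|h hs IH] n f; first by rewrite !inE.
rewrite blocks_cons star_blocks_cons fill_blocks_cons !mem_cat IH mem_cat.
set A := f \in star_blocks _ _ _; set B := f \in fill_blocks _ _ _.
rewrite /block /block_tris /fill_block !inE.
by repeat (case: (f == _); rewrite ?orbT //).
Qed.

Lemma region_split x : region_tris x.1 x.2 =i star_region x ++ fill_region x.
Proof.
move=> f; rewrite mem_cat blocks_split mem_cat [RHS]mem_cat !(in_cons _ _ f).
rewrite /header !inE; case: (f == _) => //=; case: (f == _) => //=; by rewrite ?orbT.
Qed.

Lemma fill_tip k hs n t : vertex_in (fill_blocks k n hs) (Tip t) ->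
  t = k \/ exists2 h, h \in hs & h./2 = t.
Proof.
elim: hs n => [|h hs IH] n.
  by rewrite /vertex_in /= !inE !vtxE /= orbF => /eqP ->; left.
rewrite fill_blocks_cons vertex_in_cat => /orP[|/IH[->|[h' h'i <-]]].
- rewrite /vertex_in /fill_block /= !inE !vtxE /= !orbF => H.
  have [->|->] : t = h./2 \/ t = k by lia.
    by right; exists h; rewrite ?mem_head.
  by left.
- by left.
by right; exists h'; rewrite // inE h'i orbT.
Qed.

Definition inner q x := [\/ x = Va q, x = Vb q | x = Vd q].

Lemma fill_inner k hs n q x : inner q x -> vertex_in (fill_blocks k n hs) x -> n < q <= n + size hs.
Proof.
elim: hs n => [|h hs IH] n.
  by case=> ->; rewrite /vertex_in /= !inE !vtxE.
move=> iq; rewrite fill_blocks_cons vertex_in_cat => /orP[|/(IH _ iq)]; last first.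
  by rewrite /= -addSnnS => /andP[/ltnW -> ->].
case: iq => ->; rewrite /vertex_in /fill_block /= !inE !vtxE /= ?orbF => H.
all: by move: H; rewrite !orbb => /eqP ->; rewrite ltnSn addnS ltnS leq_addr.
Qed.

Definition inner_free n m l := forall q x, n < q <= n + m -> inner q x -> vertex_in l x = false.

(** What [reachable_tip] asks of every covered hair. A new tip must not be shared by two covered
    hairs, since the first of them would make it present for the second. *)
Definition tips_free hs l := forall h, h \in hs -> edge_in l (Mid h) (Tip h./2) \/
  vertex_in l (Tip h./2) = false /\ (forall h', h' \in hs -> h'./2 = h./2 -> h' = h).

Lemma reachable_fill_left k hs n l : reachable l -> (forall h, h \in hs -> h./2 != k) ->
  {subset star_blocks k n hs <= l} -> edge_in l (Ring n) (Tip k) ->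
  inner_free n (size hs) l -> uniq hs -> tips_free hs l -> reachable (fill_blocks k n hs ++ l).
Proof.
elim: hs n l => [|h hs IH] n l rl hk sl e fr uhs tips.
  apply: reachable_ab_ac => //; first by uniqT.
  apply/hasP; exists [:: Apex; Ring n; Mid k.*2.+1]; last by rewrite !inE !eqxx !orbT.
  by apply: sl; rewrite mem_head.
have hh : h \in h :: hs by rewrite mem_head.
have /andP[hhs uhs'] : (h \notin hs) && uniq hs by exact: uhs.
have r1 : reachable (fill_block k n h ++ l).
  apply: fill_block_left => //; first exact: hk.
  - by apply: (fr n.+1); [rewrite ltnSn /= addnS ltnS leq_addr|constructor 1].
  - by apply: (fr n.+1); [rewrite ltnSn /= addnS ltnS leq_addr|constructor 2].
  - by apply: (fr n.+1); [rewrite ltnSn /= addnS ltnS leq_addr|constructor 3].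
  - apply/hasP; exists [:: Apex; Ring n; Mid h]; last by rewrite !inE !eqxx !orbT.
    by apply: sl; rewrite star_blocks_cons mem_cat mem_head.
  - apply/hasP; exists [:: Apex; Mid h; Ring n.+1]; last by rewrite !inE !eqxx !orbT.
    by apply: sl; rewrite star_blocks_cons mem_cat !inE eqxx orbT.
  by case: (tips h hh) => [|[]]; [left|right].
apply: (@eq_reachable _ (fill_blocks k n.+1 hs ++ (fill_block k n h ++ l))).
  by move=> f; rewrite fill_blocks_cons !mem_cat orbCA orbA.
apply: IH => //.
- by move=> h' h'i; apply: hk; rewrite inE h'i orbT.
- by move=> f fs; rewrite mem_cat sl ?orbT // star_blocks_cons mem_cat fs orbT.
- by rewrite edge_in_cat /fill_block; apply/orP; left; edgeE.
- move=> q x nq iq; rewrite vertex_in_cat [X in _ || X](fr q) ?orbF //; last first.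
    by move: nq; rewrite /= addSnnS => /andP[/ltnW -> ->].
  apply/negP => H; have : vertex_in (fill_blocks k n [:: h]) x.
    by rewrite fill_blocks_cons vertex_in_cat H.
  by move/(fill_inner iq); rewrite addn1 => /andP[_]; case/andP: nq => nq _; rewrite leqNgt nq.
move=> h' h'i; have h'i' : h' \in h :: hs by rewrite inE h'i orbT.
case: (tips h' h'i') => [e1|[nv un]]; first by left; rewrite edge_in_cat e1 orbT.
right; split; last by move=> h2 h2i; apply: un; rewrite inE h2i orbT.
rewrite vertex_in_cat nv orbF; apply/negP => H.
have : vertex_in (fill_blocks k n [:: h]) (Tip h'./2) by rewrite fill_blocks_cons vertex_in_cat H.
case/fill_tip => [E|[h2]]; first by have := hk h' h'i'; rewrite E eqxx.
rewrite inE => /eqP -> /esym E; move: hhs.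
by rewrite (un h hh (esym E)) h'i.
Qed.

Lemma reachable_fill_right k hs n l : reachable l -> (forall h, h \in hs -> h./2 != k) ->
  {subset star_blocks k n hs <= l} -> edge_in l (Mid k.*2.+1) (Tip k) ->
  inner_free n (size hs) l -> uniq hs -> tips_free hs l ->
  reachable (fill_blocks k n hs ++ l) /\ edge_in (fill_blocks k n hs ++ l) (Ring n) (Tip k).
Proof.
move=> rl hk sl e fr uhs tips.
have eP n0 hs0 : edge_in (fill_blocks k n0 hs0 ++ l) (Ring n0) (Tip k).
  case: hs0 => [|h0 hs0]; first by edgeE.
  by rewrite fill_blocks_cons -catA edge_in_cat /fill_block; apply/orP; left; edgeE.
split=> //; elim: hs n sl hk fr uhs tips => [|h hs IH] n sl hk fr uhs tips.
  apply: reachable_ab_bc => //; first by uniqT.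
  apply/hasP; exists [:: Apex; Ring n; Mid k.*2.+1]; last by rewrite !inE !eqxx !orbT.
  by apply: sl; rewrite mem_head.
have hh : h \in h :: hs by rewrite mem_head.
have /andP[hhs uhs'] : (h \notin hs) && uniq hs by exact: uhs.
have r1 : reachable (fill_blocks k n.+1 hs ++ l).
  apply: IH => //.
  - by move=> f fs; apply: sl; rewrite star_blocks_cons mem_cat fs orbT.
  - by move=> h' h'i; apply: hk; rewrite inE h'i orbT.
  - move=> q x nq; apply: fr; move: nq; by rewrite /= addSnnS => /andP[/ltnW -> ->].
  move=> h' h'i; have h'i' : h' \in h :: hs by rewrite inE h'i orbT.
  case: (tips h' h'i') => [e1|[nv un]]; first by left.
  by right; split=> // h2 h2i; apply: un; rewrite inE h2i orbT.
have frn x : inner n.+1 x -> vertex_in (fill_blocks k n.+1 hs ++ l) x = false.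
  move=> iq; rewrite vertex_in_cat (fr n.+1 x _ iq) ?orbF; last by rewrite ltnSn /= addnS ltnS leq_addr.
  apply/negP; by move/(fill_inner iq); rewrite ltnn.
apply: (@eq_reachable _ (fill_block k n h ++ (fill_blocks k n.+1 hs ++ l))).
  by move=> f; rewrite fill_blocks_cons !mem_cat orbA.
apply: fill_block_right => //.
- exact: hk.
- by apply: frn; constructor 1.
- by apply: frn; constructor 2.
- by apply: frn; constructor 3.
- rewrite edge_in_cat; apply/orP; right; apply/hasP.
  exists [:: Apex; Ring n; Mid h]; last by rewrite !inE !eqxx !orbT.
  by apply: sl; rewrite star_blocks_cons mem_cat mem_head.
- rewrite edge_in_cat; apply/orP; right; apply/hasP.
  exists [:: Apex; Mid h; Ring n.+1]; last by rewrite !inE !eqxx !orbT.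
  by apply: sl; rewrite star_blocks_cons mem_cat !inE eqxx orbT.
case: (tips h hh) => [e1|[nv un]]; first by left; rewrite edge_in_cat e1 orbT.
right; rewrite vertex_in_cat nv orbF; apply/negP => /fill_tip[E|[h2 h2i E]].
  by have := hk h hh; rewrite E eqxx.
by move: hhs; rewrite -(un h2 _ E) ?h2i // inE h2i orbT.
Qed.

(** The region is entered from its header if the outer edge of the hair [k.*2] is present or the tip
    is new, and from its footer if the other hair is present. *)
Lemma reachable_fill_region n k hs l : reachable l -> (forall h, h \in hs -> h./2 != k) ->
  {subset star_region (n, (k, hs)) <= l} ->
  [\/ edge_in l (Mid k.*2) (Tip k), edge_in l (Mid k.*2.+1) (Tip k) | vertex_in l (Tip k) = false] ->
  inner_free n (size hs) l -> uniq hs -> tips_free hs l -> reachable (fill_region (n, (k, hs)) ++ l).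
Proof.
move=> rl hk sl bd fr uhs tips; rewrite /fill_region /=.
have mr : edge_in l (Mid k.*2) (Ring n).
  apply/hasP; exists [:: Apex; Mid k.*2; Ring n]; last by rewrite !inE !eqxx !orbT.
  by apply: sl; rewrite mem_head.
have sb : {subset star_blocks k n hs <= l} by move=> f fs; apply: sl; rewrite inE fs orbT.
have [bd'|er] : (edge_in l (Mid k.*2) (Tip k) \/ vertex_in l (Tip k) = false) \/
    edge_in l (Mid k.*2.+1) (Tip k) by case: bd; auto.
  apply: (@eq_reachable _ (fill_blocks k n hs ++ [:: Mid k.*2; Ring n; Tip k] :: l)).
    by move=> f; rewrite /= !(mem_cat, inE) orbCA.
  apply: reachable_fill_left => //.
  - case: bd' => [e1|nv]; first by apply: reachable_ab_ac => //; uniqT.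
    by apply: reachable_new_c => //; uniqT.
  - by move=> f /sb fl; rewrite inE fl orbT.
  - by edgeE.
  - move=> q x nq iq; rewrite vertex_in_cons (fr q x nq iq) orbF.
    by case: iq => ->; rewrite !inE !vtxE.
  move=> h hi; case: (tips h hi) => [e1|[nv un]]; first by left; rewrite edge_in_cons e1 orbT.
  right; split=> //; rewrite vertex_in_cons nv orbF !inE !vtxE /=.
  exact: negbTE (hk h hi).
have [r1 e1] := reachable_fill_right rl hk sb er fr uhs tips.
by apply: reachable_ab_bc => //; [uniqT|rewrite edge_in_cat mr orbT].
Qed.

End Fill.

Definition hairs_of (r : region) : seq nat := [:: r.1.*2, r.1.*2.+1 & r.2].

(** [H] collects the hairs whose middle vertex is already joined to the apex; the star of a region
    is attached along its first boundary hair. *)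
Fixpoint linked (H : seq nat) (rs : seq region) : bool :=
  if rs is r :: rs' then (r.1.*2 \in H) && linked (hairs_of r ++ H) rs' else true.

Section Star.
Implicit Types (l : seq (seq vtx)) (k n h : nat) (hs : seq nat).

Definition apical l := forall f, f \in l -> Apex \in f.
Definition ring_free n l := forall q, n <= q -> vertex_in l (Ring q) = false.

Lemma apical_edge l x : apical l -> vertex_in l x -> edge_in l Apex x.
Proof. by move=> al /hasP[f fl xf]; apply/hasP; exists f; rewrite ?al. Qed.

Lemma apical_cons l f : Apex \in f -> apical l -> apical (f :: l).
Proof. by move=> Af al g; rewrite inE => /orP[/eqP ->|/al]. Qed.

(** As long as all triangles contain the apex, a vertex that is present is joined to it, so an
    isolated opposite vertex cannot occur. *)
Lemma reachable_star_mid l n h : reachable l -> apical l -> edge_in l Apex (Ring n) ->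
  reachable ([:: Apex; Ring n; Mid h] :: l).
Proof.
move=> rl al e; case: (boolP (vertex_in l (Mid h))) => [/(apical_edge al) e'|/negbTE nv].
  by apply: reachable_ab_ac => //; uniqT.
by apply: reachable_new_c => //; uniqT.
Qed.

Lemma reachable_star_blocks k hs n l : reachable l -> apical l -> edge_in l Apex (Ring n) ->
  ring_free n.+1 l -> reachable (star_blocks k n hs ++ l).
Proof.
elim: hs n l => [|h hs IH] n l rl al e fr; first exact: reachable_star_mid.
have r1 := reachable_star_mid h rl al e.
apply: (@eq_reachable _ (star_blocks k n.+1 hs ++
    [:: Apex; Mid h; Ring n.+1] :: [:: Apex; Ring n; Mid h] :: l)).
  move=> f; rewrite star_blocks_cons mem_cat [RHS]mem_cat mem_cat !inE.
  by do 2!case: (f == _); rewrite ?orbT.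
apply: IH.
- apply: reachable_new_c r1 _ _ _; first by uniqT.
    by edgeE.
  by rewrite vertex_in_cons fr // !inE !vtxE /= ?orbF eqn_leq ltnn.
- by do 2!apply: apical_cons => //.
- by edgeE.
move=> q nq; rewrite !vertex_in_cons fr; last exact: ltnW.
rewrite !inE !vtxE /= !orbF; apply/negP => /orP[]/eqP E; move: nq; rewrite E; lia.
Qed.

Lemma star_blocks_apical k n hs : apical (star_blocks k n hs).
Proof.
elim: hs n => [|h hs IH] n f; first by rewrite inE => /eqP ->; rewrite mem_head.
rewrite star_blocks_cons mem_cat => /orP[|/IH //].
by rewrite !inE => /orP[]/eqP ->; rewrite mem_head.
Qed.

Lemma star_region_apical x : apical (star_region x).
Proof. by apply: apical_cons; rewrite ?mem_head //; apply: star_blocks_apical. Qed.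

Lemma star_sub_region x f : f \in star_region x -> f \in region_tris x.1 x.2.
Proof. by rewrite region_split mem_cat => ->. Qed.

Lemma fill_sub_region x f : f \in fill_region x -> f \in region_tris x.1 x.2.
Proof. by rewrite region_split mem_cat orbC => ->. Qed.

Lemma star_mid k n hs h : h \in k.*2.+1 :: hs -> vertex_in (star_blocks k n hs) (Mid h).
Proof.
elim: hs n => [|h' hs IH] n.
  by rewrite inE => /eqP ->; rewrite /vertex_in /= !inE eqxx !orbT.
rewrite star_blocks_cons vertex_in_cat !inE orbCA => /orP[/eqP ->|hi].
  by rewrite /vertex_in /= !inE eqxx ?orbT.
by rewrite IH ?orbT // inE.
Qed.

Lemma star_region_mid n r h : h \in hairs_of r -> vertex_in (star_region (n, r)) (Mid h).
Proof.
rewrite /star_region vertex_in_cons in_cons => /orP[/eqP ->|hi]; first by rewrite !inE eqxx orbT.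
by rewrite star_mid ?orbT.
Qed.

Definition all_stars n rs := flatten [seq star_region x | x <- placed n rs].

Lemma all_stars_cons n r rs :
  all_stars n (r :: rs) = star_region (n, r) ++ all_stars (n + size r.2).+1 rs.
Proof. by []. Qed.

Lemma reachable_stars rs n l H : reachable l -> apical l ->
  (forall h, h \in H -> vertex_in l (Mid h)) -> ring_free n l -> linked H rs ->
  reachable (all_stars n rs ++ l).
Proof.
elim: rs n l H => // r rs IH n l H rl al HH fr /andP[rH lH].
apply: (@eq_reachable _ (all_stars (n + size r.2).+1 rs ++ (star_region (n, r) ++ l))).
  by move=> f; rewrite all_stars_cons !mem_cat orbCA orbA.
have ek := apical_edge al (HH _ rH).
have al1 : apical ([:: Apex; Mid r.1.*2; Ring n] :: l) by apply: apical_cons.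
apply: (IH _ _ (hairs_of r ++ H)) => //.
- apply: (@eq_reachable _ (star_blocks r.1 n r.2 ++ [:: Apex; Mid r.1.*2; Ring n] :: l)).
    by move=> f; rewrite /star_region /= mem_cat !inE mem_cat orbCA.
  apply: reachable_star_blocks => //.
  + by apply: reachable_new_c => //; [uniqT|apply: fr].
  + by edgeE.
  move=> q nq; rewrite vertex_in_cons fr; last exact: ltnW.
  by rewrite !inE !vtxE /= !orbF; apply/negP => /eqP E; rewrite E ltnn in nq.
- by move=> f; rewrite mem_cat => /orP[/star_region_apical|/al].
- move=> h; rewrite mem_cat vertex_in_cat => /orP[/(star_region_mid n) -> //|/HH ->].
  by rewrite orbT.
move=> q nq; rewrite vertex_in_cat fr ?orbF; last first.
  apply: leq_trans nq; by rewrite -addnS leq_addr.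
apply/negP => /hasP[f /star_sub_region fr' qf].
have : vertex_in (region_tris n r) (Ring q) by apply/hasP; exists f.
by move/region_num; rewrite /= ltnS leqNgt nq.
Qed.

Lemma reachable_all_stars r rs : linked (hairs_of r) rs ->
  reachable (all_stars 0 (r :: rs)).
Proof.
move=> lk.
have r0 : reachable [:: [:: Apex; Mid r.1.*2; Ring 0]].
  by exists [:: [:: Apex; Mid r.1.*2; Ring 0]] => //; apply: built_start; rewrite /= !inE !vtxE.
have a0 : apical [:: [:: Apex; Mid r.1.*2; Ring 0]] by apply: apical_cons.
apply: (@eq_reachable _ (all_stars (0 + size r.2).+1 rs ++ star_region (0, r))).
  by move=> f; rewrite all_stars_cons !mem_cat orbC.
apply: (@reachable_stars _ _ _ (hairs_of r)) => //.
- apply: (@eq_reachable _ (star_blocks r.1 0 r.2 ++ [:: [:: Apex; Mid r.1.*2; Ring 0]])).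
    by move=> f; rewrite /star_region /= mem_cat !inE orbC.
  apply: reachable_star_blocks => //; first by edgeE.
  by move=> q nq; rewrite /vertex_in /= !inE !vtxE /= !orbF; apply/negP => /eqP E; rewrite E in nq.
- exact: star_region_apical.
- by move=> h; apply: star_region_mid.
move=> q nq; apply/negP => /hasP[f /star_sub_region fr' qf].
have : vertex_in (region_tris 0 r) (Ring q) by apply/hasP; exists f.
by move/region_num; rewrite /= ltnS leqNgt nq.
Qed.

End Star.

(** * Filling the regions one after another *)

Section Order.
Variable rs : seq region.
Hypothesis hk : forall r h, r \in rs -> h \in r.2 -> h./2 != r.1.
Hypothesis uhs : forall r, r \in rs -> uniq r.2.
Let X := placed 0 rs.
Implicit Types (Ps Os : seq (nat * region)).

Definition hairs_in_use Ps : seq nat := flatten [seq hairs_of x.2 | x <- Ps].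

(* A region can be filled when the tip of each of its hairs that is not yet
   present is a new vertex. *)
Definition fillable Ps (r : region) := forall h, h \in r.2 -> h \in hairs_in_use Ps \/
  (forall h', h'./2 = h./2 -> h' \notin hairs_in_use Ps /\ (h' \in r.2 -> h' = h)).

(** Regions already filled may be repeated, so a last pass can run over all regions. *)
Fixpoint ordered Ps Os : Prop :=
  if Os is x :: Os' then (x \in Ps \/ fillable Ps x.2) /\ ordered (x :: Ps) Os' else True.

Definition filled Ps := flatten [seq fill_region x | x <- Ps] ++ all_stars 0 rs.

Lemma fill_blocks_hair k n hs h : h \in k.*2.+1 :: hs -> edge_in (fill_blocks k n hs) (Mid h) (Tip h./2).
Proof.
elim: hs n => [|h' hs IH] n.
  by rewrite inE => /eqP ->; rewrite /= uphalf_double /edge_in /= !inE !eqxx ?orbT.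
rewrite fill_blocks_cons edge_in_cat !inE orbCA => /orP[/eqP ->|hi].
  by apply/orP; left; rewrite /fill_block; edgeE.
by rewrite IH ?orbT // inE.
Qed.

Lemma fill_region_hair x h : h \in hairs_of x.2 -> edge_in (fill_region x) (Mid h) (Tip h./2).
Proof.
rewrite /fill_region edge_in_cons in_cons => /orP[/eqP ->|hi]; last by rewrite fill_blocks_hair ?orbT.
by rewrite doubleK !inE !eqxx ?orbT.
Qed.

Lemma filled_hair Ps h : h \in hairs_in_use Ps -> edge_in (filled Ps) (Mid h) (Tip h./2).
Proof.
case/flatten_mapP => x xP /fill_region_hair/hasP[f fx H].
by apply/hasP; exists f => //; rewrite mem_cat; apply/orP; left; apply/flatten_mapP; exists x.
Qed.

Lemma star_vertex x : vertex_in (all_stars 0 rs) x -> kind x <= 1 \/ kind x = 3.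
Proof.
case/hasP => f /flatten_mapP[[n [k hs]] _].
rewrite /star_region inE => /orP[/eqP ->|].
  by rewrite !inE => /or3P[]/eqP ->; [left|left|right].
elim: hs n => [|h hs IH] n.
  by rewrite inE => /eqP ->; rewrite !inE => /or3P[]/eqP ->; [left|right|left].
rewrite star_blocks_cons mem_cat => /orP[|/IH //].
by rewrite !inE => /orP[]/eqP ->; rewrite !inE => /or3P[]/eqP ->; auto.
Qed.

Lemma filled_tip Ps t : vertex_in (filled Ps) (Tip t) ->
  exists2 h, h \in hairs_in_use Ps & h./2 = t.
Proof.
rewrite vertex_in_cat => /orP[|/star_vertex]; last by case.
case/hasP => f /flatten_mapP[x xP fx] tf.
have : vertex_in (fill_region x) (Tip t) by apply/hasP; exists f.
suff [h hx <-] : exists2 h, h \in hairs_of x.2 & h./2 = t.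
  by move=> _; exists h => //; apply/flatten_mapP; exists x.
have : vertex_in (fill_region x) (Tip t) by apply/hasP; exists f.
have k2 : exists2 h, h \in hairs_of x.2 & h./2 = x.2.1.
  by exists x.2.1.*2; rewrite ?doubleK // mem_head.
rewrite /fill_region vertex_in_cons => /orP[|/fill_tip[->//|[h hx <-]]].
  by rewrite !inE !vtxE /= => /eqP ->.
by exists h; rewrite // !inE hx !orbT.
Qed.

Lemma filled_inner Ps q x : {subset Ps <= X} -> inner q x -> vertex_in (filled Ps) x ->
  exists2 y, y \in Ps & y.1 < q <= y.1 + size y.2.2.
Proof.
move=> PX iq; rewrite vertex_in_cat => /orP[|/star_vertex]; last first.
  by case: iq => ->; case.
case/hasP => f /flatten_mapP[y yP fy] xf; exists y => //.
have : vertex_in (fill_region y) x by apply/hasP; exists f.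
rewrite /fill_region vertex_in_cons => /orP[|/(fill_inner iq) //].
by case: iq => ->; rewrite !inE !vtxE.
Qed.

Lemma filled_sub Ps : {subset Ps <= X} -> {subset filled Ps <= tris 0 rs}.
Proof.
move=> PX f; rewrite mem_cat => /orP[]/flatten_mapP[x xP fx]; apply/tris_placed; exists x.
- exact: PX.
- exact: fill_sub_region.
- by [].
exact: star_sub_region.
Qed.

Lemma reachable_ordered Os Ps : {subset Ps <= X} -> {subset Os <= X} ->
  reachable (filled Ps) -> ordered Ps Os ->
  exists Qs, [/\ {subset Qs <= X}, reachable (filled Qs), {subset Ps <= Qs} & {subset Os <= Qs}].
Proof.
elim: Os Ps => [|x Os IH] Ps PX OX rP; first by exists Ps; split=> // x.
move=> [ok oO].
have xX : x \in X by apply: OX; rewrite mem_head.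
have OX' : {subset Os <= X} by move=> y yO; apply: OX; rewrite inE yO orbT.
have PX' : {subset x :: Ps <= X} by move=> y; rewrite inE => /orP[/eqP ->|/PX].
suff rP' : reachable (filled (x :: Ps)).
  have [Qs [QX rQ PQ OQ]] := IH _ PX' OX' rP' oO.
  exists Qs; split=> // [y yP|y]; first by apply: PQ; rewrite inE yP orbT.
  by rewrite inE => /orP[/eqP ->|/OQ //]; apply: PQ; rewrite mem_head.
have E : filled (x :: Ps) = fill_region x ++ filled Ps by rewrite /filled [RHS]catA.
have [xP|xP] := boolP (x \in Ps).
  apply: eq_reachable rP => f; rewrite E [RHS]mem_cat orb_idl // => fx.
  by rewrite mem_cat; apply/orP; left; apply/flatten_mapP; exists x.
case: ok => [xP'|ok]; first by rewrite xP' in xP.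
apply: (@eq_reachable _ (fill_region x ++ filled Ps)); first by move=> f; rewrite E.
have xrs := placed_region xX.
case: x xX xrs xP ok {OX PX' E oO} => n [k hs] xX xrs xP ok.
apply: reachable_fill_region => //.
- by move=> h; apply: (hk xrs).
- move=> f fs; rewrite mem_cat; apply/orP; right; apply/flatten_mapP.
  by exists (n, (k, hs)).
(* A tip enters the complex only together with a hair ending in it, so a tip that is present brings
   one of its two hairs. *)
- case: (boolP (vertex_in (filled Ps) (Tip k))) => [/filled_tip[h hP hE]|/negbTE]; last by constructor 3.
  have := filled_hair hP; rewrite hE.
  have [->|->] : h = k.*2 \/ h = k.*2.+1.
  + by rewrite -(odd_double_half h) hE; case: (odd h); [right|left].
  + by constructor 1.
  by constructor 2.
- move=> q y /andP[nq qn] iq; apply/negP => /(filled_inner PX iq)[y' yP /andP[q1 q2]].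
  case/negP: xP; rewrite -(_ : y' = (n, (k, hs))) //.
  apply: (owns_uniq (q := q) (PX _ yP) xX); rewrite /owns /=; first by rewrite q2 ltnW.
  by rewrite qn ltnW.
- exact: (uhs xrs).
move=> h hi; case: (ok h hi) => [/filled_hair|H]; first by left.
right; split; last by move=> h' h'i /H[_]; apply.
by apply/negP => /filled_tip[h' h'P /H[]]; rewrite h'P.
Qed.

Lemma regions_reachable r rs' Os : rs = r :: rs' -> linked (hairs_of r) rs' ->
  Os =i X -> ordered [::] Os -> reachable (tris 0 rs).
Proof.
move=> Ers lk OX oO.
have [||| Qs [QX rQ _ OQ]] := @reachable_ordered Os [::] _ _ _ oO; first by [].

- by move=> x; rewrite OX.
- by rewrite /filled /= Ers; apply: reachable_all_stars.
apply: eq_reachable rQ => f; apply/idP/idP => [/(filled_sub QX) //|].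
case/tris_placed => x xX; rewrite region_split mem_cat mem_cat => /orP[fs|fs].
  by apply/orP; right; apply/flatten_mapP; exists x.
by apply/orP; left; apply/flatten_mapP; exists x => //; apply: OQ; rewrite OX.
Qed.

End Order.

(** * The complex of a formula *)

(* Tip 0 belongs to the hub, tip 3(i+1) to variable i, and tips 3j+1 and 3j+2 to
   clause j. Covering one of the boundary hairs 6j+2 and 6j+3 of the first region
   of clause j, or the boundary hair 6j+5 of its second region, marks an
   occurrence of a literal; the boundary hair 6j+4 of the second region is
   covered by the first. *)
Definition literal : Type := (nat * bool)%type.
Definition slots : seq nat := [:: 2; 3; 5].

Definition clause_occs (l : literal) (j : nat) (c : seq literal) : seq nat :=
  flatten [seq if p.1 == l then [:: 6 * j + p.2] else [::] | p <- zip c slots].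

Fixpoint occs (l : literal) (j : nat) (cs : seq (seq literal)) : seq nat :=
  if cs is c :: cs' then clause_occs l j c ++ occs l j.+1 cs' else [::].

Definition var_regions cs i : seq region :=
  [:: (3 * i.+1, occs (i, true) 0 cs); (3 * i.+1, occs (i, false) 0 cs)].

Definition clause_regions j : seq region :=
  [:: (3 * j + 1, [:: 6 * j + 4]); (3 * j + 2, [:: 0; 1])].

Definition hub t : region := (0, flatten [seq [:: 6 * i.+1; 6 * i.+1 + 1] | i <- iota 0 t]).

Definition regions t cs : seq region :=
  hub t :: flatten [seq var_regions cs i | i <- iota 0 t] ++
           flatten [seq clause_regions j | j <- iota 0 (size cs)].

Definition raw_clauses (phi : cnf3) : seq (seq literal) :=
  [seq [seq (nat_of_ord l.1, l.2) | l <- tval c] | c <- clauses phi].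

Definition lit_at (cs : seq (seq literal)) j k : literal := nth (0, true) (nth [::] cs j) k.

Section Regions.
Variables (t : nat) (cs : seq (seq literal)).
Hypothesis cs_ok : forall c, c \in cs -> size c = 3 /\ forall l, l \in c -> l.1 < t.

Lemma clause_occsP l j c h : size c = 3 -> reflect
  (exists2 k, k < 3 & h = 6 * j + nth 0 slots k /\ nth (0, true) c k = l) (h \in clause_occs l j c).
Proof.
case: c => [|l0 [|l1 [|l2 [|]]]] // _; rewrite /clause_occs /=.
apply: (iffP idP) => [|[[|[|[|k]]] // _ [-> /= ->]]].
- rewrite !mem_cat !orbA orbF => /orP[/orP[]|].
  + by case: eqP => //= El; rewrite inE => /eqP ->; exists 0.
  + by case: eqP => //= El; rewrite inE => /eqP ->; exists 1.
  by case: eqP => //= El; rewrite inE => /eqP ->; exists 2.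
- by rewrite eqxx mem_head.
- by rewrite eqxx mem_cat mem_head orbT.
by rewrite eqxx !mem_cat mem_head !orbT.
Qed.

Lemma occs_from l i s h : (forall c, c \in s -> size c = 3) -> reflect
  (exists j k, [/\ j < size s, k < 3, h = 6 * (i + j) + nth 0 slots k & lit_at s j k = l])
  (h \in occs l i s).
Proof.
elim: s i => [|c s IH] i s3 /=; first by apply: (iffP idP) => // -[j [k []]].
have c3 : size c = 3 by apply: s3; rewrite mem_head.
have {}s3 c' : c' \in s -> size c' = 3 by move=> cs'; apply: s3; rewrite inE cs' orbT.
rewrite mem_cat; apply: (iffP orP) => [[/(clause_occsP _ _ _ c3)[k k3 [-> El]]|/(IH i.+1 s3)[j [k [lt_j k3 -> El]]]]|].
- by exists 0, k; rewrite addn0.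
- by exists j.+1, k; rewrite addSnnS.
move=> [[|j] [k [lt_j k3 E El]]].
  by left; apply/(clause_occsP _ _ _ c3); exists k; rewrite // E addn0.
by right; apply/(IH i.+1 s3); exists j, k; rewrite addSnnS.
Qed.

Lemma cs3 c : c \in cs -> size c = 3. Proof. by case/cs_ok. Qed.

Lemma occsP l h : reflect
  (exists j k, [/\ j < size cs, k < 3, h = 6 * j + nth 0 slots k & lit_at cs j k = l])
  (h \in occs l 0 cs).
Proof. exact: (@occs_from l 0 cs h cs3). Qed.

Lemma occs_uniq l : uniq (occs l 0 cs).
Proof.
suff H (s : seq (seq literal)) i : (forall c, c \in s -> size c = 3) -> uniq (occs l i s) by exact: H cs3.
elim: s i => // c s IH i s3; rewrite [occs _ _ _]/=.
have c3 : size c = 3 by apply: s3; rewrite mem_head.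
have {}s3 c' : c' \in s -> size c' = 3 by move=> cs'; apply: s3; rewrite inE cs' orbT.
rewrite cat_uniq IH // andbT; apply/andP; split.
  case: c c3 => [|l0 [|l1 [|l2 [|]]]] // _; rewrite /clause_occs /=.
  by do 3!case: ifP => _ //=; rewrite ?inE ?eqn_add2l.
apply/hasPn => h /(occs_from _ _ _ s3)[j [k [lt_j k3 -> _]]].
apply/negP => /(clause_occsP _ _ _ c3)[k' k3' [E _]]; move: E.
by case: k k3 => [|[|[|]]] // _; case: k' k3' => [|[|[|]]] // _ /=; lia.
Qed.

Lemma lit_at_lt j k : j < size cs -> k < 3 -> (lit_at cs j k).1 < t.
Proof.
move=> jm k3; have [c3 cl] := cs_ok (mem_nth [::] jm).
by apply: cl; rewrite mem_nth ?c3.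
Qed.

Inductive region_spec : region -> Prop :=
| spec_hub : region_spec (hub t)
| spec_var i b : i < t -> region_spec (3 * i.+1, occs (i, b) 0 cs)
| spec_or1 j : j < size cs -> region_spec (3 * j + 1, [:: 6 * j + 4])
| spec_or2 j : j < size cs -> region_spec (3 * j + 2, [:: 0; 1]).

Lemma regionsP r : r \in regions t cs <-> region_spec r.
Proof.
split.
  rewrite inE mem_cat => /orP[/eqP ->|/orP[]/flatten_mapP[i]]; first by constructor.
    by rewrite mem_iota add0n !inE => /andP[_ lt_i] /orP[]/eqP ->; constructor.
  by rewrite mem_iota add0n !inE => /andP[_ lt_i] /orP[]/eqP ->; constructor.
rewrite inE mem_cat; case=> [|i b lt_i|j lt_j|j lt_j].
- by rewrite eqxx.
- apply/orP; right; apply/orP; left; apply/flatten_mapP; exists i; first by rewrite mem_iota.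
  by rewrite !inE; case: b; rewrite eqxx ?orbT.
- apply/orP; right; apply/orP; right; apply/flatten_mapP; exists j; first by rewrite mem_iota.
  by rewrite !inE eqxx.
apply/orP; right; apply/orP; right; apply/flatten_mapP; exists j; first by rewrite mem_iota.
by rewrite !inE eqxx orbT.
Qed.

Lemma hubP h : h \in (hub t).2 <-> exists2 i, i < t & h = 6 * i.+1 \/ h = 6 * i.+1 + 1.
Proof.
split=> [/flatten_mapP[i]|[i lt_i H]].
  by rewrite mem_iota add0n !inE => /andP[_ lt_i] /orP[]/eqP ->; exists i; auto.
apply/flatten_mapP; exists i; first by rewrite mem_iota.
by rewrite !inE; case: H => ->; rewrite eqxx ?orbT.
Qed.

Lemma regions_half r h : r \in regions t cs -> h \in r.2 -> h./2 != r.1.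
Proof.
move=> /regionsP[|i b lt_i|j lt_j|j lt_j] /=.
- by move/hubP => [i _ [->|->]]; lia.
- by move/occsP => [j [k [_ k3 -> _]]]; case: k k3 => [|[|[|]]] //= _; lia.
- by rewrite inE => /eqP ->; lia.
by rewrite !inE => /orP[]/eqP ->; lia.
Qed.

Lemma regions_uniq r : r \in regions t cs -> uniq r.2.
Proof.
move=> /regionsP[|i b lt_i|j lt_j|j lt_j] //=; last exact: occs_uniq.
suff H n m : uniq (flatten [seq [:: 6 * i.+1; 6 * i.+1 + 1] | i <- iota n m]) by exact: H.
elim: m n => // m IH n /=; rewrite IH andbT inE.
have nH h : h <= 6 * n.+1 + 1 -> h \notin flatten [seq [:: 6 * i.+1; 6 * i.+1 + 1] | i <- iota n.+1 m].
  move=> hle; apply/negP => /flatten_mapP[i]; rewrite mem_iota !inE => /andP[ni _] /orP[]/eqP E; lia.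
by rewrite negb_or !nH ?andbT //; lia.
Qed.

Lemma regions_tips r h : r \in regions t cs -> h \in r.2 -> h./2 \in map fst (regions t cs).
Proof.
have inR r' : region_spec r' -> r'.1 \in map fst (regions t cs) by move/regionsP; apply: map_f.
move=> /regionsP[|i b lt_i|j lt_j|j lt_j] /=.
- move/hubP => [i lt_i E]; rewrite (_ : h./2 = (3 * i.+1, occs (i, true) 0 cs).1) /=; last by lia.
  exact: (inR _ (spec_var true lt_i)).
- move/occsP => [j [k [lt_j k3 E _]]].
  have [E'|E'] : h./2 = 3 * j + 1 \/ h./2 = 3 * j + 2.
    by case: k k3 E => [|[|[|]]] //= _; lia.
    by rewrite E'; apply: (inR _ (spec_or1 lt_j)).
  by rewrite E'; apply: (inR _ (spec_or2 lt_j)).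
- rewrite inE => /eqP ->; rewrite (_ : (6 * j + 4)./2 = 3 * j + 2); last by lia.
  exact: (inR _ (spec_or2 lt_j)).
by move=> h2; rewrite (_ : h./2 = 0) ?(inR _ spec_hub) //; move: h2; rewrite !inE => /orP[]/eqP ->.
Qed.

Lemma size_regions : size (regions t cs) = 1 + 2 * t + 2 * size cs.
Proof.
rewrite /= size_cat !size_flatten /shape -!map_comp.
have E (T : Type) (f : nat -> seq T) n m : (forall i, size (f i) = 2) ->
    sumn [seq (size \o f) i | i <- iota n m] = 2 * m.
  by move=> f2; elim: m n => [|m IH] n //=; rewrite IH f2; lia.
rewrite !E //; lia.
Qed.

(** The two sides of a variable share their tip, whence the difference [t] to [size_regions]. *)
Lemma size_region_tips : size (undup (map fst (regions t cs))) = 1 + t + 2 * size cs.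
Proof.
pose s' := 0 :: [seq 3 * i.+1 | i <- iota 0 t] ++ flatten [seq [:: 3 * j + 1; 3 * j + 2] | j <- iota 0 (size cs)].
have us' : uniq s'.
  rewrite /s' /= mem_cat negb_or cat_uniq map_inj_uniq ?iota_uniq; last by move=> i j; lia.
  apply/andP; split; first (apply/andP; split); last (rewrite andTb; apply/andP; split).
  - by apply/mapP => -[i _]; lia.
  - by apply/flatten_mapP => -[j _]; rewrite !inE => /orP[]/eqP; lia.
  - apply/hasPn => h /flatten_mapP[j _ hj]; apply/mapP => -[i _ E]; move: hj.
    by rewrite !inE E => /orP[]/eqP; lia.
  suff H n m : uniq (flatten [seq [:: 3 * j + 1; 3 * j + 2] | j <- iota n m]) by exact: H.
  elim: m n => // m IH n /=; rewrite IH andbT inE.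
  have nH h : h <= 3 * n + 2 -> h \notin flatten [seq [:: 3 * j + 1; 3 * j + 2] | j <- iota n.+1 m].
    move=> hle; apply/negP => /flatten_mapP[i]; rewrite mem_iota !inE => /andP[ni _] /orP[]/eqP E; lia.
  by rewrite negb_or !nH ?andbT //; lia.
have -> : size (undup (map fst (regions t cs))) = size s'.
  apply/perm_size/uniq_perm; rewrite ?undup_uniq // => h; rewrite mem_undup.
  apply/mapP/idP => [[r /regionsP[|i b lt_i|j lt_j|j lt_j] ->]|] /=.
  - by rewrite mem_head.
  - rewrite inE mem_cat; apply/orP; right; apply/orP; left; apply/mapP.
    by exists i; rewrite ?mem_iota.
  - rewrite inE mem_cat; do 2!(apply/orP; right); apply/flatten_mapP.
    by exists j; rewrite ?mem_iota // mem_head.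
  - rewrite inE mem_cat; do 2!(apply/orP; right); apply/flatten_mapP.
    by exists j; rewrite ?mem_iota // !inE eqxx orbT.
  rewrite inE mem_cat => /or3P[/eqP ->|/mapP[i]|/flatten_mapP[j]].
  - by exists (hub t) => //; apply/regionsP; constructor.
  - rewrite mem_iota => /andP[_ lt_i] ->; exists (3 * i.+1, occs (i, true) 0 cs) => //.
    by apply/regionsP; constructor.
  rewrite mem_iota !inE => /andP[_ lt_j] /orP[]/eqP ->.
    by exists (3 * j + 1, [:: 6 * j + 4]) => //; apply/regionsP; constructor.
  by exists (3 * j + 2, [:: 0; 1]) => //; apply/regionsP; constructor.
rewrite /s' /= size_cat size_map size_iota size_flatten /shape -map_comp.
suff -> n m : sumn [seq (size \o (fun j => [:: 3 * j + 1; 3 * j + 2])) i | i <- iota n m] = 2 * m by lia.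
by elim: m n => //= m IH n; rewrite IH; lia.
Qed.

Lemma linked_sub (H H' : seq nat) rs : {subset H <= H'} -> linked H rs -> linked H' rs.
Proof.
elim: rs H H' => //= r rs IH H H' HH' /andP[/HH' -> /IH]; apply.
by move=> h; rewrite !inE !mem_cat => /or3P[->|->|/orP[->|/HH' ->]]; rewrite ?orbT.
Qed.

Lemma linked_cat H rs rs' : linked H rs -> linked (flatten (map hairs_of rs) ++ H) rs' ->
  linked H (rs ++ rs').
Proof.
elim: rs H => //= r rs IH H /andP[-> lr] lr'; apply: IH lr _.
apply: linked_sub lr' => h; rewrite !(inE, mem_cat).
by case: (h == _); case: (h == _); case: (h \in r.2); case: (h \in flatten _); rewrite ?orbT.
Qed.

Lemma linked_all H rs : (forall r, r \in rs -> r.1.*2 \in H) -> linked H rs.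
Proof.
elim: rs H => //= r rs IH H HH; rewrite HH ?mem_head //= IH // => r' rr'.
by rewrite !inE mem_cat HH ?orbT // inE rr' orbT.
Qed.

(** The hub covers the first boundary hair of each side, the side of the first literal of clause [j]
    covers the hair [6 * j + 2], and the first region of the clause covers the hair [6 * j + 4] that
    bounds the second. *)
Lemma regions_linked : linked (hairs_of (hub t)) (behead (regions t cs)).
Proof.
apply: linked_cat.
  apply: linked_all => r /flatten_mapP[i]; rewrite mem_iota => /andP[_ lt_i] ri.
  have -> : r.1.*2 = 6 * i.+1 by move: ri; rewrite !inE => /orP[]/eqP -> /=; lia.
  by rewrite !inE; apply/orP; right; apply/orP; right; apply/hubP; exists i; auto.
set H := _ ++ _.
have HH j : j < size cs -> 6 * j + 2 \in H.
  move=> lt_j; rewrite mem_cat; apply/orP; left.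
  case El: (lit_at cs j 0) => [i b]; have := lit_at_lt lt_j (isT : 0 < 3); rewrite El /= => lt_i.
  apply/flatten_mapP; exists (3 * i.+1, occs (i, b) 0 cs).
    apply/flatten_mapP; exists i; first by rewrite mem_iota.
    by rewrite !inE; case: b {El}; rewrite eqxx ?orbT.
  by rewrite !inE; do 2!(apply/orP; right); apply/occsP; exists j, 0.
have {}HH j : j \in iota 0 (size cs) -> 6 * j + 2 \in H by rewrite mem_iota => /andP[_ /HH].
elim: (iota _ _) H HH => // j s IH H HH.
have E1 : (3 * j + 1).*2 = 6 * j + 2 by lia.
have E2 : (3 * j + 2).*2 = 6 * j + 4 by lia.
rewrite /= E1 HH ?mem_head // E2 !inE eqxx !orbT /= IH // => j' j's.
by rewrite !inE HH ?orbT // inE j's orbT.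
Qed.

End Regions.

Lemma raw_clauses_ok phi c : c \in raw_clauses phi ->
  size c = 3 /\ forall l, l \in c -> l.1 < nvars phi.
Proof.
case/mapP => d _ ->; split; first by rewrite size_map size_tuple.
by move=> l /mapP[l' _ ->] /=.
Qed.

(** * Satisfied formulas give an order of filling *)

Section Satisfied.
Variables (t : nat) (cs : seq (seq literal)) (a : nat -> bool).
Hypothesis cs_ok : forall c, c \in cs -> size c = 3 /\ forall l, l \in c -> l.1 < t.
Hypothesis sat : forall j, j < size cs ->
  exists2 k, k < 3 & a (lit_at cs j k).1 == (lit_at cs j k).2.

Let rs := regions t cs.
Let X := placed 0 rs.
Implicit Types (Ps Qs s : seq (nat * region)).

Lemma ordered_phase Ps s :
  (forall x Qs, x \in s -> {subset Ps <= Qs} -> {subset Qs <= Ps ++ s} -> fillable Qs x.2) ->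
  ordered Ps s.
Proof.
elim: s Ps => //= x s IH Ps H; split.
  by right; apply: H => [|//|y yP]; rewrite ?mem_head // mem_cat yP.
apply: IH => y Qs ys PQ QP; apply: H.
- by rewrite inE ys orbT.
- by move=> z zP; apply: PQ; rewrite inE zP orbT.
by move=> z /QP; rewrite !mem_cat !inE; case: (z == x); case: (z \in Ps).
Qed.

Lemma ordered_cat Ps s s' : ordered Ps s -> (forall Qs, Qs =i s ++ Ps -> ordered Qs s') ->
  ordered Ps (s ++ s').
Proof.
elim: s Ps => [|x s IH] Ps /=; first by move=> _ H; apply: H.
move=> [Hx Hs] H; split=> //; apply: IH => // Qs QE; apply: H => y.
by rewrite QE !(inE, mem_cat) orbCA.
Qed.

Lemma in_use Ps h : reflect (exists2 x, x \in Ps & h \in hairs_of x.2) (h \in hairs_in_use Ps).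
Proof. exact: flatten_mapP. Qed.

(** The only obstruction to a hair is its companion with the same tip, whether in use already or
    covered by the same region. *)
Lemma fillableI Ps (r : region) :
  (forall h h', h \in r.2 -> h' != h -> h'./2 = h./2 -> h' \in hairs_in_use Ps \/ h' \in r.2 ->
     h \in hairs_in_use Ps) -> fillable Ps r.
Proof.
move=> H h hr; case: (boolP (h \in hairs_in_use Ps)) => hP; [by left|right=> h' hh'].
split=> [|h'r]; last first.
  by case: (eqVneq h' h) => // hn; case/negP: hP; apply: H hr hn hh' _; right.
case: (eqVneq h' h) => [-> //|hn]; apply: contra hP => h'P.
by apply: H hr hn hh' _; left.
Qed.

Definition lfalse (l : literal) := a l.1 != l.2.
(** Inverts the numbering of occurrences: the quotient by 6 is the clause, and the remainder is an
    entry of [slots]. *)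
Definition hfalse h := lfalse (lit_at cs (h %/ 6) (index (h %% 6) slots)).

Lemma hfalseE j k : k < 3 -> hfalse (6 * j + nth 0 slots k) = lfalse (lit_at cs j k).
Proof.
move=> k3; have r6 : nth 0 slots k < 6 by case: k k3 => [|[|[|]]].
rewrite /hfalse mulnC divnMDl // modnMDl divn_small // modn_small // addn0.
by rewrite index_uniq.
Qed.

(** The phases of the order: first regions of clauses whose first two literals are false, sides of
    false literals, the hub, second regions, first regions. The sides of true literals that occur in
    a clause remain for the last pass. The first phase precedes the sides because two false literals
    would otherwise bring in the hairs [6 * j + 2] and [6 * j + 3], which share a tip, one after the
    other. *)
Let p1 (x : nat * region) := (x.2.1 %% 3 == 1) && lfalse (lit_at cs (x.2.1 %/ 3) 0)
  && lfalse (lit_at cs (x.2.1 %/ 3) 1).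
Let p2 (x : nat * region) := [&& x.2.1 %% 3 == 0, x.2.1 != 0 & all hfalse x.2.2].
Let p3 (x : nat * region) := x.2.1 == 0.
Let p4 (x : nat * region) := x.2.1 %% 3 == 2.
Let p5 (x : nat * region) := x.2.1 %% 3 == 1.

Lemma div3 q r : r < 3 -> (3 * q + r) %/ 3 = q /\ (3 * q + r) %% 3 = r.
Proof. by move=> r3; rewrite mulnC divnMDl // modnMDl divn_small // modn_small // addn0. Qed.

Lemma specX x : x \in X -> region_spec t cs x.2.
Proof. by move/placed_region/regionsP. Qed.

Lemma spec1 x : x \in X -> p5 x ->
  exists2 j, j < size cs & x.2 = (3 * j + 1, [:: 6 * j + 4]).
Proof.
rewrite /p5 => /specX[|i b lt_i|j lt_j|j lt_j] //=; first by rewrite modnMr.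
  by move=> _; exists j.
by have [_ ->] := div3 j (isT : 2 < 3).
Qed.

Lemma spec2 x : x \in X -> p4 x -> exists2 j, j < size cs & x.2 = (3 * j + 2, [:: 0; 1]).
Proof.
rewrite /p4 => /specX[|i b lt_i|j lt_j|j lt_j] //=; first by rewrite modnMr.
  by have [_ ->] := div3 j (isT : 1 < 3).
by move=> _; exists j.
Qed.

Lemma spec3 x : x \in X -> p3 x -> x.2 = hub t.
Proof. by rewrite /p3 => /specX[|i b lt_i|j lt_j|j lt_j] //= /eqP; (clear; lia). Qed.

Lemma spec0 x : x \in X -> p2 x ->
  exists i b, i < t /\ x.2 = (3 * i.+1, occs (i, b) 0 cs) /\
    forall h, h \in occs (i, b) 0 cs -> hfalse h.
Proof.
rewrite /p2 => xX /and3P[m0 n0 /allP]; move: m0 n0; case: (specX xX) => [|i b lt_i|j lt_j|j lt_j].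
- by [].
- by move=> _ _ H; exists i, b.
- by rewrite /=; have [_ ->] := div3 j (isT : 1 < 3).
by rewrite /=; have [_ ->] := div3 j (isT : 2 < 3).
Qed.

Lemma spec1' x : x \in X -> p1 x -> exists2 j, j < size cs & [/\ x.2 = (3 * j + 1, [:: 6 * j + 4]),
  lfalse (lit_at cs j 0) & lfalse (lit_at cs j 1)].
Proof.
rewrite /p1 => xX /andP[/andP[m1]].
have [j lt_j Ex] := spec1 xX m1; rewrite Ex /=.
by have [-> _] := div3 j (isT : 1 < 3); exists j.
Qed.

Lemma placed_spec r : region_spec t cs r -> exists2 x, x \in X & x.2 = r.
Proof. by move/regionsP/(region_placed 0) => [q qX]; exists (q, r). Qed.

Lemma use_or1 j Qs : j < size cs -> {subset filter p5 X <= Qs} ->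
  6 * j + 2 \in hairs_in_use Qs /\ 6 * j + 3 \in hairs_in_use Qs.
Proof.
move=> lt_j H; have [x xX Ex] := placed_spec (spec_or1 t lt_j).
have xQ : x \in Qs.
  by apply: H; rewrite mem_filter xX /p5 Ex /=; have [_ ->] := div3 j (isT : 1 < 3).
by split; apply/in_use; exists x => //; rewrite Ex !inE /=; apply/orP; [left|right]; (clear; lia).
Qed.

Lemma use_or2 j Qs : j < size cs -> {subset filter p4 X <= Qs} ->
  6 * j + 4 \in hairs_in_use Qs /\ 6 * j + 5 \in hairs_in_use Qs.
Proof.
move=> lt_j H; have [x xX Ex] := placed_spec (spec_or2 t lt_j).
have xQ : x \in Qs.
  by apply: H; rewrite mem_filter xX /p4 Ex /=; have [_ ->] := div3 j (isT : 2 < 3).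
by split; apply/in_use; exists x => //; rewrite Ex !inE /=; apply/orP; [left|right; apply/orP; left]; (clear; lia).
Qed.

Lemma use_hub Qs : {subset filter p3 X <= Qs} -> 0 \in hairs_in_use Qs /\ 1 \in hairs_in_use Qs.
Proof.
move=> H; have [x xX Ex] := placed_spec (spec_hub t cs).
have xQ : x \in Qs by apply: H; rewrite mem_filter xX /p3 Ex.
by split; apply/in_use; exists x => //; rewrite Ex.
Qed.

(** The side of the false literal of the variable belongs to the second phase, and it has the same
    boundary as the other side. *)
Lemma use_var i Qs : i < t -> {subset filter p2 X <= Qs} ->
  6 * i.+1 \in hairs_in_use Qs /\ 6 * i.+1 + 1 \in hairs_in_use Qs.
Proof.
move=> lt_i H; have [x xX Ex] := placed_spec (spec_var cs (~~ a i) lt_i).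
have xQ : x \in Qs.
  apply: H; rewrite mem_filter xX /p2 Ex /= modnMr /= andbT; apply/allP => h.
  move/(occsP cs_ok) => [j [k [lt_j k3 -> El]]]; rewrite hfalseE // El /lfalse /=.
  by case: (a i).
by split; apply/in_use; exists x => //; rewrite Ex !inE /=; apply/orP; [left|right; apply/orP; left]; (clear; lia).
Qed.

Lemma occ_inv i b h : h \in occs (i, b) 0 cs -> exists2 j, j < size cs &
  exists2 k, k < 3 & h = 6 * j + nth 0 slots k.
Proof. by move/(occsP cs_ok) => [j [k [lt_j k3 -> El]]]; exists j => //; exists k. Qed.

Definition fill_order := filter p1 X ++ (filter p2 X ++ (filter p3 X ++ (filter p4 X ++
  (filter p5 X ++ X)))).

Lemma fill_order_mem : fill_order =i X.
Proof.
move=> x; rewrite !mem_cat !mem_filter.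
by case: (x \in X); rewrite ?andbF ?orbT.
Qed.

Lemma phase1 : ordered [::] (filter p1 X).
Proof.
apply: ordered_phase => x Qs; rewrite mem_filter => /andP[px xX] _ QP.
have [j lt_j [Ex _ _]] := spec1' xX px.
apply: fillableI => h h'; rewrite Ex inE /= => /eqP -> hn hh [].
  case/in_use => y /QP; rewrite mem_filter => /andP[py yX].
  have [j' _ [Ey _ _]] := spec1' yX py; rewrite Ey !inE /= => H; exfalso; move: hn hh H; clear; lia.
by rewrite inE (negbTE hn).
Qed.

(** A covered hair is obstructed only by its companion. In the first two slots this requires the
    first two literals of the clause to be false, and then the first phase has brought in both
    hairs. The third slot is where satisfaction is used. *)
Lemma phase2 Ps : {subset filter p1 X <= Ps} -> {subset Ps <= filter p1 X} ->
  ordered Ps (filter p2 X).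
Proof.
move=> P1 P2; apply: ordered_phase => x Qs; rewrite mem_filter => /andP[px xX] PQ QP.
have [i [b [lt_i [Ex fx]]]] := spec0 xX px.
apply: fillableI => h h'; rewrite Ex /= => ho hn hh h'u.
have [j lt_j [k k3 Eh]] := occ_inv ho.
have fh := fx h ho; rewrite Eh hfalseE // in fh.
have both : lfalse (lit_at cs j 0) -> lfalse (lit_at cs j 1) ->
    6 * j + 2 \in hairs_in_use Qs /\ 6 * j + 3 \in hairs_in_use Qs /\ 6 * j + 4 \in hairs_in_use Qs.
  move=> f0 f1; have [y yX Ey] := placed_spec (spec_or1 t lt_j).
  have yQ : y \in Qs.
    apply/PQ/P1; rewrite mem_filter yX /p1 Ey /=.
    by have [-> ->] := div3 j (isT : 1 < 3); rewrite f0 f1.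
  by split; [|split]; apply/in_use; exists y => //; rewrite Ey !inE /=; (clear; lia).
have h'F k' : k' < 3 -> h' = 6 * j + nth 0 slots k' -> lfalse (lit_at cs j k') \/
    (lfalse (lit_at cs j 0) /\ lfalse (lit_at cs j 1)).
  move=> k'3 Eh'; case: h'u => [/in_use[y /QP]|].
    rewrite mem_cat => /orP[/P2|]; rewrite mem_filter => /andP[py yX].
      have [j' _ [Ey f0 f1]] := spec1' yX py; rewrite Ey !inE /= => H.
      right; suff -> : j = j' by [].
      by move: H; rewrite Eh'; case: k' k'3 {Eh'} => [|[|[|]]] //= _; (clear; lia).
    have [i' [b' [_ [Ey fy]]]] := spec0 yX py; rewrite Ey !inE /= => /or3P[/eqP|/eqP|/fy].
    - by rewrite Eh'; case: k' k'3 {Eh'} => [|[|[|]]] //= _; (clear; lia).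
    - by rewrite Eh'; case: k' k'3 {Eh'} => [|[|[|]]] //= _; (clear; lia).
    by rewrite Eh' hfalseE //; left.
  by move/fx; rewrite Eh' hfalseE //; left.
case: k k3 Eh fh => [|[|[|]]] //= _ Eh fh.
- have Eh' : h' = 6 * j + 3 by move: hn hh; rewrite Eh => /eqP; (clear; lia).
  have [f1|[f0 f1]] := h'F 1 isT Eh'; by have [H _] := both fh f1; rewrite Eh.
- have Eh' : h' = 6 * j + 2 by move: hn hh; rewrite Eh => /eqP; (clear; lia).
  have [f0|[f0 f1]] := h'F 0 isT Eh'; by have [_ [H _]] := both f0 fh; rewrite Eh.
have Eh' : h' = 6 * j + 4 by move: hn hh; rewrite Eh => /eqP; (clear; lia).
(* The companion [6 * j + 4] is in use only if the first region of the clause was filled in the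
   first phase, so the first two literals are false; together with the third this would falsify the
   clause. *)
suff [f0 f1] : lfalse (lit_at cs j 0) /\ lfalse (lit_at cs j 1).
  have [k k3 ak] := sat lt_j.
  by case: k k3 ak => [|[|[|]]] //= _ ak; move: f0 f1 fh; rewrite /lfalse ak.
case: h'u => [/in_use[y /QP]|/occ_inv[j' _ [k' k'3]]]; last first.
  by rewrite Eh'; case: k' k'3 => [|[|[|]]] //= _; (clear; lia).
rewrite mem_cat => /orP[/P2|]; rewrite mem_filter => /andP[py yX].
  have [j' _ [Ey f0 f1]] := spec1' yX py; rewrite Ey !inE /= => H.
  by have -> : j = j' by move: H; rewrite Eh'; (clear; lia).
have [i' [b' [_ [Ey _]]]] := spec0 yX py; rewrite Ey !inE /= => /or3P[/eqP|/eqP|/occ_inv[j' _ [k' k'3]]].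
- by rewrite Eh'; (clear; lia).
- by rewrite Eh'; (clear; lia).
by rewrite Eh'; case: k' k'3 => [|[|[|]]] //= _; (clear; lia).
Qed.

(** From the hub on every covered hair is already in use, because it bounds a region filled in an
    earlier phase. *)
Lemma fill_order_ordered : ordered [::] fill_order.
Proof.
have inuse Ps s (Q : nat * region -> Prop) : (forall x, x \in s -> Q x) ->
    (forall x Qs, Q x -> {subset Ps <= Qs} -> {subset s <= s} ->
       forall h, h \in x.2.2 -> h \in hairs_in_use Qs) -> ordered Ps s.
  move=> Hs H; apply: ordered_phase => x Qs xs PQ QP; apply: fillableI => h h' hx _ _ _.
  by apply: (H x) => //; apply: Hs.
apply: ordered_cat; first exact: phase1.
move=> P1 E1; rewrite cats0 in E1.
apply: ordered_cat; first by apply: phase2 => x; rewrite E1.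
move=> P2 E2; apply: ordered_cat.
  apply: (inuse _ _ (fun x => x.2 = hub t)) => [x|x Qs Ex PQ _ h].
    by rewrite mem_filter => /andP[px xX]; apply: spec3.
  rewrite Ex => /hubP[i lt_i H].
  have [|U1 U2] := @use_var i Qs lt_i; last by case: H => ->.
  by move=> y yp; apply: PQ; rewrite E2 mem_cat yp.
move=> P3 E3; apply: ordered_cat.
  apply: (inuse _ _ (fun x => exists j, x.2 = (3 * j + 2, [:: 0; 1]))) => [x|x Qs [j Ex] PQ _ h].
    by rewrite mem_filter => /andP[px xX]; have [j _ Ex] := spec2 xX px; exists j.
  have [|H0 H1] := @use_hub Qs; first by move=> y yp; apply: PQ; rewrite E3 mem_cat yp.
  by rewrite Ex !inE => /orP[]/eqP ->.
move=> P4 E4; apply: ordered_cat.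
  apply: (inuse _ _ (fun x => exists2 j, j < size cs & x.2 = (3 * j + 1, [:: 6 * j + 4])))
    => [x|x Qs [j lt_j Ex] PQ _ h].
    by rewrite mem_filter => /andP[px xX]; have [j lt_j Ex] := spec1 xX px; exists j.
  have [|H0 H1] := @use_or2 j Qs lt_j; first by move=> y yp; apply: PQ; rewrite E4 mem_cat yp.
  by rewrite Ex inE => /eqP ->.
move=> P5 E5.
apply: (inuse _ _ (fun x => region_spec t cs x.2)) => [x|x Qs Ex PQ _ h]; first exact: specX.
have S2 : {subset filter p2 X <= Qs}.
  by move=> y yp; apply: PQ; rewrite E5 mem_cat E4 mem_cat E3 mem_cat E2 mem_cat yp !orbT.
have S3 : {subset filter p3 X <= Qs}.
  by move=> y yp; apply: PQ; rewrite E5 mem_cat E4 mem_cat E3 mem_cat yp !orbT.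
have S4 : {subset filter p4 X <= Qs}.
  by move=> y yp; apply: PQ; rewrite E5 mem_cat E4 mem_cat yp !orbT.
have S5 : {subset filter p5 X <= Qs}.
  by move=> y yp; apply: PQ; rewrite E5 mem_cat yp.
case: Ex => [|i b lt_i|j lt_j|j lt_j] /=.
- case/hubP => i lt_i H; by have [U1 U2] := @use_var i Qs lt_i S2; case: H => ->.
- move/occ_inv => [j lt_j [k k3 ->]].
  have [U2 U3] := use_or1 lt_j S5; have [U4 U5] := use_or2 lt_j S4.
  by case: k k3 => [|[|[|]]].
- by rewrite inE => /eqP ->; case: (use_or2 lt_j S4).
by have [U0 U1] := use_hub S3; rewrite !inE => /orP[]/eqP ->.
Qed.

Lemma satisfied_shellable : shellable (complex_of (coded (tris 0 rs))).
Proof.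
have [l bl lE] : reachable (tris 0 rs).
  apply: (@regions_reachable rs _ _ (hub t) (behead rs) fill_order) => //.
  - by move=> r h; apply: regions_half.
  - by move=> r; apply: regions_uniq.
  - exact: regions_linked.
  - exact: fill_order_mem.
  exact: fill_order_ordered.
have -> : complex_of (coded (tris 0 rs)) = complex_of (coded l).
  by apply/fsetP => s; rewrite !in_complex_of; apply: eq_has_r => f; apply: eq_mem_map => g; rewrite lE.
exact/built_shellable/built_coded.
Qed.

End Satisfied.

Lemma region_private x f : f \in region_tris x.1 x.2 ->
  exists2 v, v \in f & exists2 q, vertex_num v = q.+1 & owns x q.
Proof.
case: x => n [k hs]; rewrite mem_cat /owns /= => /orP[|/blocksP[[i lt_i]|]].
- by rewrite !inE => /orP[]/eqP ->; exists (Ring n); rewrite ?inE ?eqxx ?orbT //;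
    exists n; rewrite // leqnn leq_addr.
- have o1 : n <= n + i <= n + size hs by rewrite leq_addr leq_add2l ltnW.
  have o2 : n <= (n + i).+1 <= n + size hs by rewrite -addnS leq_addr leq_add2l.
  move=> fb; have : has (fun v => [|| v == Ring (n + i), v == Va (n + i).+1, v == Vb (n + i).+1,
      v == Vd (n + i).+1 | v == Ring (n + i).+1]) f.
    move: fb; rewrite !inE => H; do 11?[case/orP: H => [/eqP -> |H]; first by rewrite /= !eqxx ?orbT].
    by move/eqP: H => ->; rewrite /= !eqxx ?orbT.
  case/hasP => v vf H; exists v => //.
  case/orP: H => [/eqP ->|H]; first by exists (n + i).
  by exists (n + i).+1 => //; move: H => /or4P[]/eqP ->.
by rewrite !inE => /orP[]/eqP ->; exists (Ring (n + size hs)); rewrite ?inE ?eqxx ?orbT //;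
  exists (n + size hs); rewrite // leqnn leq_addr.
Qed.

Lemma region_privates x f v q : f \in region_tris x.1 x.2 -> v \in f -> vertex_num v = q.+1 -> owns x q.
Proof.
case: x => n [k hs]; rewrite mem_cat /owns /= => /orP[|/blocksP[[i lt_i]|]].
- by rewrite !inE => /orP[]/eqP ->; rewrite !inE => /or3P[]/eqP -> //= [<-]; rewrite leqnn leq_addr.
- have o1 : n <= n + i <= n + size hs by rewrite leq_addr leq_add2l ltnW.
  have o2 : n <= (n + i).+1 <= n + size hs by rewrite -addnS leq_addr leq_add2l.
  rewrite !inE => H; do 11?[case/orP: H => [/eqP -> |H];
    first by rewrite !inE => /or3P[]/eqP -> //= [<-]].
  by move/eqP: H => ->; rewrite !inE => /or3P[]/eqP -> //= [<-].
by rewrite !inE => /orP[]/eqP ->; rewrite !inE => /or3P[]/eqP -> //= [<-]; rewrite leqnn leq_addr.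
Qed.

(** Every triangle has a vertex that carries an index, and each index is owned by one region. *)
Lemma face_region n rs x y f g : x \in placed n rs -> y \in placed n rs ->
  f \in region_tris x.1 x.2 -> g \in region_tris y.1 y.2 -> face_of f = face_of g -> x = y.
Proof.
move=> xX yX fx gy E; have [v vf [q vq ox]] := region_private fx.
have vg : v \in g by rewrite -in_face_of -E in_face_of.
exact: owns_uniq xX yX ox (region_privates gy vg vq).
Qed.

Lemma nth_placed n rs i d : i < size rs -> (nth (0, d) (placed n rs) i).2 = nth d rs i.
Proof. by elim: rs n i => //= r rs IH n [|i] //= /IH. Qed.

Lemma size_placed n rs : size (placed n rs) = size rs.
Proof. by elim: rs n => //= r rs IH n; rewrite IH. Qed.

Lemma placed_uniq n rs : uniq (placed n rs).
Proof.
elim: rs n => //= r rs IH n; rewrite IH andbT; apply/negP => /placed_ge /=.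
by rewrite leqNgt ltnS leq_addr.
Qed.

(** * Collapsible removals give satisfying assignments *)

Section Refuted.
Variables (t : nat) (cs : seq (seq literal)).
Hypothesis cs_ok : forall c, c \in cs -> size c = 3 /\ forall l, l \in c -> l.1 < t.
Let rs := regions t cs.
Let X := placed 0 rs.
Let L := complex_of (coded (tris 0 rs)).

(** Sides are addressed by position: the hub comes first, and [~~ b] puts the positive literal
    before the negative one. If the variable does not occur, both sides are equal as regions, so the
    region alone would not determine the copy. *)
Definition side_of i (b : bool) : nat * region := nth (0, hub t) X (1 + 2 * i + ~~ b).

Lemma nth_var_regions i b : i < t -> nth (hub t) rs (1 + 2 * i + ~~ b) = (3 * i.+1, occs (i, b) 0 cs).
Proof.
move=> lt_i; rewrite /rs /regions -addnA add1n /= nth_cat.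
have E n m : size (flatten [seq var_regions cs i | i <- iota n m]) = 2 * m.
  by elim: m n => //= m IH n; rewrite IH; lia.
rewrite E ifT; last by case: b; lia.
suff H n m : i < m -> nth (hub t) (flatten [seq var_regions cs i | i <- iota n m]) (2 * i + ~~ b) =
    (3 * (n + i).+1, occs (n + i, b) 0 cs) by rewrite H.
elim: i m n {lt_i E} => [|i IH] [|m] n // lt_i.
  by case: b; rewrite addn0.
have -> : 2 * i.+1 + ~~ b = (2 * i + ~~ b).+2 by lia.
by rewrite /= IH // addSnnS.
Qed.

Lemma side_index i b : i < t -> 1 + 2 * i + ~~ b < size X.
Proof. by move=> lt_i; rewrite size_placed size_regions; case: b => /=; lia. Qed.

Lemma side_in i b : i < t -> side_of i b \in X.
Proof. by move=> lt_i; apply: mem_nth; apply: side_index. Qed.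

Lemma side_region i b : i < t -> (side_of i b).2 = (3 * i.+1, occs (i, b) 0 cs).
Proof.
move=> lt_i; rewrite /side_of nth_placed ?nth_var_regions //.
by rewrite -(size_placed 0); apply: side_index.
Qed.

Lemma side_inj i b j c : i < t -> j < t -> side_of i b = side_of j c -> i = j /\ b = c.
Proof.
move=> lt_i lt_j /eqP; rewrite nth_uniq ?side_index ?placed_uniq // => /eqP.
by case: b; case: c => /=; lia.
Qed.

Variable T : {fset {fset nat}}.
Hypotheses (Tt : #|` T| = t) (cT : collapsible (L `\` T)).

Let region_face (x : nat * region) s := exists2 f, f \in region_tris x.1 x.2 & s = face_of f.

(** A family left untouched by [T] would survive as a subcomplex without free edges in a collapsible
    complex. *)
Lemma core_hits (Us : seq (nat * region)) : {subset Us <= X} -> Us != [::] ->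
  (forall x h, x \in Us -> h./2 = x.2.1 ->
    (exists2 y, y \in Us & h \in y.2.2) \/ (exists2 y, y \in Us & y != x /\ y.2.1 = x.2.1)) ->
  exists x s, [/\ x \in Us, s \in T & region_face x s].
Proof.
move=> UX U0 bd; apply: contrapT => H.
apply: (@core_regions rs Us _ _ UX bd (L `\` T)) => //.
- by move=> r h; apply: regions_half.
- by move=> r; apply: regions_uniq.
- move=> s; rewrite in_fsetD => /andP[_]; apply: complex_card_le.
  exact/coded_triangular/tris_triangular.
move=> f /flatten_mapP[x xU fx]; rewrite in_fsetD fset_of_complex ?andbT; last first.
  by apply: map_f; apply/tris_placed; exists x => //; apply: UX.
by apply/negP => fT; apply: H; exists x, (face_of f); split=> //; exists f.
Qed.

Lemma sphere_hit i : i < t -> exists b s, s \in T /\ region_face (side_of i b) s.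
Proof.
move=> lt_i; have [||x h xU hx|x [s [xU sT sx]]] := @core_hits [:: side_of i true; side_of i false].
- by move=> x; rewrite !inE => /orP[]/eqP ->; apply: side_in.
- by [].
- have ne : side_of i true != side_of i false.
    by apply/eqP => /(side_inj lt_i lt_i)[].
  right; move: xU; rewrite !inE => /orP[]/eqP ->.
    exists (side_of i false); first by rewrite !inE eqxx orbT.
    by rewrite eq_sym ne !side_region.
  exists (side_of i true); first by rewrite !inE eqxx.
  by rewrite ne !side_region.
by move: xU; rewrite !inE => /orP[]/eqP E; subst x; [exists true|exists false]; exists s.
Qed.

(** The [t] spheres have no triangle in common and each needs one of [T]; since [T] has only [t]
    elements, none is left over. *)
Lemma hitting : exists (g : 'I_t -> {fset nat}) (b : 'I_t -> bool),
  (forall i, g i \in T /\ region_face (side_of i (b i)) (g i)) /\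
  (forall s, s \in T -> exists i, s = g i).
Proof.
have /choice[w wP] (i : 'I_t) : exists w : bool * {fset nat},
    w.2 \in T /\ region_face (side_of i w.1) w.2.
  by have [b [s [sT sf]]] := sphere_hit (ltn_ord i); exists (b, s).
exists (fun i => (w i).2), (fun i => (w i).1); split=> // s sT.
have gI : injective (fun i => (w i).2).
  move=> i j E; have [_ [f fi Ef]] := wP i; have [_ [f' fj Ef']] := wP j.
  have := face_region (side_in _ (ltn_ord i)) (side_in _ (ltn_ord j)) fi fj.
  rewrite -Ef -Ef' => /(_ E)/(side_inj (ltn_ord i) (ltn_ord j))[ij _].
  exact: val_inj.
have imT : [fset (w i).2 | i in 'I_t] = T.
  apply/eqP; rewrite eqEfcard card_imfset //= Tt -cardE card_ord leqnn andbT.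
  by apply/fsubsetP => u /imfsetP[i _ ->]; case: (wP i).
by move: sT; rewrite -imT => /imfsetP[i _ ->]; exists i.
Qed.

Lemma removal_satisfies : exists a : nat -> bool, forall j, j < size cs ->
  exists2 k, k < 3 & a (lit_at cs j k).1 == (lit_at cs j k).2.
Proof.
have [g [b [gP gT]]] := hitting.
(* The value of a variable is the side that lost a triangle; indices beyond the variables get an
   arbitrary value. *)
pose a i := if insub i is Some o then b o else true.
have aE (i : 'I_t) : a i = b i by rewrite /a valK.
exists a => j lt_j; apply: contrapT => H.
have fj k : k < 3 -> (lit_at cs j k).2 = ~~ a (lit_at cs j k).1.
  move=> k3; case: (eqVneq (a (lit_at cs j k).1) (lit_at cs j k).2) => [E|].
    by case: H; exists k => //; rewrite E.
  by case: (a _); case: (_.2).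
have [xh hX Eh] : exists2 x, x \in X & x.2 = hub t.
  have /(region_placed 0)[q qX] : hub t \in rs by apply/regionsP; constructor.
  by exists (q, hub t).
have [x1 X1 E1] : exists2 x, x \in X & x.2 = (3 * j + 1, [:: 6 * j + 4]).
  have /(region_placed 0)[q qX] : (3 * j + 1, [:: 6 * j + 4]) \in rs by apply/regionsP; constructor.
  by exists (q, (3 * j + 1, [:: 6 * j + 4])).
have [x2 X2 E2] : exists2 x, x \in X & x.2 = (3 * j + 2, [:: 0; 1]).
  have /(region_placed 0)[q qX] : (3 * j + 2, [:: 0; 1]) \in rs by apply/regionsP; constructor.
  by exists (q, (3 * j + 2, [:: 0; 1])).
(* A closed family: the second region of the clause covers the hub hairs, the first covers one hair
   of the second, the hub covers the boundaries of the unopened sides, and these cover the three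
   slots because all literals of clause [j] are false. *)
pose Us := [:: xh; x1; x2] ++ [seq side_of i (~~ a i) | i <- iota 0 t].
have sideU i : i < t -> side_of i (~~ a i) \in Us.
  by move=> lt_i; rewrite mem_cat; apply/orP; right; apply/mapP; exists i; rewrite ?mem_iota.
have occU k : k < 3 -> exists2 y, y \in Us & 6 * j + nth 0 slots k \in y.2.2.
  move=> k3; have lt_i := lit_at_lt cs_ok lt_j k3.
  exists (side_of (lit_at cs j k).1 (~~ a (lit_at cs j k).1)); first exact: sideU.
  rewrite side_region //; apply/(occsP cs_ok); exists j, k; split=> //.
  by rewrite -fj //; case: (lit_at cs j k).
have UX : {subset Us <= X}.
  move=> x; rewrite mem_cat => /orP[|/mapP[i]]; first by rewrite !inE => /or3P[]/eqP ->.
  by rewrite mem_iota => /andP[_ lt_i] ->; apply: side_in.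
have half_cases h k : h./2 = k -> h = k.*2 \/ h = k.*2.+1.
  by rewrite -{2 3}(odd_double_half h) => ->; case: (odd h); [right|left].
have [|x h xU /half_cases hx|x [s [xU sT sx]]] := core_hits UX => //.
  left; move: xU; rewrite mem_cat => /orP[|/mapP[i]].
    rewrite !inE => /or3P[]/eqP E; move: hx; rewrite {}E.
    - rewrite Eh /= => H2; exists x2; first by rewrite !inE eqxx !orbT.
      by rewrite E2 !inE; case: H2 => ->.
    - rewrite E1 /= => -[->|->].
        by have [y yU yh] := occU 0 isT; exists y => //; rewrite (_ : (_).*2 = 6 * j + 2) //; clear; lia.
      by have [y yU yh] := occU 1 isT; exists y => //; rewrite (_ : (_).*2.+1 = 6 * j + 3) //; clear; lia.
    rewrite E2 /= => -[->|->].
      exists x1; first by rewrite !inE eqxx !orbT.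
      by rewrite E1 !inE /=; apply/eqP; clear; lia.
    by have [y yU yh] := occU 2 isT; exists y => //; rewrite (_ : (_).*2.+1 = 6 * j + 5) //; clear; lia.
  rewrite mem_iota => /andP[_ lt_i] E; move: hx; rewrite {}E side_region //= => H2.
  exists xh; first by rewrite !inE eqxx.
  rewrite Eh; apply/hubP; exists i => //.
  by case: H2 => ->; [left|right]; clear; lia.
have [i Es] := gT s sT; have [_ gi] := gP i.
have Ex : x = side_of i (b i).
  case: sx => f fx Ef; case: gi => f' fi Ef'.
  by apply: (face_region (UX x xU) (side_in _ (ltn_ord i)) fx fi); rewrite -Ef -Ef'.
move: xU; rewrite mem_cat => /orP[|/mapP[i']].
  rewrite !inE => /or3P[]/eqP E; have := side_region (b i) (ltn_ord i); rewrite -Ex E.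
  - by rewrite Eh.
  - by rewrite E1 => -[]; clear; lia.
  by rewrite E2 => -[]; clear; lia.
rewrite mem_iota => /andP[_ lt_i'] E; move: Ex; rewrite E => /(side_inj lt_i' (ltn_ord i))[Ei].
by rewrite Ei aE; case: (b i).
Qed.

End Refuted.

(** * Connectedness *)

Section Connected.
Variable rs : seq region.
Let L := tris 0 rs.
Let K := complex_of (coded L).
Let R x := reach K (code Apex) (code x).

Lemma reach_face f x y : f \in L -> x \in f -> y \in f -> R x -> R y.
Proof.
move=> fL xf yf Rx; apply: reach_trans Rx _; apply: reach1.
by rewrite in_complex_edge edge_in_coded; apply/hasP; exists f; rewrite // xf yf.
Qed.

Lemma reach_tris f x : f \in L -> x \in f -> R x.
Proof.
have R0 : R Apex by exact: reach_refl.
have R0' g y : g \in L -> y \in g -> Apex \in g -> R y.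
  by move=> gL yg Ag; apply: reach_face gL Ag yg R0.
case/trisP => [[q [k [hk]]]|[q [k [hk]]]|[q [k [h [hk]]]]].
- have H i : i < 2 -> nth [::] (header k q) i \in L.
    by move=> i2; apply: (header_tris hk); apply: mem_nth.
  have RM : R (Mid k.*2) by apply: (R0' _ _ (H 0 isT)); rewrite !inE eqxx ?orbT.
  rewrite !inE => /orP[]/eqP -> xf; first by apply: (R0' _ _ (H 0 isT)).
  by apply: (reach_face (H 1 isT) _ xf RM); rewrite !inE eqxx ?orbT.
- have H i : i < 2 -> nth [::] (footer k q) i \in L.
    by move=> i2; apply: (footer_tris hk); apply: mem_nth.
  have RM : R (Mid k.*2.+1) by apply: (R0' _ _ (H 0 isT)); rewrite !inE eqxx ?orbT.
  rewrite !inE => /orP[]/eqP -> xf; first by apply: (R0' _ _ (H 0 isT)).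
  by apply: (reach_face (H 1 isT) _ xf RM); rewrite !inE eqxx ?orbT.
have H i : i < 12 -> nth [::] (block k q h) i \in L.
  by move=> i2; apply: (block_in_tris hk); apply: mem_nth.
have Rp : R (Ring q) by apply: (R0' _ _ (H 0 isT)); rewrite !inE eqxx ?orbT.
have Rm : R (Mid h) by apply: (R0' _ _ (H 0 isT)); rewrite !inE eqxx ?orbT.
have Rz : R (Ring q.+1) by apply: (R0' _ _ (H 10 isT)); rewrite !inE eqxx ?orbT.
have Rb : R (Vb q.+1) by apply: (reach_face (H 8 isT) _ _ Rm); rewrite !inE eqxx ?orbT.
have Rd : R (Vd q.+1) by apply: (reach_face (H 9 isT) _ _ Rz); rewrite !inE eqxx ?orbT.
move=> fb xf; have : has (fun y => y \in f) [:: Ring q; Mid h; Ring q.+1; Vb q.+1; Vd q.+1].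
  move: fb; rewrite !inE => F; do 11?[case/orP: F => [/eqP -> |F]; first by rewrite /= !inE !eqxx ?orbT].
  by move/eqP: F => ->; rewrite /= !inE !eqxx ?orbT.
case/hasP => y yl yf; apply: (reach_face (block_in_tris hk fb) yf xf).
by move: yl; rewrite !inE => /or4P[/eqP ->|/eqP ->|/eqP ->|/orP[]/eqP ->].
Qed.

Lemma tris_connected : connected K.
Proof.
have RA v : v \in vertices K -> reach K (code Apex) v.
  rewrite in_vertices; last exact: complex_of_simplicial.
  rewrite in_complex_vertex => /vertex_in_ex[x -> /hasP[f fL xf]]; exact: reach_tris fL xf.
by move=> u v /RA Ru /RA Rv; apply: reach_trans Rv; apply: reach_sym.
Qed.

End Connected.

Lemma lit_at_raw phi j k : lit_at (raw_clauses phi) j k =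
  nth (0, true) [seq (nat_of_ord l.1, l.2) | l <- nth [::] [seq tval c | c <- clauses phi] j] k.
Proof.
rewrite /lit_at /raw_clauses; case: (ltnP j (size (clauses phi))) => lt_j.
  by case: (clauses phi) lt_j => // c s lt_j; rewrite !(nth_map c).
by rewrite !nth_default ?size_map.
Qed.

Lemma satisfiable_raw phi : satisfiable phi <-> exists a : nat -> bool,
  forall j, j < size (raw_clauses phi) ->
  exists2 k, k < 3 & a (lit_at (raw_clauses phi) j k).1 == (lit_at (raw_clauses phi) j k).2.
Proof.
split=> [[a /allP sat]|[a sat]].
  exists (fun i => if insub i is Some o then a o else true) => j; rewrite size_map => lt_j.
  have [c0] : exists c, c \in clauses phi by case: (clauses phi) lt_j => // c s; exists c; rewrite mem_head.
  have := sat _ (mem_nth c0 lt_j); set c := nth c0 _ j => /hasP[l lc al] _.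
  exists (index l c); first by have := index_mem l c; rewrite lc size_tuple.
  rewrite lit_at_raw (nth_map c0) // -/c (nth_map l) ?index_mem // nth_index //=.
  by rewrite valK.
exists [ffun i => a (nat_of_ord i)]; apply/allP => c /(nthP c)[j lt_j Ec].
have [|k k3] := sat j; first by rewrite size_map.
rewrite lit_at_raw (nth_map c) // Ec; have kc : k < size c by rewrite size_tuple.
have [l0 _] : exists l, l \in tval c by case: (tval c) kc => // l s _; exists l; rewrite mem_head.
rewrite (nth_map l0) //= => E.
by apply/hasP; exists (nth l0 c k); [exact: mem_nth|rewrite ffunE].
Qed.

(** * The equivalences for the complex of a formula *)

Section Reduction.
Variable phi : cnf3.
Let t := nvars phi.
Let cs := raw_clauses phi.
Let rs := regions t cs.
Let L := complex_of (coded (tris 0 rs)).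

Lemma reduction :
  let n := #|` vertices L| in
  [/\ simplicial L, pure L & dimension L = 2%R] /\
  [/\ connected L,
      reduced_euler L = (t%:Z)%R &
      [<-> satisfiable phi;
           shellable L;
           exists T, [/\ T `<=` faces L 2, #|` T| = t & collapsible (L `\` T)];
           wsat (skeleton 1 L) K3 = n - 1;
           exists2 T, T `<=` faces L 2 & collapsible (L `\` T)]].
Proof.
move=> n; have cs_ok := @raw_clauses_ok phi.
have tri := coded_triangular (@tris_triangular 0 rs).
have sL : simplicial L by exact: complex_of_simplicial.
have pL : pure L by exact: complex_pure.
have dL : dimension L = 2%R by exact: complex_dim.
have cL : connected L by exact: tris_connected.
have eL : (euler L = t%:Z)%R.
  rewrite euler_coded euler_region_complex.
  - by rewrite size_regions size_region_tips; lia.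
  - by rewrite size_regions; lia.
  - by move=> r h; apply: regions_half.
  - by move=> r; apply: regions_uniq.
  by move=> r h; apply: regions_tips.
have L3 s : s \in L -> #|` s| <= 3 by exact: complex_card_le.
have L0 : vertices L != fset0.
  apply/fset0Pn; exists (code Apex); rewrite in_vertices // in_complex_vertex vertex_in_coded.
  by apply/hasP; exists [:: Apex; Mid 0; Ring 0]; rewrite ?inE ?eqxx.
do 2!split=> //; first by rewrite reduced_eulerE.
tfae.
- by move/satisfiable_raw => [a sat]; apply: satisfied_shellable sat.
- by move=> sh; apply: shellable_removal.
- by case=> T [TL _ cT]; exact: (removal_wsat sL L3 cL L0 TL cT).
- apply: wsat_removal => // x y w xy yw xw; apply: (@coded_flag rs) => // k hs h r hr.
  exact: (regions_half cs_ok r hr).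
case=> T TL cT; apply/satisfiable_raw.
(* The Euler characteristic shows that exactly [t] triangles were removed, as [removal_satisfies]
   requires. *)
have := removal_card sL dL TL cT; rewrite eL => -[Tt].
exact: (removal_satisfies cs_ok (esym Tt) cT).
Qed.

End Reduction.

(** * Stack programs on Turing machines *)

Inductive cmd : Type :=
  | Push of nat & bool
  | Pop of nat
  | Seq of cmd & cmd
  | If of nat & (option bool -> bool) & cmd & cmd
  | While of nat & (option bool -> bool) & cmd.

(** The control points inside a command. [Push] has two because the head first moves to a free cell
    and then writes; [If] and [While] have an additional point [None] for their test. *)
Fixpoint locus (c : cmd) : finType :=
  match c with
  | Push _ _ => bool : finType
  | Pop _ => unit : finType
  | Seq a b => (locus a + locus b)%type : finType
  | If _ _ a b => option (locus a + locus b) : finType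
  | While _ _ a => option (locus a) : finType
  end.

Fixpoint entry (c : cmd) : locus c :=
  match c with
  | Push _ _ => false
  | Pop _ => tt
  | Seq a b => inl (entry a)
  | If _ _ _ _ => None
  | While _ _ _ => None
  end.

Definition stack_state := nat -> seq bool.
Implicit Types (sg : stack_state).

Definition upd sg r s : stack_state := fun i => if i == r then s else sg i.

Section Compile.
Variable m : nat.
Definition cell : Type := option (bool + void).
Implicit Types (p : option bool -> bool) (rd : {ffun 'I_m.+1 -> cell}) (tp : {ffun 'I_m.+1 -> tape (bool + void)}).

Definition bit (x : cell) : option bool := if x is Some (inl b) then Some b else None.

Definition idle rd : {ffun 'I_m.+1 -> cell * move} := [ffun i => (rd i, Stay)].

(* The second component of a transition result is None when the command is left. *)
Fixpoint trans (c : cmd) :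
    locus c -> {ffun 'I_m.+1 -> cell} -> option (locus c) * {ffun 'I_m.+1 -> cell * move} :=
  match c with
  | Push r b => fun q rd =>
      if q then (None, [ffun i => (if val i == r then Some (inl b) else rd i, Stay)])
      else (Some true, [ffun i => (rd i, if val i == r then Left else Stay)])
  | Pop r => fun _ rd => (None, [ffun i => (rd i, if val i == r then Right else Stay)])
  | Seq a b => fun q rd =>
      match q with
      | inl q => let: (o, x) := trans q rd in
          (Some (if o is Some q' then inl q' else inr (entry b)), x)
      | inr q => let: (o, x) := trans q rd in (omap inr o, x)
      end
  | If r p a b => fun q rd =>
      match q with
      | None => (Some (Some (if p (bit (rd (inord r))) then inl (entry a) else inr (entry b))),
                 idle rd)
      | Some (inl q) => let: (o, x) := trans q rd in (omap (fun q => Some (inl q)) o, x)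
      | Some (inr q) => let: (o, x) := trans q rd in (omap (fun q => Some (inr q)) o, x)
      end
  | While r p a => fun q rd =>
      match q with
      | None => (if p (bit (rd (inord r))) then Some (Some (entry a)) else None, idle rd)
      | Some q => let: (o, x) := trans q rd in (Some o, x)
      end
  end.

Definition act (x : {ffun 'I_m.+1 -> cell * move}) tp : {ffun 'I_m.+1 -> tape (bool + void)} :=
  [ffun i => tape_move (x i).2 (tape_write (x i).1 (tp i))].

Definition scan tp : {ffun 'I_m.+1 -> cell} := [ffun i => tape_head (tp i)].

Definition advance c (x : option (locus c) * {ffun 'I_m.+1 -> tape (bool + void)}) :=
  if x.1 is Some q then let: (o, y) := trans q (scan x.2) in (o, act y x.2) else x.

(* The head scans the top of the stack; what lies to its left is irrelevant. *)
Definition holds_stack (t : tape (bool + void)) (s : seq bool) :=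
  forall i, nth None (tape_head t :: tape_right t) i = nth None [seq Some (inl b) | b <- s] i.

Definition holds tp sg := forall i : 'I_m.+1, holds_stack (tp i) (sg i).

Variant transforms c sg sg' n : Prop := Transforms of forall tp, holds tp sg ->
  exists k tp', [/\ k <= n, iter k (@advance c) (Some (entry c), tp) = (None, tp') & holds tp' sg'].

(** A run of a part is a run of the whole up to the moment the part is left. The lifted run may be
    shorter because a finished part idles while the whole goes on. *)
Lemma advance_lift c c' (f : locus c -> locus c') e :
  (forall q rd, trans (f q) rd =
     (if (trans q rd).1 is Some q' then Some (f q') else e, (trans q rd).2)) ->
  forall k q tp tp', iter k (@advance c) (Some q, tp) = (None, tp') ->
  exists2 k', k' <= k & iter k' (@advance c') (Some (f q), tp) = (e, tp').
Proof.
move=> fE; elim=> [|k IH] q tp tp'; first by [].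
rewrite iterSr {2}/advance /=; case E: (trans q (scan tp)) => [[q'|] x].
  case/IH => k' k'k E'; exists k'.+1 => //.
  by rewrite iterSr {2}/advance /= fE E.
move=> H; exists 1 => //; rewrite /= /advance /= fE E /=.
suff E' : iter k (@advance c) (None, act x tp) = (None, act x tp) by move: H; rewrite E' => -[->].
by elim: k {IH H} => //= k ->.
Qed.

(** States are functions on all numbers, but only the stacks up to [m] exist as tapes. *)
Lemma holds_eq tp sg sg' : (forall i, i <= m -> sg i = sg' i) -> holds tp sg -> holds tp sg'.
Proof. by move=> E H i; rewrite -E ?H // -ltnS. Qed.

Lemma computes_eq c sg sg1 sg' sg1' n n' : transforms c sg sg' n ->
  (forall i, i <= m -> sg1 i = sg i) -> (forall i, i <= m -> sg' i = sg1' i) -> n <= n' ->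
  transforms c sg1 sg1' n'.
Proof.
case=> H E E' nn; constructor=> tp htp; have [k [tp' [kn Ek hk]]] := H tp (holds_eq E htp).
by exists k, tp'; split=> //; [exact: leq_trans nn|exact: holds_eq hk].
Qed.

Lemma computes_push sg r b : transforms (Push r b) sg (upd sg r (b :: sg r)) 2.
Proof.
constructor=> tp htp; set x := iter 2 (@advance (Push r b)) (Some false, tp).
exists 2, x.2; split=> // i; rewrite /x /= /advance /= /act !ffunE /upd.
have := htp i; case: (tp i) => l a s /= H; case: eqP => [Er|_] //= [|j] //=.
by rewrite -Er.
Qed.

Lemma computes_pop sg r : transforms (Pop r) sg (upd sg r (behead (sg r))) 1.
Proof.
constructor=> tp htp; set x := iter 1 (@advance (Pop r)) (Some tt, tp).
exists 1, x.2; split=> // i; rewrite /x /= /advance /= /act !ffunE /upd.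
have := htp i; case: (tp i) => l a s /= H; case: eqP => [Er|_] //= j.
have -> : nth None (head None s :: behead s) j = nth None s j.
  by case: s {H} => [|? ?] //; case: j => //= j; rewrite nth_nil.
have := H j.+1; rewrite -Er /= => ->.
by case: (sg _) => //=; case: j.
Qed.

Lemma computes_seq a b sg1 sg2 sg3 n1 n2 : transforms a sg1 sg2 n1 -> transforms b sg2 sg3 n2 ->
  transforms (Seq a b) sg1 sg3 (n1 + n2).
Proof.
move=> [Ha] [Hb]; constructor=> tp /Ha[k1 [tp2 [kn1 E1 /Hb[k2 [tp3 [kn2 E2 h3]]]]]].
have [|k1' kk1 E1'] := @advance_lift a (Seq a b) inl (Some (inr (entry b))) _ _ _ _ _ E1.
  by move=> q rd /=; case: (trans q rd) => -[q'|] x.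
have [|k2' kk2 E2'] := @advance_lift b (Seq a b) inr None _ _ _ _ _ E2.
  by move=> q rd /=; case: (trans q rd) => -[q'|] x.
exists (k2' + k1'), tp3; split=> //; first by lia.
by rewrite iterD E1' E2'.
Qed.

Lemma bit_scan tp sg r : holds tp sg -> r <= m -> bit (scan tp (inord r)) = ohead (sg r).
Proof.
move=> htp rm; rewrite ffunE; have := htp (inord r) 0; rewrite inordK //=.
by case: (tp _) => l a s /= ->; case: (sg r).
Qed.

Lemma act_idle tp : act (idle (scan tp)) tp = tp.
Proof. by apply/ffunP => i; rewrite !ffunE /=; case: (tp i). Qed.

Lemma computes_if r p a b sg sg' n : r <= m ->
  (if p (ohead (sg r)) then transforms a sg sg' n else transforms b sg sg' n) ->
  transforms (If r p a b) sg sg' n.+1.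
Proof.
move=> rm H; constructor=> tp htp.
have E1 : advance (Some None : option (locus (If r p a b)), tp) =
    (Some (Some (if p (ohead (sg r)) then inl (entry a) else inr (entry b))), tp).
  by rewrite /advance /= (bit_scan htp rm) act_idle.
case: ifP H E1 => _ [/(_ tp htp)][k [tp' [kn E h']]] E1.
  have [|k' kk E'] := @advance_lift a (If r p a b) (fun q => Some (inl q)) None _ _ _ _ _ E.
    by move=> q rd /=; case: (trans q rd) => -[q'|] x.
  by exists k'.+1, tp'; split=> //; [lia|rewrite iterSr E1].
have [|k' kk E'] := @advance_lift b (If r p a b) (fun q => Some (inr q)) None _ _ _ _ _ E.
  by move=> q rd /=; case: (trans q rd) => -[q'|] x.
by exists k'.+1, tp'; split=> //; [lia|rewrite iterSr E1].
Qed.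

Lemma computes_then r p a b sg sg' n : r <= m -> p (ohead (sg r)) ->
  transforms a sg sg' n -> transforms (If r p a b) sg sg' n.+1.
Proof. by move=> rm pr H; apply: computes_if; rewrite ?pr. Qed.

Lemma computes_else r p a b sg sg' n : r <= m -> ~~ p (ohead (sg r)) ->
  transforms b sg sg' n -> transforms (If r p a b) sg sg' n.+1.
Proof. by move=> rm /negbTE pr H; apply: computes_if; rewrite ?pr. Qed.

Lemma computes_exit r p a sg : r <= m -> ~~ p (ohead (sg r)) -> transforms (While r p a) sg sg 1.
Proof.
move=> rm np; constructor=> tp htp; exists 1, tp; split=> //.
by rewrite /= /advance /= (bit_scan htp rm) (negbTE np) act_idle.
Qed.

Lemma computes_turn r p a sg1 sg2 sg3 n1 n2 : r <= m -> p (ohead (sg1 r)) ->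
  transforms a sg1 sg2 n1 -> transforms (While r p a) sg2 sg3 n2 ->
  transforms (While r p a) sg1 sg3 (n1 + n2).+1.
Proof.
move=> rm pr [Ha] [Hw]; constructor=> tp htp; have [k1 [tp2 [kn1 E1 /Hw[k2 [tp3 [kn2 E2 h3]]]]]] := Ha tp htp.
have [|k1' kk1 E1'] := @advance_lift a (While r p a) Some (Some None) _ _ _ _ _ E1.
  by move=> q rd /=; case: (trans q rd) => -[q'|] x.
exists (k2 + k1').+1, tp3; split=> //; first by lia.
rewrite iterSr {2}/advance /= (bit_scan htp rm) pr act_idle.
by rewrite iterD E1' E2.
Qed.

Lemma computes_loop r p a (sg : nat -> stack_state) n k : r <= m ->
  (forall i, i < k -> p (ohead (sg i r)) /\ transforms a (sg i) (sg i.+1) n) ->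
  ~~ p (ohead (sg k r)) -> transforms (While r p a) (sg 0) (sg k) (k * n.+1).+1.
Proof.
move=> rm; elim: k sg => [|k IH] sg H pk; first exact: computes_exit.
have [p0 c0] := H 0 isT; rewrite mulSn.
apply: (@computes_eq _ (sg 0) _ (sg k.+1) _ (n + (k * n.+1).+1).+1) => //; last by lia.
by apply: (computes_turn rm p0 c0); apply: (IH (fun i => sg i.+1)) => // i ik; apply: H.
Qed.

Definition stack_machine (c : cmd) : machine :=
  @Machine (option (locus c)) void m (Some (entry c)) (fun q => q == None)
    (fun q rd => if q is Some q then trans q rd else (None, idle rd)).

Lemma stack_machine_step c x : @step (stack_machine c) x = @advance c x.
Proof.
by case: x => [[q|] tp].
Qed.

Lemma stack_machine_outputs c w v sg n :
  transforms c (fun i => if i == 0 then w else [::]) sg n -> sg m = v ->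
  outputs_within (stack_machine c) n w v.
Proof.
move=> [Hc] Ev; rewrite /outputs_within.
have [|k [tp [kn Ek h]]] := Hc (init (stack_machine c) w).2.
  move=> i; rewrite /init /= ffunE; have -> : (i == ord0) = (val i == 0) by [].
  by case: eqP => _ [|j]; case: w {Hc} => [|? ?] //=; case: j.
have E : iter n (@step (stack_machine c)) (init (stack_machine c) w) = (None, tp).
  rewrite -(subnK kn) iterD.
  have -> : iter k (@step (stack_machine c)) (init (stack_machine c) w) = (None, tp).
    by rewrite -Ek; elim: k {kn Ek} => //= k ->; rewrite stack_machine_step.
  by elim: (n - k) => //= j ->.
rewrite E; split=> //=; rewrite /word_of_tape.
have := h ord_max; rewrite /= Ev; case: (tp ord_max) => l a s /= {}h.
suff H (u : seq cell) : (forall i, nth None u i = nth None [seq Some (inl b) | b <- v] i) ->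
    @read_word (stack_machine c) u = v by exact: (H (a :: s) h).
elim: v u {Ev h} => [|b v IH] [|x u] H //=.
- by have := H 0; rewrite /= => ->.
- by have := H 0.
by have := H 0; rewrite /= => ->; congr cons; apply: IH => i; exact: (H i.+1).
Qed.

End Compile.

(** * The program of the reduction *)

(** [SAVE] receives the consumed input in reverse. The number of variables is held in [VARS] before
    the hub is written and in [LEFT] after it. [VI], [CJ] and [CELL] are the current variable,
    clause and ring index, [TMP] preserves a counter while it is read, and [FLAG] records whether a
    literal still matches. *)
Notation IN := 0 (only parsing).
Notation SAVE := 1 (only parsing).
Notation VARS := 2 (only parsing).
Notation LEFT := 3 (only parsing).
Notation VI := 4 (only parsing).
Notation CJ := 5 (only parsing).
Notation CELL := 6 (only parsing).
Notation TMP := 7 (only parsing).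
Notation FLAG := 8 (only parsing).
Notation OUT := 9 (only parsing).

(* Counters are kept in unary. *)
Definition conf (inp sv : seq bool) (t l i j n tmp : nat) (fl : bool) (out : seq bool) : stack_state :=
  fun r => match r with
  | IN => inp | SAVE => sv | VARS => nseq t true | LEFT => nseq l true
  | VI => nseq i true | CJ => nseq j true | CELL => nseq n true | TMP => nseq tmp true
  | FLAG => nseq fl true | _ => out
  end.

Ltac regs := let r := fresh "r" in move=> r /=; do 10?[case: r => [|r] //=]; by [].

Notation computes := (@transforms 9).

Lemma computes_le c sg sg' n n' : computes c sg sg' n -> n <= n' -> computes c sg sg' n'.
Proof. by move=> H nn; apply: computes_eq H _ _ nn. Qed.

Definition tops (x : option bool) : bool := x == Some true.
Definition skip := While 0 xpred0 (Pop 0).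

Lemma computes_skip sg : computes skip sg sg 1.
Proof. exact: computes_exit. Qed.

Definition pushes k r b := iter k (Seq (Push r b)) skip.

Lemma computes_pushes k r b sg : computes (pushes k r b) sg (upd sg r (nseq k b ++ sg r)) (2 * k).+1.
Proof.
elim: k sg => [|k IH] sg.
  by apply: (computes_eq (computes_skip sg)) => // i _; rewrite /upd; case: eqP => [->|].
have H := computes_seq (@computes_push 9 sg r b) (IH _).
apply: (computes_eq H) => //; last by lia.
move=> i _; rewrite /upd eqxx; case: eqP => // _.
by rewrite -cat_rcons; congr cat; elim: k {IH H} => //= k ->.
Qed.

(** The counter moves to [TMP] and back, and [k] marks are written for each unit. Successive copies
    onto [OUT] write a linear form in unary without any arithmetic. *)
Definition copy x k :=
  Seq (While x tops (Seq (Pop x) (Seq (Push TMP true) (pushes k OUT true))))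
      (While TMP tops (Seq (Pop TMP) (Push x true))).

Lemma computes_copy x k n sg : x <= 9 -> x != TMP -> x != OUT -> sg x = nseq n true ->
  sg TMP = [::] ->
  computes (copy x k) sg (upd sg OUT (nseq (k * n) true ++ sg OUT)) (n * (2 * k + 9) + 2).
Proof.
move=> x9 xT xO Ex ET.
(* [f] and [g] are the states after [i] rounds of the first and of the second loop. *)
pose f i := upd (upd (upd sg x (nseq (n - i) true)) TMP (nseq i true)) OUT (nseq (k * i) true ++ sg OUT).
pose g i := upd (upd (upd sg x (nseq i true)) TMP (nseq (n - i) true)) OUT (nseq (k * n) true ++ sg OUT).
have F : computes (While x tops (Seq (Pop x) (Seq (Push TMP true) (pushes k OUT true))))
    (f 0) (f n) (n * (1 + (2 + (2 * k).+1)).+1).+1.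
  apply: computes_loop => // [i lt_i|]; last first.
    by rewrite /f /upd (negbTE xT) (negbTE xO) eqxx subnn.
  split; first by rewrite /f /upd (negbTE xT) (negbTE xO) eqxx -(subnSK lt_i).
  have H := computes_seq (@computes_pop 9 (f i) x)
    (computes_seq (@computes_push 9 _ TMP true) (computes_pushes k OUT true _)).
  apply: (computes_eq H) => // r _; rewrite /f /upd /= eqxx.
  case: (eqVneq r OUT) => [_|rO].
    by rewrite eq_sym (negbTE xO) catA -nseqD mulnS.
  case: (eqVneq r TMP) => [_|rT]; first by rewrite eq_sym (negbTE xT).
  case: (eqVneq r x) => // _; rewrite (negbTE xT) (negbTE xO).
  by rewrite -(subnSK lt_i).
have G : computes (While TMP tops (Seq (Pop TMP) (Push x true))) (g 0) (g n) (n * (1 + 2).+1).+1.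
  apply: computes_loop => // [i lt_i|]; last by rewrite /g /upd /= subnn.
  split; first by rewrite /g /upd /= -(subnSK lt_i).
  have H := computes_seq (@computes_pop 9 (g i) TMP) (@computes_push 9 _ x true).
  apply: (computes_eq H) => // r _; rewrite /g /upd /= eqxx (negbTE xT) (negbTE xO).
  case: (eqVneq r x) => [->|rx]; first by rewrite (negbTE xT) (negbTE xO).
  case: (eqVneq r OUT) => [-> //|_]; case: (eqVneq r TMP) => // _.
  by rewrite -(subnSK lt_i).
have fg r : r <= 9 -> f n r = g 0 r.
  rewrite /f /g /upd subnn subn0; case: eqP => // _; case: eqP => // _; case: eqP => //.
apply: (computes_eq (computes_seq F (computes_eq G fg (fun _ _ => erefl) (leqnn _)))).
- move=> r _; rewrite /f /upd muln0 subn0; case: eqP => [-> //|_].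
  by case: eqP => [-> //|_]; case: eqP => [->|].
- move=> r _; rewrite /g /upd subnn; case: eqP => // _.
  by case: eqP => [-> //|_]; case: eqP => [->|].
by lia.
Qed.

(** The coefficients of the current variable, clause and ring index, and a constant term. Every
    vertex code to be written is of this form. *)
Definition linform : Type := (nat * nat * nat * nat)%type.
Definition value (i j n : nat) (d : linform) : nat :=
  let: (a, b, c, r) := d in a * i + b * j + c * n + r.

Arguments value : simpl never.

(** A stack is written back to front: the end mark [false] of the unary number comes first, and the
    mark [true] that announces a list entry comes last. *)
Definition emit_vertex (d : linform) :=
  let: (a, b, c, r) := d in
  Seq (Push OUT false) (Seq (pushes r OUT true) (Seq (copy CELL c) (Seq (copy CJ b)
    (Seq (copy VI a) (Push OUT true))))).

Fixpoint emit_face (f : seq linform) :=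
  if f is d :: f' then Seq (emit_face f') (emit_vertex d) else Push OUT false.

(* Each triangle is pushed in front of the previous ones, so that the output
   lists the triangles in the reverse order of their emission. *)
Fixpoint emit (l : seq (seq linform)) :=
  if l is f :: l' then Seq (Seq (emit_face f) (Push OUT true)) (emit l') else skip.

Section Emit.
Variables (inp sv : seq bool) (t l i j n : nat) (fl : bool) (W : nat).
Hypothesis bound : [/\ i <= W, j <= W & n <= W].
Let st := conf inp sv t l i j n 0 fl.

Definition vertex_cost (d : linform) := let: (a, b, c, r) := d in 2 * (a + b + c + r) + 40.

Lemma emit_vertexP d out :
  computes (emit_vertex d) (st out) (st (true :: enc_nat (value i j n d) ++ out)) (vertex_cost d * W.+1).
Proof.
case: d => [[[a b] c] r]; have [iW jW nW] := bound.
have C1 := @computes_push 9 (st out) OUT false.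
have C2 := computes_pushes r OUT true (st (false :: out)).
have C3 o := @computes_copy CELL c n (st o) isT isT isT erefl erefl.
have C4 o := @computes_copy CJ b j (st o) isT isT isT erefl erefl.
have C5 o := @computes_copy VI a i (st o) isT isT isT erefl erefl.
have C6 o := @computes_push 9 (st o) OUT true.
have U o o' : forall q, q <= 9 -> upd (st o) OUT o' q = st o' q.
  by move=> q; do 9?[case: q => [|q] //]; case: q.
have E c' o o' o'' k : computes c' (st o) (upd (st o'') OUT o') k -> computes c' (st o) (st o') k.
  by move=> H; apply: (computes_eq H) => //; apply: U.
have H := computes_seq (E _ _ _ _ _ C1) (computes_seq (E _ _ _ _ _ C2) (computes_seq (E _ _ _ _ _ (C3 _))
  (computes_seq (E _ _ _ _ _ (C4 _)) (computes_seq (E _ _ _ _ _ (C5 _)) (E _ _ _ _ _ (C6 _)))))).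
apply: (computes_eq H) => //; last first.
  rewrite /vertex_cost; clear -iW jW nW.
  have H x k : x <= W -> x * (2 * k + 9) + 2 <= (2 * k + 9) * W + 2.
    by move=> xW; rewrite leq_add2r mulnC leq_mul2l xW orbT.
  have := H i a iW; have := H j b jW; have := H n c nW; lia.
have -> : true :: enc_nat (value i j n (a, b, c, r)) ++ out =
    true :: nseq (a * i) true ++ nseq (b * j) true ++ nseq (c * n) true ++ nseq r true ++ false :: out.
  by rewrite /enc_nat cat_rcons /value !nseqD -!catA.
by [].
Qed.

Lemma emit_faceP f out :
  computes (emit_face f) (st out) (st (enc_seq enc_nat [seq value i j n d | d <- f] ++ out))
    (2 + sumn (map vertex_cost f) * W.+1).
Proof.
elim: f out => [|d f IH] out.
  by apply: (computes_eq (@computes_push 9 (st out) OUT false)) => //; regs.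
apply: (computes_eq (computes_seq (IH out) (emit_vertexP d _))) => // [q _|].
  by rewrite /= -catA.
by rewrite /=; lia.
Qed.

End Emit.

(** [C] depends on the forms only, and the counters enter through their bound [W], so a fixed
    pattern of triangles costs time linear in [W]. *)
Lemma emit_bound s : exists C, forall inp sv t l i j n fl W F,
  [/\ i <= W, j <= W & n <= W] ->
  computes (emit s) (conf inp sv t l i j n 0 fl (enc_complex F))
    (conf inp sv t l i j n 0 fl (enc_complex (catrev [seq [seq value i j n d | d <- f] | f <- s] F)))
    (C * W.+1).
Proof.
elim: s => [|f s [C H]].
  exists 1 => inp sv t l i j n fl W F b; apply: computes_le (computes_skip _) _; lia.
exists (C + sumn (map vertex_cost f) + 4) => inp sv t l i j n fl W F b.
have H1 := emit_faceP inp sv t l fl b f (enc_complex F).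
have H2 := computes_seq H1 (@computes_push 9 _ OUT true).
have H3 := H inp sv t l i j n fl W ([seq value i j n d | d <- f] :: F) b.
apply: (computes_eq (computes_seq H2 (computes_eq H3 _ (fun _ _ => erefl) (leqnn _)))) => //; last by lia.
by regs.
Qed.

(** Residues 3 to 6 give vertices of index [n], and 10 to 13 those of index [n.+1]. *)
Definition cell_form (r : nat) : linform := (0, 0, 7, r).
Definition apex_form : linform := (0, 0, 0, 0).

Definition emit_block (m u c : linform) :=
  Seq (emit (block_tris apex_form (cell_form 3) m u c
    (cell_form 11) (cell_form 12) (cell_form 13) (cell_form 10))) (Push CELL true).

Definition emit_header (m u : linform) :=
  emit [:: [:: apex_form; m; cell_form 3]; [:: m; cell_form 3; u]].

Definition emit_footer (m u : linform) :=
  Seq (emit [:: [:: apex_form; cell_form 3; m]; [:: cell_form 3; m; u]]) (Push CELL true).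

Ltac step H := apply: (computes_eq H) => //; regs.

Lemma emit_block_bound m u c : exists C, forall inp sv t l i j n fl W F k h,
  [/\ i <= W, j <= W & n <= W] ->
  [/\ value i j n m = code (Mid h), value i j n u = code (Tip h./2) & value i j n c = code (Tip k)] ->
  computes (emit_block m u c) (conf inp sv t l i j n 0 fl (enc_complex F))
    (conf inp sv t l i j n.+1 0 fl (enc_complex (catrev (coded (block k n h)) F))) (C * W.+1).
Proof.
have [C H] := emit_bound (block_tris apex_form (cell_form 3) m u c
    (cell_form 11) (cell_form 12) (cell_form 13) (cell_form 10)).
exists (C + 2) => inp sv t l i j n fl W F k h b [Em Eu Ec].
have H1 := H inp sv t l i j n fl W F b.
have E : [seq [seq value i j n d | d <- f] | f <- block_tris apex_form (cell_form 3) m u c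
    (cell_form 11) (cell_form 12) (cell_form 13) (cell_form 10)] = coded (block k n h).
  have E0 : value i j n apex_form = code Apex by [].
  have E1 : value i j n (cell_form 3) = code (Ring n) by rewrite /value /=; lia.
  have E2 : value i j n (cell_form 11) = code (Va n.+1) by rewrite /value /=; lia.
  have E3 : value i j n (cell_form 12) = code (Vb n.+1) by rewrite /value /=; lia.
  have E4 : value i j n (cell_form 13) = code (Vd n.+1) by rewrite /value /=; lia.
  have E5 : value i j n (cell_form 10) = code (Ring n.+1) by rewrite /value /=; lia.
  by rewrite /block_tris [LHS]/= E0 E1 E2 E3 E4 E5 Em Eu Ec.
rewrite E in H1.
by apply: (computes_eq (computes_seq H1 (@computes_push 9 _ CELL true))) => //; [regs|lia].
Qed.

Lemma emit_header_bound m u : exists C, forall inp sv t l i j n fl W F k,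
  [/\ i <= W, j <= W & n <= W] ->
  value i j n m = code (Mid k.*2) -> value i j n u = code (Tip k) ->
  computes (emit_header m u) (conf inp sv t l i j n 0 fl (enc_complex F))
    (conf inp sv t l i j n 0 fl (enc_complex (catrev (coded (header k n)) F))) (C * W.+1).
Proof.
have [C H] := emit_bound [:: [:: apex_form; m; cell_form 3]; [:: m; cell_form 3; u]].
exists C => inp sv t l i j n fl W F k b Em Eu.
have E0 : value i j n apex_form = code Apex by [].
have E1 : value i j n (cell_form 3) = code (Ring n) by rewrite /value /=; lia.
by have := H inp sv t l i j n fl W F b; rewrite /header [X in catrev X]/= E0 E1 Em Eu.
Qed.

Lemma emit_footer_bound m u : exists C, forall inp sv t l i j n fl W F k,
  [/\ i <= W, j <= W & n <= W] ->
  value i j n m = code (Mid k.*2.+1) -> value i j n u = code (Tip k) ->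
  computes (emit_footer m u) (conf inp sv t l i j n 0 fl (enc_complex F))
    (conf inp sv t l i j n.+1 0 fl (enc_complex (catrev (coded (footer k n)) F))) (C * W.+1).
Proof.
have [C H] := emit_bound [:: [:: apex_form; cell_form 3; m]; [:: cell_form 3; m; u]].
exists (C + 2) => inp sv t l i j n fl W F k b Em Eu.
have E0 : value i j n apex_form = code Apex by [].
have E1 : value i j n (cell_form 3) = code (Ring n) by rewrite /value /=; lia.
have := H inp sv t l i j n fl W F b; rewrite [X in catrev X]/= E0 E1 Em Eu => H1.
by apply: (computes_eq (computes_seq H1 (@computes_push 9 _ CELL true))) => //; [regs|lia].
Qed.

(** The blocks without the footer: unlike [blocks], they concatenate, which fits a scan that finds
    the covered hairs one by one. *)
Fixpoint bodies k n hs : seq (seq vtx) :=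
  if hs is h :: hs' then block k n h ++ bodies k n.+1 hs' else [::].

Lemma blocks_bodies k n hs : blocks k n hs = bodies k n hs ++ footer k (n + size hs).
Proof. by elim: hs n => [|h hs IH] n; rewrite ?addn0 //= IH addSnnS. Qed.

Lemma bodies_cat k n hs hs' : bodies k n (hs ++ hs') = bodies k n hs ++ bodies k (n + size hs) hs'.
Proof. by elim: hs n => [|h hs IH] n /=; rewrite ?addn0 // IH addSnnS. Qed.

Definition enc_lit (l : literal) : seq bool := l.2 :: enc_nat l.1.
Definition clause_code (c : seq literal) : seq bool := true :: flatten [seq enc_lit l | l <- c].
Definition clauses_code (cs : seq (seq literal)) : seq bool := flatten [seq clause_code c | c <- cs].

Lemma enc_cnf3E phi :
  enc_cnf3 phi = enc_nat (nvars phi) ++ clauses_code (raw_clauses phi) ++ [:: false].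
Proof.
rewrite /enc_cnf3 /raw_clauses; congr cat; elim: (clauses phi) => //= c s ->.
rewrite /clauses_code /= -!catA /enc_clause.
by congr (_ :: _ ++ _); rewrite -map_comp.
Qed.

(** [FLAG] is set if the sign is [b] and is dropped when the unary index runs past [VI] or falls
    short of it, so it survives exactly for the literal [(i, b)]. [TMP] keeps the consumed part of
    [VI]. The forms are the codes of [Mid (6 * j + s)], of its tip, and of [Tip (3 * i.+1)]. *)
Definition scan_literal (b : bool) (s : nat) :=
  Seq (If IN tops
        (Seq (Pop IN) (Seq (Push SAVE true) (if b then Push FLAG true else skip)))
        (Seq (Pop IN) (Seq (Push SAVE false) (if b then skip else Push FLAG true))))
  (Seq (While IN tops (Seq (Pop IN) (Seq (Push SAVE true)
        (If VI tops (Seq (Pop VI) (Push TMP true)) (Pop FLAG)))))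
  (Seq (Seq (Pop IN) (Push SAVE false))
  (Seq (If VI tops (Pop FLAG) skip)
  (Seq (While TMP tops (Seq (Pop TMP) (Push VI true)))
       (If FLAG tops
         (Seq (Pop FLAG) (emit_block (0, 42, 0, 7 * s + 1) (0, 21, 0, 7 * s./2 + 2) (21, 0, 0, 23)))
         skip))))).

Lemma scan_literal_bound b s : exists C, forall x rest sv t l i j n W F,
  [/\ x.1 <= W, i <= W, j <= W & n <= W] ->
  let hs := if x == (i, b) then [:: 6 * j + s] else [::] in
  computes (scan_literal b s) (conf (enc_lit x ++ rest) sv t l i j n 0 false (enc_complex F))
    (conf rest (catrev (enc_lit x) sv) t l i j (n + size hs) 0 false
      (enc_complex (catrev (coded (bodies (3 * i.+1) n hs)) F))) (C * W.+1).
Proof.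
have [C HC] := emit_block_bound (0, 42, 0, 7 * s + 1) (0, 21, 0, 7 * s./2 + 2) (21, 0, 0, 23).
exists (C + 100) => -[x c] rest sv t l i j n W F []; rewrite [(x, c).1]/= => xW iW jW nW hs.
pose st inp sv i tmp fl := conf inp sv t l i j n tmp fl (enc_complex F).
have S1 : computes (If IN tops
        (Seq (Pop IN) (Seq (Push SAVE true) (if b then Push FLAG true else skip)))
        (Seq (Pop IN) (Seq (Push SAVE false) (if b then skip else Push FLAG true))))
    (st (c :: enc_nat x ++ rest) sv i 0 false) (st (enc_nat x ++ rest) (c :: sv) i 0 (c == b)) 6.
  apply: computes_if => //=.
  have H1 := @computes_pop 9 (st (c :: enc_nat x ++ rest) sv i 0 false) IN.
  have H2 := computes_seq H1 (@computes_push 9 _ SAVE c).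
  case: c H1 H2 {hs} => H1 H2 /=.
    case: b {HC}.
      by step (computes_seq H1 (computes_seq (@computes_push 9 _ SAVE true) (@computes_push 9 _ FLAG true))).
    by step (computes_seq H1 (computes_seq (@computes_push 9 _ SAVE true) (computes_skip _))).
  case: b {HC}.
    by step (computes_seq H1 (computes_seq (@computes_push 9 _ SAVE false) (computes_skip _))).
  by step (computes_seq H1 (computes_seq (@computes_push 9 _ SAVE false) (@computes_push 9 _ FLAG true))).
(* The state after [k] marks of the index: [minn k i] units have gone to [TMP], and the flag is lost
   once [k] exceeds [i]. *)
pose f k := st (nseq (x - k) true ++ false :: rest) (nseq k true ++ c :: sv) (i - k) (minn k i)
  ((c == b) && (k <= i)).
have S2 : computes (While IN tops (Seq (Pop IN) (Seq (Push SAVE true)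
        (If VI tops (Seq (Pop VI) (Push TMP true)) (Pop FLAG))))) (f 0) (f x) (x * 8).+1.
  apply: computes_loop => // [k kx|]; last by rewrite /f /= subnn.
  split; first by rewrite /f /= -(subnSK kx).
  set a := If _ _ _ _.
  pose g := conf (nseq (x - k.+1) true ++ false :: rest) (nseq k.+1 true ++ c :: sv) t l (i - k) j n
    (minn k i) ((c == b) && (k <= i)) (enc_complex F).
  have H : computes a g (f k.+1) 4.
    apply: computes_if => //=; case: (ltnP k i) => ki.
      rewrite -(subnSK ki) /=; have H := @computes_pop 9 g VI.
      apply: (computes_eq (computes_seq H (@computes_push 9 _ TMP true))) => //.
      rewrite /g /f -(subnSK ki) ltnW // ki (minn_idPl (ltnW ki)) (minn_idPl ki); regs.
    have -> : i - k = 0 by lia.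
    apply: (computes_eq (@computes_pop 9 g FLAG)) => //.
    rewrite /g /f (_ : i - k = 0); last by lia.
    rewrite (_ : i - k.+1 = 0); last by lia.
    rewrite (minn_idPr ki) (minn_idPr (leqW ki)) ltnNge ki andbF.
    by case: (_ && _); regs.
  apply: (computes_eq (computes_seq (@computes_pop 9 (f k) IN)
    (computes_seq (@computes_push 9 _ SAVE true) (computes_eq H _ (fun _ _ => erefl) (leqnn _))))) => //.
  by rewrite /f -(subnSK kx); regs.
have S3 : computes (Seq (Pop IN) (Push SAVE false)) (f x)
    (st rest (false :: nseq x true ++ c :: sv) (i - x) (minn x i) ((c == b) && (x <= i))) 3.
  rewrite /f subnn; set g := st _ _ _ _ _.
  by step (computes_seq (@computes_pop 9 g IN) (@computes_push 9 _ SAVE false)).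
have Esv : false :: nseq x true ++ c :: sv = catrev (enc_lit (x, c)) sv.
  rewrite catrevE /enc_lit /enc_nat /= rev_cons rev_rcons -cats1 -catA /=.
  congr (_ :: _ ++ _); elim: x {S1 S2 S3 f xW hs} => //= x IH; rewrite rev_cons -IH.
  by rewrite -cats1; elim: x {IH} => //= x ->.
rewrite {}Esv in S3.
set sv' := catrev _ _ in S3 *.
have S4 : computes (If VI tops (Pop FLAG) skip)
    (st rest sv' (i - x) (minn x i) ((c == b) && (x <= i)))
    (st rest sv' (i - x) (minn x i) ((x, c) == (i, b))) 2.
  apply: computes_if => //; rewrite xpair_eqE andbC.
  have [xi|ix|->] := ltngtP x i.
  - rewrite (_ : i - x = (i - x).-1.+1) /= ?andbF; last by lia.
    apply: (computes_eq (@computes_pop 9 _ FLAG)) => //=.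
    by case: (c == b); regs.
  - rewrite (_ : i - x = 0) /= ?andbF; last by lia.
    exact: computes_skip.
  by rewrite subnn /=; case: (c == b); apply: computes_skip.
pose g k := st rest sv' (i - x + k) (minn x i - k) ((x, c) == (i, b)).
have S5 : computes (While TMP tops (Seq (Pop TMP) (Push VI true))) (g 0) (g (minn x i)) (minn x i * 4).+1.
  apply: computes_loop => // [k lt_k|]; last by rewrite /g /= subnn.
  split; first by rewrite /g /= -(subnSK lt_k).
  apply: (computes_eq (computes_seq (@computes_pop 9 (g k) TMP) (@computes_push 9 _ VI true))) => //.
  by rewrite /g addnS -(subnSK lt_k); regs.
have Eg0 : g 0 = st rest sv' (i - x) (minn x i) ((x, c) == (i, b)) by rewrite /g addn0 subn0.
have Eg1 : g (minn x i) = st rest sv' i 0 ((x, c) == (i, b)).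
  by rewrite /g subnn (_ : i - x + minn x i = i) //; lia.
rewrite Eg0 Eg1 in S5.
have S6 : computes (If FLAG tops
         (Seq (Pop FLAG) (emit_block (0, 42, 0, 7 * s + 1) (0, 21, 0, 7 * s./2 + 2) (21, 0, 0, 23)))
         skip) (st rest sv' i 0 ((x, c) == (i, b)))
    (conf rest sv' t l i j (n + size hs) 0 false (enc_complex (catrev (coded (bodies (3 * i.+1) n hs)) F)))
    (C * W.+1 + 2).
  apply: (@computes_le _ _ _ (C * W.+1 + 1).+1); last by rewrite !addnS.
  case: eqP => Eb; last first.
    have -> : hs = [::] by rewrite /hs; case: eqP.
    rewrite addn0; apply: computes_else => //.
    by apply: (computes_le (computes_skip _)); rewrite addn1.
  have -> : hs = [:: 6 * j + s] by rewrite /hs Eb eqxx.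
  have H := HC rest sv' t l i j n false W F (3 * i.+1) (6 * j + s).
  rewrite [n + _]addn1 [bodies _ _ _]cats0; apply: computes_then => //.
  apply: (computes_eq (computes_seq (@computes_pop 9 (st rest sv' i 0 true) FLAG)
    (computes_eq (H _ _) _ (fun _ _ => erefl) (leqnn _)))) => //.
  - by split; rewrite /value /=; lia.
  - by regs.
  by rewrite addnC.
have S0 r : r <= 9 -> f 0 r = st (enc_nat x ++ rest) (c :: sv) i 0 (c == b) r.
  move=> _; rewrite /f !subn0 min0n leq0n andbT /=.
  by rewrite /enc_nat cat_rcons.
apply: (computes_eq (computes_seq S1 (computes_seq (computes_eq S2 (fun r h => esym (S0 r h)) (fun _ _ => erefl) (leqnn _))
  (computes_seq S3 (computes_seq S4 (computes_seq S5 S6)))))) => //.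
by move: xW; clear; rewrite /minn; case: ifP; lia.
Qed.

(** One pass over the clauses for each side; 2, 3 and 5 are the entries of [slots]. *)
Definition scan_clauses (b : bool) :=
  While IN tops (Seq (Seq (Pop IN) (Push SAVE true))
    (Seq (scan_literal b 2) (Seq (scan_literal b 3) (Seq (scan_literal b 5) (Push CJ true))))).

Lemma catrev_catl (T : Type) (s1 s2 s3 : seq T) : catrev (s1 ++ s2) s3 = catrev s2 (catrev s1 s3).
Proof. by elim: s1 s3 => //= x s1 IH s3. Qed.

Lemma scan_clauses_bound b : exists C, forall cs sv t l i j n W F,
  (forall c, c \in cs -> size c = 3 /\ forall x, x \in c -> x.1 <= W) ->
  [/\ i <= W, j + size cs <= W & n + size (occs (i, b) j cs) <= W] ->
  computes (scan_clauses b)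
    (conf (clauses_code cs ++ [:: false]) sv t l i j n 0 false (enc_complex F))
    (conf [:: false] (catrev (clauses_code cs) sv) t l i (j + size cs)
      (n + size (occs (i, b) j cs)) 0 false
      (enc_complex (catrev (coded (bodies (3 * i.+1) n (occs (i, b) j cs))) F)))
    (1 + C * size cs * W.+1).
Proof.
have [C2 H2] := scan_literal_bound b 2.
have [C3 H3] := scan_literal_bound b 3.
have [C5 H5] := scan_literal_bound b 5.
exists (C2 + C3 + C5 + 6); elim=> [|c cs IH] sv t l i j n W F csW [iW jW nW].
  rewrite muln0 !addn0; exact: computes_exit.
have [c3 cW] := csW c (mem_head _ _).
have csW' c' : c' \in cs -> size c' = 3 /\ forall x, x \in c' -> x.1 <= W.
  by move=> c'cs; apply: csW; rewrite inE c'cs orbT.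
have {}jW : j + (size cs).+1 <= W := jW.
case: c c3 cW {csW} nW => [|x2 [|x3 [|x5 [|]]]] // _ cW.
set o2 := if x2 == (i, b) then [:: 6 * j + 2] else [::].
set o3 := if x3 == (i, b) then [:: 6 * j + 3] else [::].
set o5 := if x5 == (i, b) then [:: 6 * j + 5] else [::].
have -> : occs (i, b) j ([:: x2; x3; x5] :: cs) = o2 ++ o3 ++ o5 ++ occs (i, b) j.+1 cs.
  by rewrite /= /clause_occs /= cats0 -!catA.
rewrite !size_cat !addnA => nW.
have x2W : x2.1 <= W by apply: cW; rewrite !inE eqxx.
have x3W : x3.1 <= W by apply: cW; rewrite !inE eqxx orbT.
have x5W : x5.1 <= W by apply: cW; rewrite !inE eqxx !orbT.
have jW' : j <= W by apply: leq_trans jW; apply: leq_addr.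
have {}jW : j.+1 + size cs <= W by rewrite addSnnS.
have n2W : n <= W by lia.
have n3W : n + size o2 <= W by lia.
have n5W : n + size o2 + size o3 <= W by lia.
set rest := clauses_code cs ++ [:: false].
have -> : clauses_code ([:: x2; x3; x5] :: cs) ++ [:: false] =
    true :: enc_lit x2 ++ enc_lit x3 ++ enc_lit x5 ++ rest.
  by rewrite /clauses_code /clause_code /= cats0 -!catA /= -!catA.
have -> : catrev (clauses_code ([:: x2; x3; x5] :: cs)) sv =
    catrev (clauses_code cs) (catrev (enc_lit x5) (catrev (enc_lit x3) (catrev (enc_lit x2) (true :: sv)))).
  have -> : clauses_code ([:: x2; x3; x5] :: cs) =
      (true :: enc_lit x2 ++ enc_lit x3 ++ enc_lit x5) ++ clauses_code cs.
    by rewrite /clauses_code /clause_code /= cats0.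
  by rewrite catrev_catl -cat1s !catrev_catl.
have S2 := H2 x2 (enc_lit x3 ++ enc_lit x5 ++ rest) (true :: sv) t l i j n W F (And4 x2W iW jW' n2W).
rewrite -/o2 in S2.
have S3 := H3 x3 (enc_lit x5 ++ rest) (catrev (enc_lit x2) (true :: sv)) t l i j _ W
  (catrev (coded (bodies (3 * i.+1) n o2)) F) (And4 x3W iW jW' n3W).
rewrite -/o3 in S3.
have S5 := H5 x5 rest (catrev (enc_lit x3) (catrev (enc_lit x2) (true :: sv))) t l i j _ W
  (catrev (coded (bodies (3 * i.+1) (n + size o2) o3)) (catrev (coded (bodies (3 * i.+1) n o2)) F))
  (And4 x5W iW jW' n5W).
rewrite -/o5 in S5.
have SI := IH (catrev (enc_lit x5) (catrev (enc_lit x3) (catrev (enc_lit x2) (true :: sv)))) t l i j.+1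
  (n + size o2 + size o3 + size o5) W
  (catrev (coded (bodies (3 * i.+1) (n + size o2 + size o3) o5))
    (catrev (coded (bodies (3 * i.+1) (n + size o2) o3)) (catrev (coded (bodies (3 * i.+1) n o2)) F))) csW'.
have {}SI := SI (And3 iW jW nW); rewrite addSnnS in SI.
rewrite !bodies_cat /coded !map_cat !catrev_catl -!/(coded _).
set st1 := conf (true :: _) _ _ _ _ _ _ _ _ _.
have S1 : computes (Seq (Pop IN) (Push SAVE true)) st1
    (conf (enc_lit x2 ++ enc_lit x3 ++ enc_lit x5 ++ rest) (true :: sv) t l i j n 0 false (enc_complex F)) 3.
  by step (computes_seq (@computes_pop 9 st1 IN) (@computes_push 9 _ SAVE true)).
have SB := computes_seq S1 (computes_seq S2 (computes_seq S3 (computes_seq S5 (@computes_push 9 _ CJ true)))).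
have tn : tops (ohead (st1 IN)) by [].
apply: (computes_eq (computes_turn (isT : IN <= 9) tn SB (computes_eq SI _ (fun _ _ => erefl) (leqnn _)))) => //.
  by regs.
rewrite -![size (_ :: cs)]/(size cs).+1; clear; nia.
Qed.

(** As [SAVE] is reversed, popping it onto [IN] rewinds the input for the next pass. *)
Definition restore :=
  While SAVE isSome (If SAVE tops (Seq (Pop SAVE) (Push IN true)) (Seq (Pop SAVE) (Push IN false))).

Lemma computes_restore s inp t l i j n out :
  computes restore (conf inp s t l i j n 0 false out) (conf (catrev s inp) [::] t l i j n 0 false out)
    (1 + 5 * size s).
Proof.
elim: s inp => [|b s IH] inp; first exact: computes_exit.
have S : computes (If SAVE tops (Seq (Pop SAVE) (Push IN true)) (Seq (Pop SAVE) (Push IN false)))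
    (conf inp (b :: s) t l i j n 0 false out) (conf (b :: inp) s t l i j n 0 false out) 4.
  set st := conf inp _ _ _ _ _ _ _ _ _.
  have H := computes_seq (@computes_pop 9 st SAVE) (@computes_push 9 _ IN b).
  by rewrite /st; case: b @st H => st H; [apply: computes_then|apply: computes_else] => //; step H.
apply: (computes_eq (computes_turn (isT : SAVE <= 9) _ S (IH _))) => //=.
by lia.
Qed.

Definition clear_counter x := While x tops (Pop x).

Lemma computes_clear_cj inp sv t l i j n out :
  computes (clear_counter CJ) (conf inp sv t l i j n 0 false out) (conf inp sv t l i 0 n 0 false out) (1 + 2 * j).
Proof.
elim: j => [|j IH]; first exact: computes_exit.
set st := conf _ _ _ _ _ _ _ _ _ _.
have S : computes (Pop CJ) st (conf inp sv t l i j n 0 false out) 1.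
  by step (@computes_pop 9 st CJ).
apply: (computes_eq (computes_turn (isT : CJ <= 9) _ S IH)) => //.
by lia.
Qed.

Lemma computes_clear_vi inp sv t l i j n out :
  computes (clear_counter VI) (conf inp sv t l i j n 0 false out) (conf inp sv t l 0 j n 0 false out) (1 + 2 * i).
Proof.
elim: i => [|i IH]; first exact: computes_exit.
set st := conf _ _ _ _ _ _ _ _ _ _.
have S : computes (Pop VI) st (conf inp sv t l i j n 0 false out) 1.
  by step (@computes_pop 9 st VI).
apply: (computes_eq (computes_turn (isT : VI <= 9) _ S IH)) => //.
by lia.
Qed.

(** With [k] equal to [3 * i.+1], the codes of [Mid k.*2], [Mid k.*2.+1] and [Tip k] are
    [42 * i + 43], [42 * i + 50] and [21 * i + 23]. *)
Definition var_region (b : bool) :=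
  Seq (emit_header (42, 0, 0, 43) (21, 0, 0, 23)) (Seq (scan_clauses b) (Seq restore
    (Seq (clear_counter CJ) (emit_footer (42, 0, 0, 50) (21, 0, 0, 23))))).

Lemma catrev_revK (T : Type) (s u : seq T) : catrev (catrev s [::]) u = s ++ u.
Proof. by rewrite -/(rev s) catrevE revK. Qed.

Lemma region_trisE n (r : region) :
  region_tris n r = header r.1 n ++ bodies r.1 n r.2 ++ footer r.1 (n + size r.2).
Proof. by rewrite /region_tris blocks_bodies. Qed.

Lemma var_region_bound b : exists C, forall cs t l i n W F,
  (forall c, c \in cs -> size c = 3 /\ forall x, x \in c -> x.1 <= W) ->
  size (clauses_code cs) <= W -> i <= W -> size cs <= W ->
  let r := (3 * i.+1, occs (i, b) 0 cs) in n + size r.2 <= W ->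
  computes (var_region b)
    (conf (clauses_code cs ++ [:: false]) [::] t l i 0 n 0 false (enc_complex F))
    (conf (clauses_code cs ++ [:: false]) [::] t l i 0 (n + size r.2).+1 0 false
      (enc_complex (catrev (coded (region_tris n r)) F)))
    (C * (W.+1 * W.+1)).
Proof.
have [C1 H1] := emit_header_bound (42, 0, 0, 43) (21, 0, 0, 23).
have [C2 H2] := scan_clauses_bound b.
have [C3 H3] := emit_footer_bound (42, 0, 0, 50) (21, 0, 0, 23).
exists (C1 + C2 + C3 + 10) => cs t l i n W F csW codeW iW sizeW r nW.
have nW' : n <= W by apply: leq_trans nW; apply: leq_addr.
have S1 := H1 (clauses_code cs ++ [:: false]) [::] t l i 0 n false W F (3 * i.+1) (And3 iW (leq0n W) nW').
have S2 := H2 cs [::] t l i 0 n W (catrev (coded (header (3 * i.+1) n)) F) csW (And3 iW sizeW nW).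
have S3 := computes_restore (catrev (clauses_code cs) [::]) [:: false] t l i (0 + size cs) (n + size r.2)
  (enc_complex (catrev (coded (bodies (3 * i.+1) n r.2)) (catrev (coded (header (3 * i.+1) n)) F))).
have S4 := computes_clear_cj (clauses_code cs ++ [:: false]) [::] t l i (0 + size cs) (n + size r.2)
  (enc_complex (catrev (coded (bodies (3 * i.+1) n r.2)) (catrev (coded (header (3 * i.+1) n)) F))).
have S5 := H3 (clauses_code cs ++ [:: false]) [::] t l i 0 (n + size r.2) false W
  (catrev (coded (bodies (3 * i.+1) n r.2)) (catrev (coded (header (3 * i.+1) n)) F)) (3 * i.+1)
  (And3 iW (leq0n W) nW).
rewrite catrev_revK in S3.
have {}S1 := S1 _ _; have {}S5 := S5 _ _.
have S := computes_seq (S1 _ _) (computes_seq S2 (computes_seq S3 (computes_seq S4 (S5 _ _)))).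
rewrite region_trisE /coded !map_cat !catrev_catl -!/(coded _).
apply: (computes_eq (S _ _ _ _)) => //; try by rewrite /value /=; lia.
rewrite size_rev add0n.
have : size cs * W.+1 <= W.+1 * W.+1 by rewrite leq_mul2r leqW ?orbT.
move: sizeW codeW; clear; nia.
Qed.

Definition next_cell n (rs : seq region) := n + sumn [seq (size r.2).+1 | r <- rs].

Lemma next_cell_cat n rs rs' : next_cell n (rs ++ rs') = next_cell (next_cell n rs) rs'.
Proof. by rewrite /next_cell map_cat sumn_cat addnA. Qed.

Lemma next_cell_cons n r rs : next_cell n (r :: rs) = next_cell (n + size r.2).+1 rs.
Proof. by rewrite /next_cell /= addnA addnS. Qed.

Lemma next_cell_ge n rs : n <= next_cell n rs.
Proof. exact: leq_addr. Qed.

Lemma tris_cat n rs rs' : tris n (rs ++ rs') = tris n rs ++ tris (next_cell n rs) rs'.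
Proof.
elim: rs n => [|r rs IH] n; first by rewrite /next_cell addn0.
by rewrite next_cell_cons cat_cons [LHS]/= IH catA.
Qed.

Definition var_loop :=
  While LEFT tops (Seq (Pop LEFT) (Seq (var_region true) (Seq (var_region false) (Push VI true)))).

Lemma var_loop_bound : exists C, forall cs l i n W F,
  (forall c, c \in cs -> size c = 3 /\ forall x, x \in c -> x.1 <= W) ->
  size (clauses_code cs) <= W -> size cs <= W -> i + l <= W ->
  let rs := flatten [seq var_regions cs i | i <- iota i l] in next_cell n rs <= W ->
  computes var_loop
    (conf (clauses_code cs ++ [:: false]) [::] 0 l i 0 n 0 false (enc_complex F))
    (conf (clauses_code cs ++ [:: false]) [::] 0 0 (i + l) 0 (next_cell n rs) 0 false
      (enc_complex (catrev (coded (tris n rs)) F)))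
    (1 + C * l * (W.+1 * W.+1)).
Proof.
have [C1 H1] := var_region_bound true; have [C2 H2] := var_region_bound false.
exists (C1 + C2 + 4) => cs l i n W F csW codeW sizeW.
elim: l i n F => [|l IH] i n F ilW rs nW.
  rewrite muln0 addn0 /rs /next_cell /= addn0; exact: computes_exit.
have iW : i <= W by apply: leq_trans ilW; apply: leq_addr.
have Ers : rs = var_regions cs i ++ flatten [seq var_regions cs i | i <- iota i.+1 l] by [].
move: nW; rewrite Ers next_cell_cat tris_cat /coded map_cat catrev_catl -!/(coded _) => nW.
set n1 := (n + size (occs (i, true) 0 cs)).+1; set n2 := (n1 + size (occs (i, false) 0 cs)).+1.
have En : next_cell n (var_regions cs i) = n2 by rewrite /next_cell /n2 /n1 /=; lia.
rewrite En in nW *.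
have n2W : n2 <= W by apply: leq_trans nW; apply: next_cell_ge.
have n1W : n1 + size (occs (i, false) 0 cs) <= W by apply: ltnW.
have n0W : n + size (occs (i, true) 0 cs) <= W.
  by apply: leq_trans n1W; rewrite /n1 addSn; apply/leqW/leq_addr.
have S1 := H1 cs 0 l i n W F csW codeW iW sizeW n0W.
set F1 := catrev _ F in S1.
have S2 := H2 cs 0 l i n1 W F1 csW codeW iW sizeW n1W.
set F2 := catrev _ F1 in S2.
have {}ilW : i.+1 + l <= W by rewrite addSnnS.
have SI := IH i.+1 n2 F2 ilW nW; rewrite addSnnS in SI.
have -> : catrev (coded (tris n (var_regions cs i))) F = F2.
  rewrite -[tris _ _]/(region_tris n (3 * i.+1, occs (i, true) 0 cs) ++
    region_tris n1 (3 * i.+1, occs (i, false) 0 cs) ++ [::]) cats0.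
  by rewrite /coded map_cat catrev_catl.
set st := conf _ _ 0 l.+1 _ _ _ _ _ _.
have S0 : computes (Pop LEFT) st (conf (clauses_code cs ++ [:: false]) [::] 0 l i 0 n 0 false (enc_complex F)) 1.
  by step (@computes_pop 9 st LEFT).
have SB := computes_seq S0 (computes_seq S1 (computes_seq S2 (@computes_push 9 _ VI true))).
apply: (computes_eq (computes_turn (isT : LEFT <= 9) _ SB (computes_eq SI _ (fun _ _ => erefl) (leqnn _)))) => //.
  by regs.
by clear; nia.
Qed.

(** Units move from [VARS] to [LEFT] because the number of variables is needed again to drive
    [var_loop]. *)
Definition hub_loop :=
  While VARS tops (Seq (Pop VARS) (Seq (Push LEFT true)
    (Seq (emit_block (42, 0, 0, 43) (21, 0, 0, 23) (0, 0, 0, 2))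
    (Seq (emit_block (42, 0, 0, 50) (21, 0, 0, 23) (0, 0, 0, 2)) (Push VI true))))).

Lemma hub_loop_bound : exists C, forall w t l i n W F, i + t <= W -> n + 2 * t <= W ->
  computes hub_loop (conf w [::] t l i 0 n 0 false (enc_complex F))
    (conf w [::] 0 (l + t) (i + t) 0 (n + 2 * t) 0 false (enc_complex (catrev (coded (bodies 0 n
      (flatten [seq [:: 6 * i.+1; 6 * i.+1 + 1] | i <- iota i t]))) F)))
    (1 + C * t * W.+1).
Proof.
have [C1 H1] := emit_block_bound (42, 0, 0, 43) (21, 0, 0, 23) (0, 0, 0, 2).
have [C2 H2] := emit_block_bound (42, 0, 0, 50) (21, 0, 0, 23) (0, 0, 0, 2).
exists (C1 + C2 + 6) => w t l i n W F; elim: t l i n F => [|t IH] l i n F iW nW.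
  rewrite !muln0 !addn0; exact: computes_exit.
have i0W : i <= W by lia.
have n0W : n <= W by lia.
have n1W : n.+1 <= W by lia.
have S1 := H1 w [::] t l.+1 i 0 n false W F 0 (6 * i.+1) (And3 i0W (leq0n W) n0W).
set F1 := catrev _ F in S1.
have S2 := H2 w [::] t l.+1 i 0 n.+1 false W F1 0 (6 * i.+1 + 1) (And3 i0W (leq0n W) n1W).
set F2 := catrev _ F1 in S2.
have SI := IH l.+1 i.+1 n.+2 F2; rewrite (addSnnS l) (addSnnS i) in SI.
rewrite -[flatten _]/([:: 6 * i.+1; 6 * i.+1 + 1] ++ flatten [seq [:: 6 * i.+1; 6 * i.+1 + 1] | i <- iota i.+1 t]).
rewrite bodies_cat /coded map_cat catrev_catl -!/(coded _).
have -> : catrev (coded (bodies 0 n [:: 6 * i.+1; 6 * i.+1 + 1])) F = F2.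
  rewrite -[bodies _ _ _]/(block 0 n (6 * i.+1) ++ block 0 n.+1 (6 * i.+1 + 1) ++ [::]) cats0.
  by rewrite /coded map_cat catrev_catl.
rewrite (_ : n + size [:: _; _] = n.+2); last by rewrite /= addn2.
set st := conf _ _ t.+1 _ _ _ _ _ _ _.
have S0 : computes (Pop VARS) st (conf w [::] t l i 0 n 0 false (enc_complex F)) 1.
  by step (@computes_pop 9 st VARS).
have S0' : computes (Push LEFT true) (conf w [::] t l i 0 n 0 false (enc_complex F))
    (conf w [::] t l.+1 i 0 n 0 false (enc_complex F)) 2.
  by step (@computes_push 9 (conf w [::] t l i 0 n 0 false (enc_complex F)) LEFT true).
have {}S1 : computes _ _ _ _ := S1 _; have {}S2 := S2 _.
have SB := computes_seq S0 (computes_seq S0' (computes_seq (S1 _) (computes_seq (S2 _) (@computes_push 9 _ VI true)))).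
have n2 : n.+2 + 2 * t = n + 2 * t.+1 by lia.
rewrite n2 in SI.
apply: (computes_eq (computes_turn (isT : VARS <= 9) _ (SB _ _) (computes_eq (SI iW nW) _ (fun _ _ => erefl) (leqnn _)))) => //.
- by split; rewrite /value /=; lia.
- by split; rewrite /value /=; lia.
- by regs.
by clear; nia.
Qed.

Definition skip_literal := Seq (Pop IN) (Seq (While IN tops (Pop IN)) (Pop IN)).

Lemma computes_skip_literal x rest sv t l i j n out :
  computes skip_literal (conf (enc_lit x ++ rest) sv t l i j n 0 false out)
    (conf rest sv t l i j n 0 false out) (3 + 2 * x.1).
Proof.
case: x => x c; pose st w := conf w sv t l i j n 0 false out.
have L : computes (While IN tops (Pop IN)) (st (enc_nat x ++ rest)) (st (false :: rest)) (1 + 2 * x).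
  elim: x => [|x IH]; first exact: computes_exit.
  have S : computes (Pop IN) (st (enc_nat x.+1 ++ rest)) (st (enc_nat x ++ rest)) 1.
    by step (@computes_pop 9 (st (enc_nat x.+1 ++ rest)) IN).
  by apply: (computes_eq (computes_turn (isT : IN <= 9) _ S IH)) => //; lia.
have S : computes (Pop IN) (st (enc_lit (x, c) ++ rest)) (st (enc_nat x ++ rest)) 1.
  by step (@computes_pop 9 (st (enc_lit (x, c) ++ rest)) IN).
have S' : computes (Pop IN) (st (false :: rest)) (st rest) 1.
  by step (@computes_pop 9 (st (false :: rest)) IN).
by apply: (computes_eq (computes_seq S (computes_seq L S'))) => //; rewrite [(x, c).1]/=; lia.
Qed.

(** The constants 15, 22 and 29 belong to the hairs [6 * j + 2], [6 * j + 3] and [6 * j + 4], and 9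
    and 16 to the tips [3 * j + 1] and [3 * j + 2]. *)
Definition emit_or1 :=
  Seq (emit_header (0, 42, 0, 15) (0, 21, 0, 9))
  (Seq (emit_block (0, 42, 0, 29) (0, 21, 0, 16) (0, 21, 0, 9)) (emit_footer (0, 42, 0, 22) (0, 21, 0, 9))).

Lemma emit_or1_bound : exists C, forall inp sv t l i j n W F, [/\ i <= W, j <= W & n.+1 <= W] ->
  computes emit_or1 (conf inp sv t l i j n 0 false (enc_complex F))
    (conf inp sv t l i j n.+2 0 false
      (enc_complex (catrev (coded (region_tris n (3 * j + 1, [:: 6 * j + 4]))) F)))
    (C * W.+1).
Proof.
have [C1 H1] := emit_header_bound (0, 42, 0, 15) (0, 21, 0, 9).
have [C2 H2] := emit_block_bound (0, 42, 0, 29) (0, 21, 0, 16) (0, 21, 0, 9).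
have [C3 H3] := emit_footer_bound (0, 42, 0, 22) (0, 21, 0, 9).
exists (C1 + C2 + C3) => inp sv t l i j n W F [iW jW n1W]; have n0W := ltnW n1W.
have S1 := H1 inp sv t l i j n false W F (3 * j + 1) (And3 iW jW n0W).
set F1 := catrev _ F in S1.
have S2 := H2 inp sv t l i j n false W F1 (3 * j + 1) (6 * j + 4) (And3 iW jW n0W).
set F2 := catrev _ F1 in S2.
have S3 := H3 inp sv t l i j n.+1 false W F2 (3 * j + 1) (And3 iW jW n1W).
set F3 := catrev _ F2 in S3.
have -> : catrev (coded (region_tris n (3 * j + 1, [:: 6 * j + 4]))) F = F3.
  rewrite region_trisE [bodies _ _ _]cats0 [n + _]addn1.
  by rewrite /coded !map_cat !catrev_catl.
apply: (computes_eq (computes_seq (S1 _ _) (computes_seq (S2 _) (S3 _ _)))) => //;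
  try by rewrite /value /=; lia.
by split; rewrite /value /=; lia.
Qed.

(** The constant 36 belongs to the hair [6 * j + 5]; 1, 8 and 2 are the codes of the two hairs and
    of the tip of the hub. *)
Definition emit_or2 :=
  Seq (emit_header (0, 42, 0, 29) (0, 21, 0, 16))
  (Seq (emit_block (0, 0, 0, 1) (0, 0, 0, 2) (0, 21, 0, 16))
  (Seq (emit_block (0, 0, 0, 8) (0, 0, 0, 2) (0, 21, 0, 16)) (emit_footer (0, 42, 0, 36) (0, 21, 0, 16)))).

Lemma emit_or2_bound : exists C, forall inp sv t l i j n W F, [/\ i <= W, j <= W & n.+2 <= W] ->
  computes emit_or2 (conf inp sv t l i j n 0 false (enc_complex F))
    (conf inp sv t l i j n.+3 0 false
      (enc_complex (catrev (coded (region_tris n (3 * j + 2, [:: 0; 1]))) F)))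
    (C * W.+1).
Proof.
have [C1 H1] := emit_header_bound (0, 42, 0, 29) (0, 21, 0, 16).
have [C2 H2] := emit_block_bound (0, 0, 0, 1) (0, 0, 0, 2) (0, 21, 0, 16).
have [C4 H4] := emit_block_bound (0, 0, 0, 8) (0, 0, 0, 2) (0, 21, 0, 16).
have [C3 H3] := emit_footer_bound (0, 42, 0, 36) (0, 21, 0, 16).
exists (C1 + C2 + C3 + C4) => inp sv t l i j n W F [iW jW n2W].
have n1W := ltnW n2W; have n0W := ltnW n1W.
have S1 := H1 inp sv t l i j n false W F (3 * j + 2) (And3 iW jW n0W).
set F1 := catrev _ F in S1.
have S2 := H2 inp sv t l i j n false W F1 (3 * j + 2) 0 (And3 iW jW n0W).
set F2 := catrev _ F1 in S2.
have S4 := H4 inp sv t l i j n.+1 false W F2 (3 * j + 2) 1 (And3 iW jW n1W).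
set F4 := catrev _ F2 in S4.
have S3 := H3 inp sv t l i j n.+2 false W F4 (3 * j + 2) (And3 iW jW n2W).
set F3 := catrev _ F4 in S3.
have -> : catrev (coded (region_tris n (3 * j + 2, [:: 0; 1]))) F = F3.
  rewrite region_trisE -[bodies _ _ _]/(block (3 * j + 2) n 0 ++ block (3 * j + 2) n.+1 1 ++ [::]).
  by rewrite cats0 [n + size _]addn2 /coded !map_cat !catrev_catl.
apply: (computes_eq (computes_seq (S1 _ _) (computes_seq (S2 _) (computes_seq (S4 _) (S3 _ _))))) => //;
  try by rewrite /value /=; lia.
- by split; rewrite /value /=; lia.
- by split; rewrite /value /=; lia.
Qed.

Definition clause_loop :=
  While IN tops (Seq (Pop IN) (Seq skip_literal (Seq skip_literal (Seq skip_literal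
    (Seq emit_or1 (Seq emit_or2 (Push CJ true))))))).

Lemma clause_loop_bound : exists C, forall cs t l i j n W F,
  (forall c, c \in cs -> size c = 3 /\ forall x, x \in c -> x.1 <= W) ->
  i <= W -> j + size cs <= W ->
  let rs := flatten [seq clause_regions j | j <- iota j (size cs)] in next_cell n rs <= W ->
  computes clause_loop
    (conf (clauses_code cs ++ [:: false]) [::] t l i j n 0 false (enc_complex F))
    (conf [:: false] [::] t l i (j + size cs) (next_cell n rs) 0 false
      (enc_complex (catrev (coded (tris n rs)) F)))
    (1 + C * size cs * W.+1).
Proof.
have [C1 H1] := emit_or1_bound; have [C2 H2] := emit_or2_bound.
exists (C1 + C2 + 20) => cs t l i j n W F csW iW.
elim: cs j n F csW => [|c cs IH] j n F csW jW rs nW.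
  rewrite muln0 addn0 /rs /next_cell /= addn0; exact: computes_exit.
have [c3 cW] := csW c (mem_head _ _).
have csW' c' : c' \in cs -> size c' = 3 /\ forall x, x \in c' -> x.1 <= W.
  by move=> c'cs; apply: csW; rewrite inE c'cs orbT.
have {}jW : j + (size cs).+1 <= W := jW.
have Ers : rs = clause_regions j ++ flatten [seq clause_regions j | j <- iota j.+1 (size cs)] by [].
move: nW; rewrite Ers next_cell_cat tris_cat /coded map_cat catrev_catl -!/(coded _) => nW.
have En : next_cell n (clause_regions j) = n.+2.+3 by rewrite /next_cell /=; lia.
rewrite En in nW *.
have n2W : n.+2.+3 <= W by apply: leq_trans nW; apply: next_cell_ge.
have n1W : n.+1 <= W by move: n2W; clear; lia.
have n4W : n.+2.+2 <= W by apply: leq_trans n2W.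
have jW' : j <= W by apply: leq_trans jW; apply: leq_addr.
case: c c3 cW {csW rs Ers} => [|x2 [|x3 [|x5 [|]]]] // _ cW.
have x2W : x2.1 <= W by apply: cW; rewrite !inE eqxx.
have x3W : x3.1 <= W by apply: cW; rewrite !inE eqxx orbT.
have x5W : x5.1 <= W by apply: cW; rewrite !inE eqxx !orbT.
set rest := clauses_code cs ++ [:: false].
have -> : clauses_code ([:: x2; x3; x5] :: cs) ++ [:: false] =
    true :: enc_lit x2 ++ enc_lit x3 ++ enc_lit x5 ++ rest.
  by rewrite /clauses_code /clause_code /= cats0 -!catA /= -!catA.
have S1 := computes_skip_literal x2 (enc_lit x3 ++ enc_lit x5 ++ rest) [::] t l i j n (enc_complex F).
have S2 := computes_skip_literal x3 (enc_lit x5 ++ rest) [::] t l i j n (enc_complex F).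
have S3 := computes_skip_literal x5 rest [::] t l i j n (enc_complex F).
have S4 := H1 rest [::] t l i j n W F (And3 iW jW' n1W).
set F1 := catrev _ F in S4.
have S5 := H2 rest [::] t l i j n.+2 W F1 (And3 iW jW' n4W).
set F2 := catrev _ F1 in S5.
have {}jW : j.+1 + size cs <= W by rewrite addSnnS.
have SI := IH j.+1 n.+2.+3 F2 csW' jW nW; rewrite addSnnS in SI.
have -> : catrev (coded (tris n (clause_regions j))) F = F2.
  rewrite -[tris _ _]/(region_tris n (3 * j + 1, [:: 6 * j + 4]) ++
    region_tris (n + 1).+1 (3 * j + 2, [:: 0; 1]) ++ [::]) cats0 [n + 1]addn1.
  by rewrite /coded map_cat catrev_catl.
set st := conf (true :: _) _ _ _ _ _ _ _ _ _.
have S0 : computes (Pop IN) st (conf (enc_lit x2 ++ enc_lit x3 ++ enc_lit x5 ++ rest) [::] t l i j n 0 false (enc_complex F)) 1.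
  by step (@computes_pop 9 st IN).
have SB := computes_seq S0 (computes_seq S1 (computes_seq S2 (computes_seq S3 (computes_seq S4 (computes_seq S5 (@computes_push 9 _ CJ true)))))).
have tn : tops (ohead (st IN)) by [].
apply: (computes_eq (computes_turn (isT : IN <= 9) tn SB (computes_eq SI _ (fun _ _ => erefl) (leqnn _)))) => //.
  by regs.
move: x2W x3W x5W; rewrite /=; clear; move: (x2.1) (x3.1) (x5.1) (size cs) => a b c s; lia.
Qed.

Definition hub_region :=
  Seq (emit_header (0, 0, 0, 1) (0, 0, 0, 2)) (Seq hub_loop
    (Seq (clear_counter VI) (emit_footer (0, 0, 0, 8) (0, 0, 0, 2)))).

Lemma size_hub t : size (hub t).2 = 2 * t.
Proof.
rewrite /hub /= size_flatten /shape -map_comp.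
suff H n m : sumn [seq (size \o (fun i => [:: 6 * i.+1; 6 * i.+1 + 1])) i | i <- iota n m] = 2 * m by exact: H.
by elim: m n => //= m IH n; rewrite IH; lia.
Qed.

Lemma hub_region_bound : exists C, forall w t W F, 2 * t <= W ->
  computes hub_region (conf w [::] t 0 0 0 0 0 false (enc_complex F))
    (conf w [::] 0 t 0 0 (next_cell 0 [:: hub t]) 0 false (enc_complex (catrev (coded (tris 0 [:: hub t])) F)))
    (C * (W.+1 * W.+1)).
Proof.
have [C1 H1] := emit_header_bound (0, 0, 0, 1) (0, 0, 0, 2).
have [C2 H2] := hub_loop_bound.
have [C3 H3] := emit_footer_bound (0, 0, 0, 8) (0, 0, 0, 2).
exists (C1 + C2 + C3 + 4) => w t W F tW.
have tW' : 0 + t <= W by lia.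
have S1 := H1 w [::] t 0 0 0 0 false W F 0 (And3 (leq0n W) (leq0n W) (leq0n W)).
set F1 := catrev _ F in S1.
have S2 := H2 w t 0 0 0 W F1 tW' tW.
set F2 := catrev _ F1 in S2.
have S3 := computes_clear_vi w [::] 0 (0 + t) (0 + t) 0 (0 + 2 * t) (enc_complex F2).
have S4 := H3 w [::] 0 (0 + t) 0 0 (0 + 2 * t) false W F2 0 (And3 (leq0n W) (leq0n W) tW).
set F3 := catrev _ F2 in S4.
have -> : catrev (coded (tris 0 [:: hub t])) F = F3.
  rewrite -[tris _ _]/(region_tris 0 (hub t) ++ [::]) cats0 region_trisE size_hub.
  by rewrite /coded !map_cat !catrev_catl.
have -> : next_cell 0 [:: hub t] = (0 + 2 * t).+1 by rewrite next_cell_cons size_hub /next_cell addn0.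
apply: (computes_eq (computes_seq (S1 _ _) (computes_seq S2 (computes_seq S3 (S4 _ _))))) => //.
have : t * W.+1 <= W.+1 * W.+1 by rewrite leq_mul2r leqW ?orbT.
by move: tW'; clear; nia.
Qed.

Definition reduction_program :=
  Seq (Push OUT false) (Seq (While IN tops (Seq (Pop IN) (Push VARS true))) (Seq (Pop IN)
    (Seq hub_region (Seq var_loop clause_loop)))).

(** Cubic because all clauses are scanned for each side of each variable, at a cost linear in [W]
    for every literal. *)
Lemma reduction_program_bound : exists C, forall t cs W,
  (forall c, c \in cs -> size c = 3 /\ forall x, x \in c -> x.1 <= W) ->
  size (clauses_code cs) <= W -> size cs <= W -> 2 * t <= W ->
  next_cell 0 (regions t cs) <= W ->
  exists sg, computes reduction_program
    (fun r => if r == 0 then enc_nat t ++ clauses_code cs ++ [:: false] else [::]) sg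
    (C * (W.+1 * (W.+1 * W.+1))) /\
  sg OUT = enc_complex (rev (coded (tris 0 (regions t cs)))).
Proof.
have [C1 H1] := hub_region_bound; have [C2 H2] := var_loop_bound; have [C3 H3] := clause_loop_bound.
exists (C1 + C2 + C3 + 10) => t cs W csW codeW sizeW tW nW.
set w := clauses_code cs ++ [:: false].
set sg0 : stack_state := fun r => _.
have S0 : computes (Push OUT false) sg0 (conf (enc_nat t ++ w) [::] 0 0 0 0 0 0 false (enc_complex [::])) 2.
  by step (@computes_push 9 sg0 OUT false).
pose f k := conf (nseq (t - k) true ++ false :: w) [::] k 0 0 0 0 0 false (enc_complex [::]).
have S1 : computes (While IN tops (Seq (Pop IN) (Push VARS true))) (f 0) (f t) (t * 4).+1.
  apply: computes_loop => // [k lt_k|]; last by rewrite /f /= subnn.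
  split; first by rewrite /f /= -(subnSK lt_k).
  apply: (computes_eq (computes_seq (@computes_pop 9 (f k) IN) (@computes_push 9 _ VARS true))) => //.
  by rewrite /f -(subnSK lt_k); regs.
have E0 r : r <= 9 -> f 0 r = conf (enc_nat t ++ w) [::] 0 0 0 0 0 0 false (enc_complex [::]) r.
  by move=> _; rewrite /f subn0 /enc_nat cat_rcons.
have S2 : computes (Pop IN) (f t) (conf w [::] t 0 0 0 0 0 false (enc_complex [::])) 1.
  by rewrite /f subnn; set g := conf _ _ _ _ _ _ _ _ _ _; step (@computes_pop 9 g IN).
have S3 := H1 w t W [::] tW.
pose R1 := flatten [seq var_regions cs i | i <- iota 0 t].
pose R2 := flatten [seq clause_regions j | j <- iota 0 (size cs)].
have ER : regions t cs = [:: hub t] ++ (R1 ++ R2) by [].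
rewrite ER !next_cell_cat in nW.
set n1 := next_cell 0 [:: hub t] in S3 nW; set n2 := next_cell n1 R1 in nW.
set F1 := catrev _ [::] in S3.
have n2W : n2 <= W by apply: leq_trans nW; apply: next_cell_ge.
have tW' : 0 + t <= W by lia.
have S4 := H2 cs t 0 n1 W F1 csW codeW sizeW tW' n2W.
rewrite -/R1 -/n2 in S4; set F2 := catrev _ F1 in S4.
have S5 := H3 cs 0 0 (0 + t) 0 n2 W F2 csW tW' sizeW nW.
rewrite -/R2 in S5; set F3 := catrev _ F2 in S5.
exists (conf [:: false] [::] 0 0 (0 + t) (0 + size cs) (next_cell n2 R2) 0 false (enc_complex F3)); split; last first.
  by rewrite ER 2!tris_cat /coded 2!map_cat /rev 2!catrev_catl.
apply: (computes_eq (computes_seq S0 (computes_seq (computes_eq S1 (fun r h => esym (E0 r h)) (fun _ _ => erefl) (leqnn _))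
  (computes_seq S2 (computes_seq S3 (computes_seq S4 S5)))))) => //.
have b1 : t * (W.+1 * W.+1) <= W.+1 * (W.+1 * W.+1) by rewrite leq_mul2r leqW ?orbT.
have b2 : size cs * W.+1 <= W.+1 * W.+1 by rewrite leq_mul2r leqW ?orbT.
have b3 : W.+1 * W.+1 <= W.+1 * (W.+1 * W.+1) by rewrite leq_pmull.
move: tW' b1 b2 b3; rewrite add0n; clear.
set X := W.+1 * W.+1; set Y := W.+1 * X; set Z := t * X; set U := size cs * W.+1 => tW ZY UX XY.
have -> : C2 * t * X = C2 * Z by rewrite /Z mulnA.
have -> : C3 * size cs * W.+1 = C3 * U by rewrite /U mulnA.
have WX : W <= X by rewrite /X; nia.
have : C2 * Z <= C2 * Y by rewrite leq_mul2l ZY orbT.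
have : C3 * U <= C3 * Y by rewrite leq_mul2l (leq_trans UX XY) orbT.
have : C1 * X <= C1 * Y by rewrite leq_mul2l XY orbT.
have : 0 < X by rewrite muln_gt0.
by nia.
Qed.

(** * Sizes of the code and of the complex *)

Lemma size_clauses_code cs : size cs <= size (clauses_code cs).
Proof.
elim: cs => // c cs IH; rewrite -[clauses_code _]/(clause_code c ++ clauses_code cs) size_cat.
exact: (@leq_add 1).
Qed.

Lemma literal_code_size (cs : seq (seq literal)) c x : c \in cs -> x \in c -> x.1 <= size (clauses_code cs).
Proof.
move=> cC xc; have le_flat (T : eqType) (s : seq T) ss : s \in ss -> size s <= size (flatten ss).
  elim: ss => //= s' ss IH; rewrite inE size_cat => /orP[/eqP ->|/IH H]; first exact: leq_addr.
  by rewrite (leq_trans H) ?leq_addl.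
apply: leq_trans (le_flat _ _ _ (map_f clause_code cC)).
rewrite /clause_code /= leqW //; apply: leq_trans (le_flat _ _ _ (map_f enc_lit xc)).
by rewrite /enc_lit /= /enc_nat size_rcons size_nseq leqW.
Qed.

Lemma size_occs l j cs : (forall c, c \in cs -> size c = 3) -> size (occs l j cs) <= 3 * size cs.
Proof.
elim: cs j => //= c cs IH j cs3; rewrite size_cat.
have {}IH := IH j.+1 (fun c' c'cs => cs3 c' (mem_behead (s := c :: cs) c'cs)).
have : size (clause_occs l j c) <= 3.
  have := cs3 c (mem_head _ _); case: c {cs3} => [|x [|y [|z [|]]]] //= _.
  by rewrite /clause_occs /=; do 3!case: ifP => _.
lia.
Qed.

Lemma next_cell_regions t cs : (forall c, c \in cs -> size c = 3) ->
  next_cell 0 (regions t cs) <= 1 + 2 * t + t * (2 + 6 * size cs) + 5 * size cs.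
Proof.
move=> cs3; rewrite next_cell_cons size_hub /next_cell map_cat sumn_cat.
have H1 i n : sumn [seq (size r.2).+1 | r <- flatten [seq var_regions cs i | i <- iota i n]] <= n * (2 + 6 * size cs).
  elim: n i => //= n IH i; rewrite mulSn; have := IH i.+1.
  by have := size_occs (i, true) 0 cs3; have := size_occs (i, false) 0 cs3; clear; move: (size _) (size _) (size cs) (sumn _) (n * _); lia.
have H2 j n : sumn [seq (size r.2).+1 | r <- flatten [seq clause_regions j | j <- iota j n]] = 5 * n.
  by elim: n j => //= n IH j; rewrite IH; lia.
by have := H1 0 t; rewrite H2; clear; move: (sumn _) (t * _) (5 * _); lia.
Qed.

Lemma reduction_poly_time :
  poly_time enc_cnf3 enc_complex
    (fun phi => rev (coded (tris 0 (regions (nvars phi) (raw_clauses phi))))).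
Proof.
have [C H] := reduction_program_bound.
(* The bound [W] is quadratic in the length of the input and the running time is cubic in [W],
   whence the exponent 6. *)
exists (stack_machine 9 reduction_program), (C * 18 ^ 3), 6 => phi.
set t := nvars phi; set cs := raw_clauses phi; set B := (size _).+1.
have EB : B = (t.+1 + (size (clauses_code cs) + 1)).+1.
  by rewrite /B enc_cnf3E /enc_nat !size_cat size_rcons size_nseq.
(* [next_cell_regions] allows at most [16 * B ^ 2] ring indices; [W] dominates these and all other
   counters. *)
pose W := 17 * B ^ 2.
have cs_ok c : c \in cs -> size c = 3 by case/raw_clauses_ok.
have codeB : size (clauses_code cs) <= B by lia.
have sizeB : size cs <= B := leq_trans (size_clauses_code cs) codeB.
have tB : t < B by lia.
have BW : 2 * B <= W by rewrite /W expnS expn1; move: tB; clear; nia.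
have BW' : B <= W by lia.
have [||||//|sg [Hsg sgO]] := H t cs W.
- move=> c cC; split=> [|x xc]; first exact: cs_ok.
  exact: leq_trans (literal_code_size cC xc) (leq_trans codeB BW').
- exact: leq_trans BW'.
- exact: leq_trans BW'.
- by apply: leq_trans BW; rewrite leq_mul2l ltnW.
- apply: leq_trans (next_cell_regions t cs_ok) _.
  have tsB : t * size cs <= B * B by rewrite leq_mul // ltnW.
  have BB : B <= B * B by rewrite leq_pmulr.
  by rewrite /W expnS expn1; move: (size cs) sizeB tB tsB BB => s; clear; lia.
apply: stack_machine_outputs sgO.
have -> : enc_cnf3 phi = enc_nat t ++ clauses_code cs ++ [:: false] by exact: enc_cnf3E.
apply: computes_le Hsg _; rewrite -mulnA leq_mul2l; apply/orP; right.
have WB : W.+1 <= 18 * B ^ 2 by rewrite /W expnS expn1; move: tB; clear; nia.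
have -> : 18 ^ 3 * B ^ 6 = (18 * B ^ 2) * ((18 * B ^ 2) * (18 * B ^ 2)).
  by rewrite (expnM B 2 3) !expnS !expn0; lia.
by rewrite !leq_mul.
Qed.

Theorem theorem3 :
  exists A : cnf3 -> seq (seq nat),
    poly_time enc_cnf3 enc_complex A /\
    forall phi : cnf3,
      let t := nvars phi in
      let L := complex_of (A phi) in
      let n := #|` vertices L| in
      [/\ simplicial L, pure L & dimension L = 2%R] /\
      [/\ connected L,
          reduced_euler L = (t%:Z)%R &
          [<-> satisfiable phi;
               shellable L;
               exists T, [/\ T `<=` faces L 2, #|` T| = t & collapsible (L `\` T)];
               wsat (skeleton 1 L) K3 = n - 1;
               exists2 T, T `<=` faces L 2 & collapsible (L `\` T)]].
Proof.
exists (fun phi => rev (coded (tris 0 (regions (nvars phi) (raw_clauses phi))))).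
split; first exact: reduction_poly_time.
(* The machine lists the triangles in reverse, which does not change the complex. *)
move=> phi t L; have -> : L = complex_of (coded (tris 0 (regions t (raw_clauses phi)))).
  by apply: eq_complex_of => f; rewrite mem_rev.
exact: reduction.
Qed.
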